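(* Let $M$ be a finitely generated left $D$-module which is $r$-pure with $r\ge1$. Then there exists a finitely generated left $D$-module $L$ with projective dimension $\mathrm{pd}_D(L)\le r$ and a monomorphism $M\hookrightarrow L$ of left $D$-modules.
   Context: $K$ is a differential field with $n$ commuting derivations $\partial_i$, $D=K[d_1,\dots,d_n]$ with $d_ia=ad_i+\partial_ia$. For a finitely presented left $D$-module $M$ with its order filtration, $\dim_K M_{q+s}$ is for $q$ large a polynomial in $s$ of degree $d\le n$ (Hilbert polynomial); the codimension is $\mathrm{cd}(M)=n-d$ (equivalently $n$ minus the dimension of the characteristic variety), with $\mathrm{cd}(0)=\infty$ conventionally. For $0\le r\le n$, $t_r(M)=\{m\in M:\mathrm{cd}(Dm)>r\}$ is the largest submodule of codimension $>r$, and $t_{-1}(M)=M$. $M$ is $r$-pure if $t_r(M)=0$ and $t_{r-1}(M)=M$, i.e. $\mathrm{cd}(Dm)=r$ for every nonzero $m\in M$. *)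

(* Defs.v *)
From HB Require Import structures.
From mathcomp Require Import all_boot all_order all_algebra.
Set Implicit Arguments.
Unset Strict Implicit.
Unset Printing Implicit Defensive.
Import GRing.Theory.
Local Open Scope ring_scope.

Section DModules.
Variables (K : fieldType) (n : nat) (der : 'I_n -> K -> K).

Definition commuting_derivations : Prop :=
  [/\ (forall i a b, der i (a + b) = der i a + der i b),
      (forall i a b, der i (a * b) = der i a * b + a * der i b)
    & (forall i j a, der i (der j a) = der j (der i a))].

(* A left module over D = K[d_1,...,d_n] (d_i a = a d_i + der_i a, d_i d_j = d_j d_i):
   a K-vector space with n additive operators satisfying the defining relations of D. *)
Record dmod := DMod {
  dcar :> lmodType K;
  dop : 'I_n -> dcar -> dcar;
  dop_add : forall i x y, dop i (x + y) = dop i x + dop i y;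
  dop_scale : forall i (a : K) x, dop i (a *: x) = a *: dop i x + der i a *: x;
  dop_comm : forall i j x, dop i (dop j x) = dop j (dop i x) }.

Definition dlinear (M N : dmod) (f : M -> N) : Prop :=
  [/\ (forall x y, f (x + y) = f x + f y),
      (forall (a : K) x, f (a *: x) = a *: f x)
    & (forall i x, f (@dop M i x) = @dop N i (f x))].

Definition dpow (M : dmod) (al : 'I_n -> nat) (x : M) : M :=
  foldr (fun i y => iter (al i) (@dop M i) y) x (enum 'I_n).

Definition Dgenerated (M : dmod) (g : seq M) (x : M) : Prop :=
  exists l : seq (K * ('I_n -> nat) * nat),
    x = \sum_(t <- l) t.1.1 *: dpow t.1.2 (nth 0 g t.2).

Definition fingen (M : dmod) : Prop :=
  exists g : seq M, forall x, Dgenerated g x.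

(* The family {d^alpha m : |alpha| <= s}, spanning D_s m (order filtration on Dm) *)
Definition Dfam (M : dmod) (s : nat) (m : M) : seq M :=
  [seq dpow (fun i => nat_of_ord (f i)) m
  | f : {ffun 'I_n -> 'I_s.+1} <- enum {ffun 'I_n -> 'I_s.+1}
  & (\sum_(i < n) nat_of_ord (f i) <= s)%N].

Definition independent (M : lmodType K) (v : seq M) : Prop :=
  forall c : seq K, \sum_(i < size v) c`_i *: v`_i = 0 ->
    forall i, (i < size v)%N -> c`_i = 0.

Definition span_dim (M : lmodType K) (v : seq M) (k : nat) : Prop :=
  (exists2 w, subseq w v & independent w /\ size w = k) /\
  (forall w, subseq w v -> independent w -> (size w <= k)%N).

Definition hilb_poly (M : dmod) (m : M) (P : {poly rat}) : Prop :=
  exists s0, forall s, (s0 <= s)%N ->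
    exists k, span_dim (Dfam s m) k /\ P.[s%:R] = k%:R.

(* cd(Dm) = c, with None standing for infinity (the case Dm = 0) *)
Definition codim_is (M : dmod) (m : M) (c : option nat) : Prop :=
  exists P, hilb_poly m P /\
    (if P == 0 then c = None else c = Some (n - (size P).-1)%N).

Definition codim_gt (c : option nat) (r : nat) : Prop :=
  match c with None => True | Some c' => (r < c')%N end.

Definition in_t (M : dmod) (r : nat) (m : M) : Prop :=
  exists c, codim_is m c /\ codim_gt c r.

(* M is r-pure: t_r(M) = 0 and t_{r-1}(M) = M (t_{-1}(M) = M) *)
Definition pure (M : dmod) (r : nat) : Prop :=
  (forall m : M, in_t r m -> m = 0) /\
  (forall m : M, r = 0%N \/ in_t r.-1 m).

Definition projective (P : dmod) : Prop :=
  forall (A B : dmod) (p : A -> B) (g : P -> B),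
    dlinear p -> (forall y, exists x, p x = y) -> dlinear g ->
    exists h : P -> A, dlinear h /\ forall x, p (h x) = g x.

(* pd_D(L) <= r : L has a projective resolution of length <= r,
   0 -> P_r -> ... -> P_0 -> L -> 0, unrolled one step at a time *)
Fixpoint pd_le (r : nat) (L : dmod) : Prop :=
  match r with
  | 0 => projective L
  | r'.+1 => exists (P N : dmod) (f : N -> P) (g : P -> L),
      [/\ projective P /\ pd_le r' N, dlinear f /\ dlinear g,
          injective f, (forall y, exists x, g x = y)
        & (forall x, g x = 0 <-> exists z, f z = x)]
  end.

End DModules.

(* Main.v *)
(* Put d = n - r and let R_q be the subring of D generated by K and the first q derivations.
   Purity says that every cyclic submodule Dx, x <> 0, has growth of degree exactly d. Noether
   normalization, i.e. a triangular change of the derivations that keeps the shape of D, makes M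
   finitely generated over R_d, and then torsion-free over R_d, because the torsion submodule
   can be normalized once more, down to R_(d-1), and so has growth of degree < d.

   The antilinear functionals M -> R_d form a left D-module N, finitely generated over R_d, and
   they separate the points of M. Take a resolution G of N by finitely generated free D-modules.
   As N is finitely generated over R_d, the complex Hom_D(G, D) has no cohomology in degrees < r.
   Hence the cokernel L of its map from degree r - 1 to degree r (turned into a left module) has
   a free resolution of length r. Finally, the pairing of M with N, read as a cocycle of
   Hom_(R_d)(G, D) and lifted r times along the exact sequences
   0 -> Hom_(R_(q+1))(G, D) -> Hom_(R_q)(G, D) -> Hom_(R_q)(G, D) -> 0, embeds M into the
   cohomology of Hom_D(G, D) in degree r, hence into L. *)
Require Import Defs.
From HB Require Import structures.
From mathcomp Require Import all_boot all_order all_algebra.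
From mathcomp Require Import boolp functions.
From mathcomp Require Import mpoly ring zify.
From mathcomp Require polyrcf.
Set Implicit Arguments.
Unset Strict Implicit.
Unset Printing Implicit Defensive.
Import GRing.Theory.
Local Open Scope ring_scope.

(** The cohomological steps rest on one degree argument. Write $B_q = \mathrm{Hom}_{R_q}(G, D)$ and
    $\tau_q f(x) = f(d_q x) - d_q f(x)$; the kernel of $\tau_q$ in $B_q$ is $B_{q+1}$. For $q \ge d$
    the module $N$ is finitely generated over $R_q$, so the identity of $G$ is homotopic over $R_q$
    to a map with finitely generated values. Hence, up to coboundaries, a cocycle takes values of
    bounded degree in $d_q$, powers of $d_q$ being written on the right. The term $d_q f(x)$ raises
    this degree, so if $\tau_q f$ is a coboundary, then so are the top coefficient of $f$ and, by
    descent, $f$ itself: $\tau_q$ is injective on cohomology. The vanishing follows; injectivity of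
    the embedding uses the same argument with an error term of degree 0 in $d_q$.

    Normalization must work over any $K$, even with few constants. The operators $d_i + c_i
    d_j^{e_i}$ are of the same kind as the $d_i$ when $c_i$ is constant and $\partial_j^{e_i}$ is
    again a derivation; hence $c_i$ comes from a natural number, and $e_i$ is 1 or, in positive
    characteristic, a power of the characteristic. *)

Lemma expo_ind (n : nat) (P : ('I_n -> nat) -> Prop) :
  P (fun=> 0%N) -> (forall al i, P al -> P (fun k => al k + (k == i))%N) ->
  forall al, P al.
Proof.
move=> P0 PS al; have [N] := ubnP (\sum_k al k)%N; elim: N al => // N IH al HN.
case: (pickP (fun i => al i != 0%N)) => [i ai|al0]; last first.
  by suff -> : al = (fun=> 0%N) by []; apply/funext => k; apply/eqP/negbFE/al0.
pose al' k := (al k - (k == i))%N.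
have E : al = (fun k => al' k + (k == i))%N.
  apply/funext => k; rewrite /al'; case: eqP => [->|]; rewrite ?subn0 ?addn0 ?subnK //.
  by rewrite lt0n.
rewrite E; apply/PS/IH.
rewrite -ltnS (leq_trans _ HN) // ltnS E big_split /= -[X in (X < _)%N]addn0 ltn_add2l.
by rewrite (bigD1 i) //= eqxx.
Qed.

(** * The ring of differential operators *)

Section DmodBasics.
Variables (K : fieldType) (n : nat) (der : 'I_n -> K -> K).
Implicit Types (X Y : dmod der) (i j : 'I_n).

Lemma dop0 X i : dop i (0 : X) = 0.
Proof. by apply: (@addrI _ (dop i 0)); rewrite -dop_add !addr0. Qed.
Lemma dopN X i (x : X) : dop i (- x) = - dop i x.
Proof. by apply: (@addrI _ (dop i x)); rewrite -dop_add !subrr dop0. Qed.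
Lemma dopB X i (x y : X) : dop i (x - y) = dop i x - dop i y.
Proof. by rewrite dop_add dopN. Qed.
Lemma dop_sum X i (I : Type) (s : seq I) (P : pred I) (F : I -> X) :
  dop i (\sum_(k <- s | P k) F k) = \sum_(k <- s | P k) dop i (F k).
Proof. by apply: (big_morph _ (dop_add i) (dop0 X i)). Qed.

Lemma dop_iterC X i j k (x : X) :
  dop i (iter k (@dop _ _ _ X j) x) = iter k (@dop _ _ _ X j) (dop i x).
Proof. by elim: k => //= k IH; rewrite dop_comm IH. Qed.

Lemma dpow_dop X al i (x : X) : dpow al (dop i x) = dop i (dpow al x).
Proof.
rewrite /dpow; elim: (enum _) => //= j s ->.
by rewrite dop_iterC.
Qed.

Lemma eq_dpow X al be (x : X) : al =1 be -> dpow al x = dpow be x.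
Proof. by move=> E; rewrite /dpow; elim: (enum _) => //= j s ->; rewrite E. Qed.

Lemma dpow0 X al (x : X) : al =1 (fun _ => 0%N) -> dpow al x = x.
Proof. by move=> E; rewrite /dpow; elim: (enum _) => //= j s ->; rewrite E. Qed.

Lemma dpowS X al i (x : X) :
  dpow (fun k => al k + (k == i))%N x = dop i (dpow al x).
Proof.
rewrite /dpow.
have: uniq (enum 'I_n) := enum_uniq _.
have: i \in enum 'I_n by rewrite mem_enum.
elim: (enum _) => //= j s IH; rewrite inE => /orP[/eqP <-|si] /andP[js us].
  rewrite eqxx addn1 iterS; congr (dop _ (iter _ _ _)).
  elim: s js {IH us} => //= k s IH; rewrite inE negb_or => /andP[ik /IH->].
  by rewrite eq_sym (negbTE ik) addn0.
rewrite IH // dop_iterC; case: eqP => [ji|_]; last by rewrite addn0.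
by rewrite ji si in js.
Qed.

(** Linearity over $R_q$: [q = 0] gives the $K$-linear maps and [q = n] the $D$-linear ones. *)
Definition qlin (q : nat) X Y (f : X -> Y) : Prop :=
  [/\ forall x y, f (x + y) = f x + f y,
      forall (a : K) x, f (a *: x) = a *: f x
    & forall i x, (i < q)%N -> f (dop i x) = dop i (f x)].

Lemma qlin_dlin X Y (f : X -> Y) : dlinear f <-> qlin n f.
Proof. by split=> -[fD fZ fd]; split=> // i x *; rewrite fd. Qed.

Lemma qlin_le p q X Y (f : X -> Y) : (p <= q)%N -> qlin q f -> qlin p f.
Proof. by move=> pq [fD fZ fd]; split=> // i x ip; apply/fd/(leq_trans ip). Qed.

Lemma qlin0 q X Y (f : X -> Y) : qlin q f -> f 0 = 0.
Proof. by case=> fD _ _; apply: (@addrI _ (f 0)); rewrite -fD !addr0. Qed.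
Lemma qlinN q X Y (f : X -> Y) x : qlin q f -> f (- x) = - f x.
Proof. by case=> _ fZ _; rewrite -scaleN1r fZ scaleN1r. Qed.
Lemma qlinB q X Y (f : X -> Y) x y : qlin q f -> f (x - y) = f x - f y.
Proof. by move=> H; case: (H) => fD _ _; rewrite fD (qlinN _ H). Qed.
Lemma qlin_sum q X Y (f : X -> Y) (I : Type) (s : seq I) (P : pred I) (F : I -> X) :
  qlin q f -> f (\sum_(k <- s | P k) F k) = \sum_(k <- s | P k) f (F k).
Proof. by move=> H; case: (H) => fD _ _; apply: (big_morph _ fD (qlin0 H)). Qed.

Lemma qlin_comp q X Y (Z : dmod der) (g : Y -> Z) (f : X -> Y) :
  qlin q g -> qlin q f -> qlin q (fun x => g (f x)).
Proof.
move=> [gD gZ gd] [fD fZ fd]; split=> [x y|a x|i x iq].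
- by rewrite fD gD.
- by rewrite fZ gZ.
- by rewrite fd // gd.
Qed.
Lemma qlin_id q X : qlin q (fun x : X => x). Proof. by []. Qed.
Lemma qlin_cst0 q X Y : qlin q (fun _ : X => 0 : Y).
Proof. by split=> *; rewrite ?addr0 ?scaler0 ?dop0. Qed.
Lemma qlin_add q X Y (f g : X -> Y) : qlin q f -> qlin q g -> qlin q (fun x => f x + g x).
Proof.
move=> [fD fZ fd] [gD gZ gd]; split=> [x y|a x|i x iq].
- by rewrite fD gD addrACA.
- by rewrite fZ gZ scalerDr.
- by rewrite fd // gd // dop_add.
Qed.
Lemma qlin_opp q X Y (f : X -> Y) : qlin q f -> qlin q (fun x => - f x).
Proof.
move=> [fD fZ fd]; split=> [x y|a x|i x iq].
- by rewrite fD opprD.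
- by rewrite fZ scalerN.
- by rewrite fd // dopN.
Qed.
Lemma qlin_sub q X Y (f g : X -> Y) : qlin q f -> qlin q g -> qlin q (fun x => f x - g x).
Proof. by move=> F G; apply: qlin_add => //; apply: qlin_opp. Qed.

Lemma qlin_dpow q X Y (f : X -> Y) (al : 'I_n -> nat) x :
  qlin q f -> (forall i, (q <= i)%N -> al i = 0%N) -> f (dpow al x) = dpow al (f x).
Proof.
move=> [_ _ fd]; elim/expo_ind: al => [|al i IH] Hal; first by rewrite !dpow0.
have iq : (i < q)%N by rewrite ltnNge; apply/negP => /Hal; rewrite eqxx addn1.
rewrite !dpowS fd // IH // => k /Hal; by case: (al k).
Qed.

Definition lext X (F : 'X_{1..n} -> X) (p : {mpoly K[n]}) : X :=
  \sum_(m <- msupp p) p@_m *: F m.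

Lemma lext_sup X F p (s : seq 'X_{1..n}) : uniq s -> {subset msupp p <= s} ->
  lext F p = \sum_(m <- s) p@_m *: F m :> X.
Proof.
move=> us ps; rewrite /lext [RHS](bigID (mem (msupp p))) /=.
rewrite [X in _ + X]big1 ?addr0; last by move=> m /memN_msupp_eq0->; rewrite scale0r.
rewrite -[RHS]big_filter; apply: perm_big; apply: uniq_perm => [||m].
- exact: msupp_uniq.
- exact: filter_uniq.
- by rewrite mem_filter; case: (boolP (m \in msupp p)) => //= /ps->.
Qed.
Lemma lextD X F p p' : lext F (p + p') = lext F p + lext F p' :> X.
Proof.
pose s := undup (msupp p ++ msupp p').
have us : uniq s by apply: undup_uniq.
have sub q : {subset msupp q <= msupp p ++ msupp p'} -> {subset msupp q <= s}.
  by move=> H m /H; rewrite mem_undup.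
have Hp : {subset msupp p <= s} by apply: sub => m mp; rewrite mem_cat mp.
have Hp' : {subset msupp p' <= s} by apply: sub => m mp; rewrite mem_cat mp orbT.
have Hs : {subset msupp (p + p') <= s} by apply: sub => m /msuppD_le.
rewrite (lext_sup _ us Hs) (lext_sup _ us Hp) (lext_sup _ us Hp') -big_split /=.
by apply: eq_bigr => m _; rewrite mcoeffD scalerDl.
Qed.
Lemma lextZ X F a p : lext F (a *: p) = a *: lext F p :> X.
Proof.
rewrite (@lext_sup _ _ _ (msupp p)) ?msupp_uniq //; last by move=> m /msuppZ_le.
by rewrite /lext scaler_sumr; apply: eq_bigr => m _; rewrite mcoeffZ scalerA.
Qed.
Lemma lext0 X F : lext F 0 = 0 :> X.
Proof. by rewrite /lext msupp0 big_nil. Qed.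
Lemma lext_sumr X F (I : Type) (s : seq I) (G : I -> {mpoly K[n]}) :
  lext F (\sum_(k <- s) G k) = \sum_(k <- s) lext F (G k) :> X.
Proof. by apply: (big_morph _ (lextD F) (lext0 F)). Qed.
Lemma lextX X F m : lext F 'X_[m] = F m :> X.
Proof. by rewrite /lext msuppX big_seq1 mcoeffX eqxx scale1r. Qed.
Lemma lext_add X (F G : 'X_{1..n} -> X) p : lext (fun m => F m + G m) p = lext F p + lext G p.
Proof. by rewrite /lext -big_split; apply: eq_bigr => m _; rewrite scalerDr. Qed.

(* The action of the differential operator [sum_m p_m d^m]. *)
Definition act X (p : {mpoly K[n]}) (x : X) : X := lext (fun m : 'X_{1..n} => dpow m x) p.

Lemma actD X p p' (x : X) : act (p + p') x = act p x + act p' x.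
Proof. exact: lextD. Qed.
Lemma actZ X a p (x : X) : act (a *: p) x = a *: act p x.
Proof. exact: lextZ. Qed.
Lemma act0 X (x : X) : act 0 x = 0.
Proof. exact: lext0. Qed.
Lemma actN X p (x : X) : act (- p) x = - act p x.
Proof. by rewrite -(scaleN1r p) actZ scaleN1r. Qed.
Lemma actX X m (x : X) : act 'X_[m] x = dpow m x.
Proof. exact: lextX. Qed.
Lemma act1 X (x : X) : act 1 x = x.
Proof. by rewrite -mpolyX0 actX dpow0 // => i; rewrite mnm0E. Qed.

Lemma qlin_act X Y (f : X -> Y) p x : qlin n f -> f (act p x) = act p (f x).
Proof.
move=> H; case: (H) => _ fZ _; rewrite /act /lext (qlin_sum _ _ _ H).
by apply: eq_bigr => m _; rewrite fZ (qlin_dpow _ H) // => i; rewrite leqNgt ltn_ord.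
Qed.
Lemma act_add X p (x y : X) : act p (x + y) = act p x + act p y.
Proof.
rewrite /act -lext_add; apply: eq_bigr => m _ /=; congr (_ *: _).
rewrite /dpow; elim: (enum _) => //= i s ->.
by elim: (m i) => //= k ->; rewrite dop_add.
Qed.
Lemma act_0 X p : act p (0 : X) = 0.
Proof. by apply: (@addrI _ (act p 0)); rewrite -act_add !addr0. Qed.
End DmodBasics.

Section Diffop.
Variables (K : fieldType) (n : nat) (der : 'I_n -> K -> K).

(* The carrier of the ring [D]: the polynomial [sum_m p_m X^m] stands for [sum_m p_m d^m]. *)
Definition wop of commuting_derivations der := {mpoly K[n]}.

Variable h : commuting_derivations der.
Notation W := (wop h).
HB.instance Definition _ := GRing.Lmodule.on W.

Lemma derD i a b : der i (a + b) = der i a + der i b. Proof. by case: h. Qed.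
Lemma derM i a b : der i (a * b) = der i a * b + a * der i b. Proof. by case: h. Qed.
Lemma derC i j a : der i (der j a) = der j (der i a). Proof. by case: h. Qed.
Lemma der0 i : der i 0 = 0.
Proof. by apply: (@addrI _ (der i 0)); rewrite -derD !addr0. Qed.
Lemma der1 i : der i 1 = 0.
Proof. by have := derM i 1 1; rewrite !mulr1 mul1r -[LHS]addr0 => /addrI. Qed.

(** This is the commutator $[d_i, p]$: the $d_k$ commute with each other, so only the coefficients
    are differentiated. *)
Definition cder i (p : {mpoly K[n]}) : {mpoly K[n]} :=
  \sum_(m <- msupp p) der i p@_m *: 'X_[m].
Lemma coef_cder i p m : (cder i p)@_m = der i p@_m.
Proof.
rewrite /cder raddf_sum /=.
under eq_bigr do rewrite mcoeffZ mcoeffX.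
case: (boolP (m \in msupp p)) => [mp|mp].
  rewrite (bigD1_seq m) ?msupp_uniq //= eqxx mulr1 big1 ?addr0 //.
  by move=> k /negbTE->; rewrite mulr0.
rewrite (memN_msupp_eq0 mp) der0 big_seq big1 // => k kp.
by case: eqP => [E|]; rewrite ?mulr0 //; rewrite -E kp in mp.
Qed.
Lemma cderD i p q : cder i (p + q) = cder i p + cder i q.
Proof. by apply/mpolyP=> m; rewrite mcoeffD !coef_cder mcoeffD derD. Qed.
Lemma cderZ i a p : cder i (a *: p) = a *: cder i p + der i a *: p.
Proof.
by apply/mpolyP=> m; rewrite mcoeffD !mcoeffZ !coef_cder mcoeffZ derM addrC.
Qed.
Lemma cderC i j p : cder i (cder j p) = cder j (cder i p).
Proof. by apply/mpolyP=> m; rewrite !coef_cder derC. Qed.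
Lemma coef_mulX (p : {mpoly K[n]}) (u m : 'X_{1..n}) :
  ('X_[u] * p)@_m = if (u <= m)%MM then p@_(m - u) else 0.
Proof.
rewrite -commr_mpolyX; case: ifP => um; first by rewrite -(mcoeffMX p u (m - u)) addmC submK.
apply: memN_msupp_eq0; rewrite (perm_mem (msuppMX _ _)).
by apply/negP => /mapP[k _ E]; rewrite E lem_addr in um.
Qed.
Lemma cderXM i u p : cder i ('X_[u] * p) = 'X_[u] * cder i p.
Proof.
apply/mpolyP=> m; rewrite coef_cder !coef_mulX; case: ifP => _; first by rewrite coef_cder.
by rewrite der0.
Qed.
Lemma cderX i u : cder i 'X_[u] = 0.
Proof. by apply/mpolyP=> m; rewrite coef_cder mcoeffX mcoeff0; case: eqP; rewrite ?der0 ?der1. Qed.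

(** Left multiplication by $d_i$, from $d_i a = a d_i + \partial_i a$. It makes the polynomials a
    module before any product is available. *)
Definition wd i (p : W) : W := 'X_i * p + cder i p.
Definition wmod : dmod der.
Proof.
refine (@DMod K n der W wd _ _ _).
- by move=> i x y; rewrite /wd mulrDr cderD addrACA.
- by move=> i a x; rewrite /wd cderZ scalerDr -scalerAr addrA.
- move=> i j x; rewrite /wd !cderD !mulrDr !cderXM (cderC i j).
  rewrite !mulrA (mulrC 'X_i) -!addrA; congr (_ + _).
  by rewrite !addrA; congr (_ + _); rewrite addrC.
Defined.

Lemma wdD i (p q : W) : wd i (p + q) = wd i p + wd i q.
Proof. exact: (@dop_add _ _ _ wmod). Qed.
Lemma wdZ i a (p : W) : wd i (a *: p) = a *: wd i p + der i a *: p.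
Proof. exact: (@dop_scale _ _ _ wmod). Qed.

Lemma wdpow1 m (u : 'X_{1..n}) : dpow m ('X_[u] : wmod) = 'X_[[multinom m i | i < n] + u].
Proof.
elim/expo_ind: m => [|m i IH].
  by rewrite dpow0 //; congr 'X_[_]; apply/mnmP => k; rewrite mnmDE mnmE.
rewrite dpowS IH /= /wd cderX addr0 -mpolyXD; congr 'X_[_]; apply/mnmP => k.
rewrite !mnmDE !mnmE (eq_sym k i). lia.
Qed.
Lemma mnm_id (m : 'X_{1..n}) : [multinom m i | i < n] = m.
Proof. by apply/mnmP => i; rewrite mnmE. Qed.

Lemma act_1 (p : W) : act p (1 : wmod) = p.
Proof.
rewrite [RHS]mpolyE; apply: eq_bigr => m _; congr (_ *: _).
by rewrite -mpolyX0 wdpow1 addm0 mnm_id.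
Qed.

Lemma wdE i (p : W) : wd i p =
  \sum_(m <- msupp p) (p@_m *: 'X_[U_(i) + m] + der i p@_m *: 'X_[m]).
Proof.
rewrite big_split /= -/(cder i p) /wd; congr (_ + _).
by rewrite {1}[p]mpolyE mulr_sumr; apply: eq_bigr => m _; rewrite -scalerAr mpolyXD.
Qed.
Lemma lext_wd (X : dmod der) F i (p : W) : (forall m, F (U_(i) + m)%MM = dop i (F m)) ->
  lext F (wd i p) = dop i (lext F p) :> X.
Proof.
move=> HF; rewrite wdE lext_sumr /lext dop_sum; apply: eq_bigr => m _.
by rewrite dop_scale -/(lext F _) lextD !lextZ !lextX HF.
Qed.
Lemma act_wd (X : dmod der) i (p : W) (x : X) : act (wd i p) x = dop i (act p x).
Proof.
apply: lext_wd => m; rewrite -dpowS; apply: eq_dpow => k.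
by rewrite mnmDE mnm1E addnC eq_sym.
Qed.

Lemma act_qlin (X : dmod der) (x : X) : qlin n (fun p : wmod => act p x).
Proof. by split=> [p q|a p|i p _]; [exact: actD | exact: actZ | exact: act_wd]. Qed.

(** Taking the action on [wmod] as product reduces associativity to the $D$-linearity of $p \mapsto
    p x$. *)
Definition wmul (p q : W) : W := @act _ _ _ wmod p q.
Lemma act_wmul (X : dmod der) p q (x : X) : act (wmul p q) x = act p (act q x).
Proof. exact: (qlin_act _ _ (act_qlin x)). Qed.

Lemma wmulA : associative wmul.
Proof. by move=> p q s; rewrite /wmul -act_wmul. Qed.
Lemma wmul1 : right_id (1 : {mpoly K[n]}) wmul. Proof. exact: act_1. Qed.
Lemma w1mul : left_id (1 : {mpoly K[n]}) wmul. Proof. by move=> p; exact: (@act1 _ _ _ wmod). Qed.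
Lemma wmulDl : left_distributive wmul +%R.
Proof. by move=> p q s; exact: (@actD _ _ _ wmod). Qed.
Lemma wmulDr : right_distributive wmul +%R.
Proof. by move=> p q s; exact: (@act_add _ _ _ wmod). Qed.
Lemma w1neq0 : (1 : {mpoly K[n]}) != 0. Proof. exact: oner_neq0. Qed.
HB.instance Definition _ := GRing.Zmodule_isNzRing.Build W wmulA w1mul wmul1 wmulDl wmulDr w1neq0.

Lemma actM (X : dmod der) (p q : W) (x : X) : act (p * q : W) x = act p (act q x).
Proof. exact: act_wmul. Qed.
Lemma act_mul (p q : W) : act p (q : wmod) = p * q. Proof. by []. Qed.
Lemma wscaleAl (a : K) (p q : W) : (a *: p : W) * q = a *: (p * q : W).
Proof. exact: (@actZ _ _ _ wmod). Qed.
Definition wX (i : 'I_n) : W := 'X_i.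
Lemma wXmul i (p : W) : wX i * p = wd i p.
Proof.
have -> : wX i = wd i (1 : {mpoly K[n]}) by rewrite /wd mulr1 -mpolyX0 cderX addr0.
by rewrite -act_mul act_wd act1.
Qed.
Lemma wd_mul i (p q : W) : wd i p * q = wd i (p * q).
Proof. by rewrite -!wXmul mulrA. Qed.

(** Coefficients stand on the left, so $d_i$ multiplied on the right only raises exponents. *)
Lemma mulwX i (p : W) : p * wX i = 'X_i * (p : {mpoly K[n]}) :> {mpoly K[n]}.
Proof.
rewrite -act_mul /act /lext.
rewrite {3}[p]mpolyE mulr_sumr; apply: eq_bigr => m _.
by rewrite wdpow1 -scalerAr -mpolyXD addmC mnm_id.
Qed.
Lemma mulwXn i k (p : W) : p * wX i ^+ k = 'X_[U_(i) *+ k] * (p : {mpoly K[n]}) :> {mpoly K[n]}.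
Proof.
elim: k => [|k IH]; first by rewrite expr0 mulr1 mulm0n mpolyX0 mul1r.
by rewrite exprSr mulrA mulwX IH mulrA -mpolyXD mulmS.
Qed.
End Diffop.

(** * Noetherianity and the Ore condition *)

Section Gen.
Variables (K : fieldType) (n : nat) (der : 'I_n -> K -> K).

(** The $R_q$-submodule generated by [s]. In this form all the rings $R_q$ act on the one type
    [dmod] of $D$-modules. *)
Inductive gen (q : nat) (X : dmod der) (s : seq X) : X -> Prop :=
| gen_in x of x \in s : gen q s x
| gen_0 : gen q s 0
| gen_add x y of gen q s x & gen q s y : gen q s (x + y)
| gen_scale a x of gen q s x : gen q s (a *: x)
| gen_dop (i : 'I_n) x of (i < q)%N & gen q s x : gen q s (dop i x).

Definition subq (q : nat) (X : dmod der) (W : X -> Prop) : Prop :=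
  [/\ W 0, forall x y, W x -> W y -> W (x + y), forall a x, W x -> W (a *: x)
    & forall (i : 'I_n) x, (i < q)%N -> W x -> W (dop i x)].

Section Fixed.
Variables (q : nat) (X : dmod der).
Implicit Types (W : X -> Prop) (s : seq X) (x y : X) (i : 'I_n).

Lemma gen_subq s : subq q (gen q s).
Proof. by split=> *; [exact: gen_0|exact: gen_add|exact: gen_scale|exact: gen_dop]. Qed.

Lemma gen_min s W : subq q W -> (forall x, x \in s -> W x) -> forall x, gen q s x -> W x.
Proof.
by move=> [W0 WD WZ Wd] sW x; elim=> {x} [||*|*|*]; [exact: sW| |exact: WD|exact: WZ|exact: Wd].
Qed.

Lemma subq_opp W x : subq q W -> W x -> W (- x).
Proof. by move=> [_ _ WZ _] Wx; rewrite -scaleN1r; apply: WZ. Qed.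
Lemma subq_sub W x y : subq q W -> W x -> W y -> W (x - y).
Proof. by move=> HW Wx Wy; case: (HW) => _ WD _ _; apply: WD => //; apply: subq_opp. Qed.
Lemma subq_sum W (I : Type) (r : seq I) (P : pred I) (F : I -> X) :
  subq q W -> (forall k, P k -> W (F k)) -> W (\sum_(k <- r | P k) F k).
Proof. by move=> [W0 WD _ _] WF; elim/big_ind: _. Qed.
Lemma subq_sum_seq W (I : eqType) (r : seq I) (F : I -> X) :
  subq q W -> (forall k, k \in r -> W (F k)) -> W (\sum_(k <- r) F k).
Proof. by move=> [W0 WD _ _] WF; rewrite big_seq; elim/big_ind: _. Qed.
Lemma subq_iter W i k x : (i < q)%N -> subq q W -> W x -> W (iter k (@dop _ _ _ X i) x).
Proof. by move=> iq [_ _ _ Wd] Wx; elim: k => //= k IH; apply: Wd. Qed.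
Lemma subq_dpow W (al : 'I_n -> nat) x : subq q W -> (forall i, (q <= i)%N -> al i = 0%N) ->
  W x -> W (dpow al x).
Proof.
move=> HW Hal Wx; rewrite /dpow; elim: (enum _) => //= i s IH.
case: (ltnP i q) => [iq|/Hal->//]; exact: subq_iter.
Qed.
End Fixed.

Lemma subq_le p q (X : dmod der) W : (p <= q)%N -> @subq q X W -> @subq p X W.
Proof. by move=> pq [W0 WD WZ Wd]; split=> // i x ip; apply/Wd/(leq_trans ip). Qed.
Lemma gen_le p q (X : dmod der) s x : (p <= q)%N -> @gen p X s x -> gen q s x.
Proof.
move=> pq; apply: gen_min => [|y]; last exact: gen_in.
exact: subq_le pq (gen_subq _ _).
Qed.
Lemma gen_sub q (X : dmod der) (s t : seq X) : {subset s <= t} -> forall x, gen q s x -> gen q t x.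
Proof. by move=> st; apply: gen_min => [|y /st]; [exact: gen_subq|exact: gen_in]. Qed.

Lemma subq_and q (X : dmod der) (W V : X -> Prop) : subq q W -> subq q V -> subq q (fun x => W x /\ V x).
Proof.
move=> [W0 WD WZ Wd] [V0 VD VZ Vd]; split=> //.
- by move=> x y [? ?] [? ?]; split; [apply: WD|apply: VD].
- by move=> a x [? ?]; split; [apply: WZ|apply: VZ].
- by move=> i x iq [? ?]; split; [apply: Wd|apply: Vd].
Qed.

Lemma gen_image q (X Y : dmod der) (f : X -> Y) s x : qlin q f -> gen q s x -> gen q (map f s) (f x).
Proof.
move=> H; case: (H) => fD fZ fd; elim=> {x} [x xs||x y _ IH1 _ IH2|a x _ IH|i x iq _ IH].
- by apply/gen_in/map_f.
- by rewrite (qlin0 H); apply: gen_0.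
- by rewrite fD; apply: gen_add.
- by rewrite fZ; apply: gen_scale.
- by rewrite fd //; apply: gen_dop.
Qed.

Definition fgq q (X : dmod der) (W : X -> Prop) : Prop := exists s, forall x, W x <-> gen q s x.

(** Over $R_0 = K$: one element of [W] with a nonzero coordinate along [z], if there is any,
    eliminates [z] from all the others. *)
Lemma noeth0 (X : dmod der) (s : seq X) (W : X -> Prop) :
  subq 0 W -> (forall x, W x -> gen 0 s x) -> fgq 0 W.
Proof.
elim: s W => [|z s IH] W HW Ws.
  exists [::] => x; split=> [/Ws//|]; exact: gen_min.
have dec x : gen 0 (z :: s) x -> exists a, gen 0 s (x - a *: z).
  elim=> {x} [x||x y _ [a Ha] _ [b Hb]|c x _ [a Ha]|//].
  - rewrite inE => /orP[/eqP->|xs]; first by exists 1; rewrite scale1r subrr; apply: gen_0.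
    by exists 0; rewrite scale0r subr0; apply: gen_in.
  - by exists 0; rewrite scale0r subrr; apply: gen_0.
  - by exists (a + b); rewrite scalerDl opprD addrACA; apply: gen_add.
  - by exists (c * a); rewrite -scalerA -scalerBr; apply: gen_scale.
have [t Ht] := IH (fun x => W x /\ gen 0 s x) (subq_and HW (gen_subq _ _)) (fun _ => @proj2 _ _).
have tW x : gen 0 t x -> W x by move=> /Ht[].
case: (pselect (exists a w, [/\ a != 0, W w & gen 0 s (w - a *: z)])) => [[a [w [a0 Ww wa]]]|none].
  exists (w :: t) => x; split=> [Wx|].
    have [b xb] := dec _ (Ws _ Wx).
    rewrite -(subrK ((b / a) *: w) x); apply: gen_add; last first.
      by apply/gen_scale/gen_in; rewrite mem_head.
    apply: (@gen_sub _ _ t); first by move=> y yt; rewrite inE yt orbT.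
    apply/Ht; split; first by apply: (subq_sub HW Wx); case: HW => _ _ WZ _; apply: WZ.
    have -> : x - (b / a) *: w = (x - b *: z) - (b / a) *: (w - a *: z).
      by rewrite scalerBr scalerA divfK // opprB addrA subrK.
    by apply: subq_sub (gen_subq _ _) xb _; apply: gen_scale.
  apply: (gen_min HW) => y; rewrite inE => /orP[/eqP->//|yt]; exact/tW/gen_in.
exists t => x; split=> [Wx|]; last exact: tW.
apply/Ht; split=> //; have [b xb] := dec _ (Ws _ Wx).
case: (eqVneq b 0) xb => [->|b0 xb]; first by rewrite scale0r subr0.
by case: none; exists b, x.
Qed.

Section NoethStep.
Variables (j : 'I_n) (X : dmod der) (g : seq X).
Notation q := (nat_of_ord j).
Notation d := (@dop _ _ _ X j).
Notation dk k := (iter k d).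

(** The part of order less than [k] in $d_j$. As [X] need not be free, an element can have several
    leading coefficients; this is why [lead] is a relation. *)
Definition ord_lt k : X -> Prop := gen q [seq dk i x | i <- iota 0 k, x <- g].

Lemma ord_lt_in k i z : (i < k)%N -> z \in g -> ord_lt k (dk i z).
Proof. by move=> ik zg; apply/gen_in/allpairs_f; rewrite ?mem_iota. Qed.
Lemma ord_ltP k x : x \in [seq dk i x | i <- iota 0 k, x <- g] ->
  exists i z, [/\ (i < k)%N, z \in g & x = dk i z].
Proof.
by case/allpairsP => -[i z] [ik zg ->]; exists i, z; split=> //; move: ik; rewrite mem_iota.
Qed.
Lemma ord_lt_le k l x : (k <= l)%N -> ord_lt k x -> ord_lt l x.
Proof.
move=> kl; apply: gen_min => [|y /ord_ltP[i [z [ik zg ->]]]]; first exact: gen_subq.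
by apply: ord_lt_in => //; apply: leq_trans kl.
Qed.
Lemma ord_lt_dop k x : ord_lt k x -> ord_lt k.+1 (d x).
Proof.
elim=> {x} [x /ord_ltP[i [z [ik zg ->]]]||x y _ IH1 _ IH2|a x Hx IH|i x iq _ IH].
- exact: (@ord_lt_in _ i.+1).
- rewrite dop0; exact: gen_0.
- by rewrite dop_add; apply: gen_add.
- rewrite dop_scale; apply: gen_add; apply: gen_scale => //; exact: ord_lt_le Hx.
- by rewrite dop_comm; apply: gen_dop.
Qed.
Lemma ord_lt_iter k l x : ord_lt k x -> ord_lt (l + k) (dk l x).
Proof. by move=> Hx; elim: l => //= l IH; apply: ord_lt_dop. Qed.
Lemma ord_lt_gen y : gen q g y -> ord_lt 1 y.
Proof.
apply: gen_min => [|z zg]; [exact: gen_subq|exact: (@ord_lt_in _ 0)].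
Qed.
Lemma ord_lt_comm k a y : gen q g y -> ord_lt k (a *: dk k y - dk k (a *: y)).
Proof.
move=> gy; elim: k a => [|k IH] a; first by rewrite subrr; apply: gen_0.
have /ord_lt_dop := IH a; rewrite dopB dop_scale /= => H.
rewrite -(addrK (der j a *: dk k y) (a *: _)) addrAC.
apply: subq_sub (gen_subq _ _) H _; apply: gen_scale.
by rewrite -[k.+1]addn1; apply/ord_lt_iter/ord_lt_gen.
Qed.
Lemma ord_lt_lead k x : ord_lt k.+1 x -> exists2 y, gen q g y & ord_lt k (x - dk k y).
Proof.
elim=> {x} [x /ord_ltP[i [z [ik zg ->]]]||x x' _ [y gy H] _ [y' gy' H']|a x _ [y gy H]|i x iq _ [y gy H]].
- case: (ltnP i k) => [lt|ge].
    exists 0; first exact: gen_0.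
    have -> : dk k 0 = 0 by elim: (k) => //= l ->; rewrite dop0.
    by rewrite subr0; apply: ord_lt_in.
  exists z; first exact: gen_in.
  have -> : i = k by lia.
  rewrite subrr; exact: gen_0.
- exists 0; first exact: gen_0.
  have -> : dk k 0 = 0 by elim: (k) => //= l ->; rewrite dop0.
  rewrite subr0; exact: gen_0.
- exists (y + y'); first exact: gen_add.
  have -> : dk k (y + y') = dk k y + dk k y' by elim: (k) => //= l ->; rewrite dop_add.
  by rewrite opprD addrACA; apply: gen_add.
- exists (a *: y); first exact: gen_scale.
  rewrite -(subrK (a *: dk k y) (a *: x)) -scalerBr -addrA; apply: gen_add.
    exact: gen_scale.
  exact: ord_lt_comm.
- exists (dop i y); first exact: gen_dop.
  rewrite -dop_iterC -dopB; exact: gen_dop.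
Qed.

Variable W : X -> Prop.
Hypothesis HW : subq q.+1 W.

(* The elements of [gen q g] that are leading coefficients, in degree [k], of elements of [V] *)
Definition lead (V : X -> Prop) k y := gen q g y /\ exists2 w, V w & ord_lt k (w - dk k y).

Lemma lead_subq V k : subq q.+1 V -> subq q (lead V k).
Proof.
move=> [V0 VD VZ Vd]; split.
- split; [exact: gen_0|exists 0 => //].
  have -> : dk k 0 = 0 by elim: (k) => //= l ->; rewrite dop0.
  rewrite subr0; exact: gen_0.
- move=> x y [gx [w Vw H]] [gy [w' Vw' H']]; split; first exact: gen_add.
  exists (w + w'); first exact: VD.
  have -> : dk k (x + y) = dk k x + dk k y by elim: (k) => //= l ->; rewrite dop_add.
  by rewrite opprD addrACA; apply: gen_add.
- move=> a x [gx [w Vw H]]; split; first exact: gen_scale.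
  exists (a *: w); first exact: VZ.
  rewrite -(subrK (a *: dk k x) (a *: w)) -scalerBr -addrA; apply: gen_add.
    exact: gen_scale.
  exact: ord_lt_comm.
- move=> i x iq [gx [w Vw H]]; split; first exact: gen_dop.
  exists (dop i w); first by apply: Vd => //; apply: ltnW.
  rewrite -dop_iterC -dopB; exact: gen_dop.
Qed.
Lemma lead_mono V k l y : subq q.+1 V -> (k <= l)%N -> lead V k y -> lead V l y.
Proof.
move=> HV kl [gy [w Vw H]]; split=> //; exists (dk (l - k) w); first exact: (subq_iter _ (ltnSn _) HV).
have := ord_lt_iter (l - k) H; rewrite subnK //; have -> : dk l y = dk (l - k) (dk k y) by rewrite -iterD subnK.
suff -> : dk (l - k) (w - dk k y) = dk (l - k) w - dk (l - k) (dk k y) by [].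
by elim: (l - k)%N => //= i ->; rewrite dopB.
Qed.

Hypothesis IH : forall V : X -> Prop, subq q V -> (forall x, V x -> gen q g x) -> fgq q V.

(** The leading coefficients of degree [k] form an $R_q$-submodule of [gen q g], so finitely many
    elements of [W] account for all of them. *)
Lemma lead_fin k : exists2 T : seq X, (forall x, x \in T -> W x) &
  forall y, lead W k y -> lead (gen q.+1 T) k y.
Proof.
have [v Hv] := IH (lead_subq k HW) (fun _ => @proj1 _ _).
have: forall y, y \in v -> lead W k y by move=> y yv; apply/Hv/gen_in.
have: exists2 T : seq X, (forall x, x \in T -> W x) &
    forall y, y \in v -> lead (gen q.+1 T) k y.
  have: forall y, y \in v -> lead W k y by move=> y yv; apply/Hv/gen_in.
  elim: (v) => [|z s IHs] Hs; first by exists [::].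
  have [|T TW HT] := IHs; first by move=> y ys; apply: Hs; rewrite inE ys orbT.
  have [gz [w Ww Hw]] := Hs z (mem_head _ _).
  exists (w :: T) => [x|y]; rewrite inE => /orP[/eqP->//|]; first exact: TW.
    by split=> //; exists w => //; apply: gen_in; rewrite mem_head.
  move=> /HT[gy [w' Ww' Hw']]; split=> //; exists w' => //.
  by apply: gen_sub Ww' => x xT; rewrite inE xT orbT.
case=> T TW HT _; exists T => // y /Hv; apply: gen_min => //.
exact/lead_subq/gen_subq.
Qed.

(** Hilbert's basis argument for the extension of $R_q$ by $d_j$. The modules of leading
    coefficients increase with the degree and are constant from some [N] on; elements of [W] that
    realize them in degrees up to [N] generate [W], by induction on the order in $d_j$. *)
Lemma noeth_step : (forall x, W x -> gen q.+1 g x) -> fgq q.+1 W.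
Proof.
move=> Wg.
have Wlt x : W x -> exists k, ord_lt k x.
  move=> /Wg; elim=> {x} [x xg||x y _ [k Hk] _ [l Hl]|a x _ [k Hk]|i x iq _ [k Hk]].
  - by exists 1%N; apply/ord_lt_gen/gen_in.
  - by exists 0%N; apply: gen_0.
  - exists (maxn k l); apply: gen_add; [apply: ord_lt_le Hk; exact: leq_maxl|].
    apply: ord_lt_le Hl; exact: leq_maxr.
  - by exists k; apply: gen_scale.
  - case: (ltnP i q) => iq'; first by exists k; apply: gen_dop.
    have -> : i = j by apply: val_inj => /=; lia.
    by exists k.+1; apply: ord_lt_dop.
pose U y := exists k, lead W k y.
have HU : subq q U.
  split.
  - by exists 0%N; case: (lead_subq 0 HW).
  - move=> x y [k Hx] [l Hy]; exists (maxn k l).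
    case: (lead_subq (maxn k l) HW) => _ LD _ _.
    by apply: LD; [apply: lead_mono Hx|apply: lead_mono Hy]; rewrite ?leq_maxl ?leq_maxr.
  - by move=> a x [k Hx]; exists k; case: (lead_subq k HW) => _ _ LZ _; apply: LZ.
  - by move=> i x iq [k Hx]; exists k; case: (lead_subq k HW) => _ _ _ Ld; apply: Ld.
have [v Hv] := IH HU (fun y Uy => let: ex_intro k Hk := Uy in proj1 Hk).
have [N HN] : exists N, forall y, U y -> lead W N y.
  have: exists N, forall y, y \in v -> lead W N y.
    have: forall y, y \in v -> U y by move=> y yv; apply/Hv/gen_in.
    elim: (v) => [|z s IHs] Hs; first by exists 0%N.
    have [|N HN] := IHs; first by move=> y ys; apply: Hs; rewrite inE ys orbT.
    have [k Hk] := Hs z (mem_head _ _).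
    exists (maxn k N) => y; rewrite inE => /orP[/eqP->|/HN HyN].
      apply: lead_mono Hk => //; exact: leq_maxl.
    apply: lead_mono HyN => //; exact: leq_maxr.
  by case=> N HN; exists N => y /Hv; apply: gen_min => //; apply: lead_subq.
have [T TW HT] : exists2 T : seq X, (forall x, x \in T -> W x) &
    forall k y, (k <= N)%N -> lead W k y -> lead (gen q.+1 T) k y.
  have: exists2 T : seq X, (forall x, x \in T -> W x) &
    forall k y, (k < N.+1)%N -> lead W k y -> lead (gen q.+1 T) k y.
    elim: (N.+1) => [|M [T TW HT]]; first by exists [::].
    have [T' TW' HT'] := lead_fin M.
    exists (T ++ T') => [x|k y]; first by rewrite mem_cat => /orP[/TW|/TW'].
    rewrite ltnS leq_eqVlt => /orP[/eqP->|kM] Hy.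
      have [gy [w Hw Hw']] := HT' _ Hy; split=> //; exists w => //.
      by apply: gen_sub Hw => x xT; rewrite mem_cat xT orbT.
    have [gy [w Hw Hw']] := HT _ _ kM Hy; split=> //; exists w => //.
    by apply: gen_sub Hw => x xT; rewrite mem_cat xT.
  by case=> T ? HT; exists T => // k y kN; apply: HT; rewrite ltnS.
exists T => x; split=> [Wx|]; last exact: gen_min.
have [k] := Wlt _ Wx; elim: k x Wx => [|k IHk] x Wx Hx.
  have /gen_sub : gen q.+1 [::] x by exact: (gen_le (leqnSn q) Hx).
  exact.
have [y gy Hy] := ord_lt_lead Hx.
have Ly : lead W k y by split=> //; exists x.
have [_ [w Tw Hw]] : lead (gen q.+1 T) k y.
  case: (leqP k N) => [kN|Nk]; first exact: HT.
  apply: lead_mono (gen_subq _ _) (ltnW Nk) _; apply: HT => //; apply: HN; by exists k.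
rewrite -(subrK w x); apply: gen_add => //; apply: IHk.
  by apply: (subq_sub HW Wx); apply: gen_min Tw.
have -> : x - w = (x - dk k y) - (w - dk k y) by rewrite opprB addrA subrK.
exact: subq_sub (gen_subq _ _) Hy Hw.
Qed.
End NoethStep.

Theorem noeth q (X : dmod der) (s : seq X) (W : X -> Prop) :
  subq q W -> (forall x, W x -> gen q s x) -> fgq q W.
Proof.
elim: q W => [|q IH] W HW Ws; first exact: noeth0 Ws.
case: (ltnP q n) => [qn|nq].
  exact: (@noeth_step (Ordinal qn) X s W HW (fun V => IH V) Ws).
(* There is no derivation of index $q \ge n$, so $R_{q+1} = R_q$. *)
have E (t : seq X) x : gen q.+1 t x <-> gen q t x.
  split; last exact: gen_le.
  elim=> {x} [x xt||x y _ H1 _ H2|a x _ H1|i x _ _ H1]; first exact: gen_in.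
  - exact: gen_0.
  - exact: gen_add.
  - exact: gen_scale.
  - by apply: gen_dop => //; apply: leq_trans nq.
have [|t Ht] := IH W (subq_le (leqnSn q) HW); first by move=> x /Ws/E.
by exists t => x; rewrite Ht E.
Qed.
End Gen.

(** * The rings $R_k$: absence of zero divisors and the Ore condition *)

Section Operators.
Variables (K : fieldType) (n : nat) (der : 'I_n -> K -> K) (h : commuting_derivations der).
Notation W := (wop h).
Notation wmod := (wmod h).
Implicit Types (p q r : W) (X Y : dmod der).

Definition inR (k : nat) (p : W) : Prop := @gen K n der k wmod [:: (1 : W)] p.

Lemma inR_subq k : @subq K n der k wmod (inR k). Proof. exact: gen_subq. Qed.
Lemma inR_le k l p : (k <= l)%N -> inR k p -> inR l p. Proof. exact: gen_le. Qed.
Lemma inR1 k : inR k 1. Proof. by apply: gen_in; rewrite mem_head. Qed.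
Lemma inR0 k : inR k 0. Proof. exact: (@gen_0 K n der k wmod). Qed.
Lemma inRD k p q : inR k p -> inR k q -> inR k (p + q).
Proof. exact: (@gen_add K n der k wmod). Qed.
Lemma inRN k p : inR k p -> inR k (- p).
Proof. exact: (subq_opp (inR_subq k)). Qed.
Lemma inRB k p q : inR k p -> inR k q -> inR k (p - q).
Proof. exact: (subq_sub (inR_subq k)). Qed.
Lemma inRZ k a p : inR k p -> inR k (a *: p : W).
Proof. exact: (@gen_scale K n der k wmod). Qed.
Lemma inRd k (i : 'I_n) p : (i < k)%N -> inR k p -> inR k (wd i p).
Proof. exact: (@gen_dop K n der k wmod). Qed.

Lemma inR_act k X (V : X -> Prop) p x : subq k V -> inR k p -> V x -> V (act p x).
Proof.
move=> HV Hp Vx; case: (HV) => V0 VD VZ Vd.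
apply: (@gen_min K n der k wmod [:: (1 : W)] (fun p => V (act p x)) _ _ p) => //.
  split=> [|p1 p2 H1 H2|a p1 H1|i p1 ik H1].
  - by rewrite act0.
  - by rewrite actD; apply: VD.
  - by rewrite actZ; apply: VZ.
  - by rewrite /= act_wd; apply: Vd.
by move=> y; rewrite inE => /eqP->; rewrite act1.
Qed.

Lemma inRM k p q : inR k p -> inR k q -> inR k (p * q).
Proof. by move=> Hp Hq; exact: (@inR_act k wmod _ _ _ (inR_subq k) Hp Hq). Qed.
Lemma inRwX k (i : 'I_n) : (i < k)%N -> inR k (wX h i).
Proof. by move=> ik; rewrite -[wX h i]mulr1 wXmul; apply: inRd => //; apply: inR1. Qed.
Lemma inRX k p i : inR k p -> inR k (p ^+ i).
Proof.
move=> Hp; elim: i => [|i IH]; first by rewrite expr0; apply: inR1.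
by rewrite exprS; apply: inRM.
Qed.

Lemma inR_mono k (m : 'X_{1..n}) : (forall i : 'I_n, (k <= i)%N -> m i = 0%N) ->
  inR k ('X_[m] : {mpoly K[n]}).
Proof.
move=> Hm; have -> : 'X_[m] = dpow m (1 : wmod).
  by rewrite -[RHS]actX act_1.
exact: (subq_dpow (inR_subq k) Hm (inR1 k)).
Qed.

Lemma inR_suppP k p : inR k p <->
  forall m, (p : {mpoly K[n]})@_m != 0 -> forall i : 'I_n, (k <= i)%N -> m i = 0%N.
Proof.
split=> [|Hp].
  elim=> {p} [p ps||p1 p2 _ H1 _ H2|a p1 _ H1|i p1 ik _ H1] m.
  - move: ps; rewrite inE => /eqP->; rewrite mcoeff1; case: (eqVneq m 0%MM) => [->|]; last by rewrite eqxx.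
    by move=> _ i _; rewrite mnm0E.
  - by rewrite mcoeff0 eqxx.
  - rewrite mcoeffD; case: (eqVneq (p1 : {mpoly K[n]})@_m 0) => [->|/H1//]; rewrite add0r; exact: H2.
  - rewrite mcoeffZ mulf_eq0 negb_or => /andP[_]; exact: H1.
  - rewrite mcoeffD coef_mulX (coef_cder h); case: ifP => mi; last first.
      by rewrite add0r => H; apply: H1; apply: contraNneq H => ->; rewrite (der0 h).
    case: (eqVneq (p1 : {mpoly K[n]})@_(m - U_(i)) 0) => [->|/H1 H _ l kl].
      by rewrite add0r => H; apply: H1; apply: contraNneq H => ->; rewrite (der0 h).
    have := H l kl; rewrite mnmBE mnm1E; case: eqP => [E|_]; last by rewrite subn0.
    by move: ik; rewrite E ltnNge kl.
rewrite [p]mpolyE; apply: (@subq_sum_seq _ _ _ k wmod _ _ _ _ (inR_subq k)) => m mp.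
by apply/inRZ/inR_mono/Hp; rewrite -mcoeff_msupp.
Qed.

Lemma inR_all p : inR n p.
Proof. by apply/inR_suppP => m _ i; rewrite leqNgt ltn_ord. Qed.

Lemma inR0P p : inR 0 p -> exists a, p = a *: 1 :> W.
Proof.
elim=> {p} [p||p q _ [a ->] _ [b ->]|c p _ [a ->]|//].
- by rewrite inE => /eqP->; exists 1; rewrite scale1r.
- by exists 0; rewrite scale0r.
- by exists (a + b); rewrite scalerDl.
- by exists (c * a); rewrite scalerA.
Qed.

(** Moving $d^{al}$ past the coefficients of [p] only creates terms of lower total degree. *)
Lemma msize_sub_dpow (al : 'I_n -> nat) p : p != 0 ->
  (msize (dpow al (p : wmod) - 'X_[[multinom al i | i < n]] * (p : {mpoly K[n]}))%R < \sum_i al i + msize p)%N.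
Proof.
have msd i (u : {mpoly K[n]}) : (msize (cder der i u) <= msize u)%N.
  rewrite msizeE; apply/bigmax_leqP_seq => m; rewrite mcoeff_msupp (coef_cder h) => Hm _.
  apply: msize_mdeg_lt; rewrite mcoeff_msupp; apply: contraNneq Hm => ->; by rewrite (der0 h).
have msx i (u : {mpoly K[n]}) : (msize ('X_i * u)%R <= (msize u).+1)%N.
  case: (eqVneq u 0) => [->|u0]; first by rewrite mulr0 mmeasure0.
  by rewrite msizeM // ?msizeX ?mdeg1 //; apply/eqP => /(congr1 (mcoeff U_(i))); 
    rewrite mcoeffX eqxx mcoeff0 => /eqP; rewrite oner_eq0.
move=> p0; have sp : (0 < msize p)%N by rewrite lt0n msize_poly_eq0.
elim/expo_ind: al => [|al i IH].
  rewrite dpow0 // big1 // (_ : [multinom _ | _ < n] = 0%MM); last by apply/mnmP => k; rewrite !mnmE.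
  by rewrite mpolyX0 mul1r subrr mmeasure0.
rewrite dpowS big_split /=.
have -> : (\sum_k (k == i) = 1)%N by rewrite (bigD1 i) //= eqxx big1 // => k /negbTE->.
have -> : [multinom (al k + (k == i))%N | k < n] = ([multinom al k | k < n] + U_(i))%MM.
  by apply/mnmP => k; rewrite mnmDE !mnmE eq_sym.
rewrite mpolyXD.
pose u : {mpoly K[n]} := dpow al (p : wmod).
pose v : {mpoly K[n]} := 'X_[[multinom al k | k < n]] * (p : {mpoly K[n]}).
have {}IH : (msize (u - v)%R < \sum_k al k + msize p)%N := IH.
have -> : (dop i (dpow al (p : wmod)) - 'X_[[multinom al k | k < n]] * 'X_i * (p : {mpoly K[n]}))
    = 'X_i * (u - v) + cder der i u :> {mpoly K[n]}.
  rewrite /= /wd -/u mulrBr [RHS]addrAC /v mulrA (mulrC 'X_i 'X_[[multinom al k | k < n]]).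
  by [].
have us : (msize u <= \sum_k al k + msize p)%N.
  rewrite -(subrK v u); apply: leq_trans (msizeD_le _ _) _; rewrite geq_max ltnW //=.
  rewrite /v msizeM // ?msizeX; last first.
    by apply/eqP => /(congr1 (mcoeff [multinom al k | k < n]));
    rewrite mcoeffX eqxx mcoeff0 => /eqP; rewrite oner_eq0.
  by rewrite /= mdegE leq_add2r; apply: eq_leq; apply: eq_bigr => k _; rewrite mnmE.
apply: leq_ltn_trans (msizeD_le _ _) _; rewrite gtn_max; apply/andP; split.
  by apply: leq_ltn_trans (msx _ _) _; rewrite addn1 addSn ltnS.
by apply: leq_ltn_trans (msd _ _) _; rewrite addn1 addSn ltnS.
Qed.

(** Principal symbols multiply as commutative polynomials: if $pq = 0$, the commutative product of
    [p] and [q] would be a sum of correction terms, all of smaller degree. *)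
Lemma wmul_eq0 p q : p * q = 0 -> p = 0 \/ q = 0.
Proof.
move=> pq; case: (eqVneq p 0) => [|p0]; first by left.
case: (eqVneq q 0) => [|q0]; first by right.
exfalso.
pose c := (p : {mpoly K[n]}) * (q : {mpoly K[n]}).
have sp : (0 < msize p)%N by rewrite lt0n msize_poly_eq0.
have sq : (0 < msize q)%N by rewrite lt0n msize_poly_eq0.
have sc : msize c = (msize p + msize q).-1 by rewrite msizeM.
have E : c = - \sum_(m <- msupp p) p@_m *: (dpow m (q : wmod) - 'X_[m] * (q : {mpoly K[n]})).
  under eq_bigr do rewrite scalerBr.
  rewrite sumrB opprB; have -> : \sum_(m <- msupp p) p@_m *: dpow m (q : wmod) = p * q by [].
  rewrite pq subr0 /c {1}[p]mpolyE mulr_suml; apply: eq_bigr => m _; by rewrite scalerAl.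
have: (msize c < (msize p + msize q).-1)%N; last by rewrite sc ltnn.
rewrite {1}E msizeN; apply: leq_ltn_trans (msize_sum _ _ _) _.
rewrite big_seq; elim/big_ind: _ => [|x y Hx Hy|m mp].
- by lia.
- by rewrite gtn_max Hx.
apply: leq_ltn_trans (msizeZ_le _ _) _.
have := msize_sub_dpow m q0; rewrite mnm_id -mdegE => H; apply: leq_trans H _.
have := msize_mdeg_lt mp; lia.
Qed.

Lemma wmulIr p q r : r != 0 -> p * r = q * r -> p = q.
Proof.
move=> r0 E; have : (p - q) * r = 0 by rewrite mulrBl E subrr.
by case/wmul_eq0 => [/subr0_eq//|rE]; rewrite rE eqxx in r0.
Qed.

Lemma gen_coef k X (s : seq X) x : gen k s x ->
  exists c : nat -> W, (forall i, inR k (c i)) /\ x = \sum_(i < size s) act (c i) s`_i.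
Proof.
elim=> {x} [x xs||x y _ [c [Hc ->]] _ [c' [Hc' ->]]|a x _ [c [Hc ->]]|i x ik _ [c [Hc ->]]].
- exists (fun i => if i == index x s then 1 else 0); split=> [i|].
    by case: ifP => _; [apply: inR1|apply: inR0].
  have xs' : (index x s < size s)%N by rewrite index_mem.
  rewrite (bigD1 (Ordinal xs')) //= eqxx act1 nth_index // big1 ?addr0 // => i.
  by rewrite -val_eqE /= => /negbTE->; rewrite act0.
- by exists (fun=> 0); split=> [i|]; [exact: inR0|rewrite big1 // => i _; rewrite act0].
- exists (fun i => c i + c' i); split=> [i|]; first exact: inRD.
  by rewrite -big_split; apply: eq_bigr => i _; rewrite actD.
- exists (fun i => a *: c i : W); split=> [i|]; first exact: inRZ.
  by rewrite scaler_sumr; apply: eq_bigr => j _; rewrite actZ.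
- exists (fun l => wd i (c l)); split=> [l|]; first exact: inRd.
  by rewrite dop_sum; apply: eq_bigr => l _; rewrite act_wd.
Qed.

(** Cancelling on the right the lowest power of [v] that occurs turns the relation into $x u = y v$,
    with [x] the first nonzero coefficient. *)
Lemma ore_relation k u v N (c : nat -> W) : inR k u -> inR k v -> u != 0 -> v != 0 ->
  (forall i, inR k (c i)) -> (exists2 i, (i < N)%N & c i != 0) ->
  \sum_(i < N) c i * (u * v ^+ i) = 0 -> exists x y, [/\ inR k x, inR k y, x != 0 & x * u = y * v].
Proof.
move=> Hu Hv u0 v0; elim: N c => [|N IH] c Hc [i iN ci]; first by [].
rewrite big_ord_recl expr0 mulr1 => E.
have E' : c 0%N * u = - (\sum_(i < N) c i.+1 * (u * v ^+ i)) * v.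
  apply/eqP; rewrite mulNr -addr_eq0 mulr_suml -[X in _ == X]E; apply/eqP; congr (_ + _).
  by apply: eq_bigr => l _; rewrite /= -!mulrA /bump /= add1n exprSr.
case: (eqVneq (c 0%N) 0) => [c0|c0]; last first.
  exists (c 0%N), (- (\sum_(i < N) c i.+1 * (u * v ^+ i))); split=> //.
  apply/inRN/(@subq_sum _ _ _ k wmod _ _ _ _ _ (inR_subq k)) => l _.
  by do 2?apply: inRM => //; apply: inRX.
apply: (IH (fun i => c i.+1)) => //.
  by case: i ci iN => [|i] ci iN; [rewrite c0 eqxx in ci|exists i].
apply: (@wmulIr _ _ v) => //; rewrite mul0r -[LHS]opprK -mulNr -E' c0 mul0r oppr0 //.
Qed.

(** The left ideal of $R_k$ generated by all $u v^i$ is finitely generated, so some $u v^N$ is a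
    combination of the preceding ones. *)
Lemma ore k u v : inR k u -> inR k v -> v != 0 ->
  exists x y, [/\ inR k x, inR k y, x != 0 & x * u = y * v].
Proof.
move=> Hu Hv v0; case: (eqVneq u 0) => [->|u0].
  by exists 1, 0; split; [exact: inR1|exact: inR0|exact: oner_neq0|rewrite mulr0 mul0r].
pose f i : wmod := u * v ^+ i.
pose V x := exists N, @gen K n der k wmod (map f (iota 0 N)) x.
have Hf (i : nat) : inR k (f i) by apply: inRM => //; apply: inRX.
have mon N M x : (N <= M)%N -> gen k (map f (iota 0 N)) x -> gen k (map f (iota 0 M)) x.
  move=> NM; apply: gen_sub => y /mapP[i]; rewrite mem_iota add0n => iN ->.
  by apply: map_f; rewrite mem_iota add0n; lia.
have HV : subq k V.
  split.
  - by exists 0%N; apply: gen_0.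
  - move=> x y [N Hx] [M Hy]; exists (maxn N M); apply: gen_add.
      by apply: mon Hx; exact: leq_maxl.
    by apply: mon Hy; exact: leq_maxr.
  - by move=> a x [N Hx]; exists N; apply: gen_scale.
  - by move=> i x ik [N Hx]; exists N; apply: gen_dop.
have V1 (x : wmod) : V x -> inR k x.
  case=> N; apply: gen_min; first exact: inR_subq.
  by move=> y /mapP[i _ ->]; apply: Hf.
have [s Hs] := @noeth K n der k wmod [:: (1 : W)] V HV V1.
have [N HN] : exists N, forall x, V x -> gen k (map f (iota 0 N)) x.
  have: exists N, forall x, x \in s -> gen k (map f (iota 0 N)) x.
    have: forall x, x \in s -> V x by move=> x xs; apply/Hs/gen_in.
    elim: (s) => [|z t IH] Ht; first by exists 0%N.
    have [|N HN] := IH; first by move=> y yt; apply: Ht; rewrite inE yt orbT.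
    have [M HM] := Ht z (mem_head _ _); exists (maxn M N) => x.
    rewrite inE => /orP[/eqP->|/HN H]; first by apply: mon HM; exact: leq_maxl.
    by apply: mon H; exact: leq_maxr.
  case=> N HN; exists N => x /Hs; apply: gen_min => //; exact: gen_subq.
have VN : V (f N).
  by exists N.+1; apply: gen_in; apply: map_f; rewrite mem_iota add0n ltnSn.
have [c [Hc E]] := gen_coef (HN _ VN).
rewrite size_map size_iota in E.
apply: (@ore_relation k u v N.+1 (fun i => if i == N then -1 else c i)) => //.
- by move=> i; case: ifP => // _; apply/inRN/inR1.
- by exists N; rewrite ?eqxx ?oppr_eq0 ?oner_neq0 // ltnSn.
rewrite big_ord_recr /= eqxx mulN1r; apply/eqP; rewrite subr_eq0; apply/eqP.
rewrite [RHS]E; apply: eq_bigr => i _; have iN := ltn_ord i.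
by rewrite (nth_map 0%N) ?size_iota // nth_iota // add0n ltn_eqF.
Qed.
End Operators.

(** * Antilinear functionals separate points *)

Section Adjoint.
Variables (K : fieldType) (n : nat) (der : 'I_n -> K -> K) (h : commuting_derivations der).
Notation W := (wop h).
Notation wmod := (wmod h).
Implicit Types (p q r : W) (X Y : dmod der).

Lemma wscaleE (a : K) p : a *: p = (a *: 1 : W) * p :> W.
Proof. by rewrite wscaleAl mul1r. Qed.
Lemma wscal_comm (a b : K) : (a *: 1 : W) * (b *: 1 : W) = ((a * b) *: 1 : W).
Proof. by rewrite wscaleAl mul1r scalerA. Qed.
Lemma wX_scal i (a : K) : wX h i * (a *: 1 : W) = (a *: 1 : W) * wX h i + der i a *: 1.
Proof. by rewrite wXmul wdZ -wXmul mulr1 -wscaleE. Qed.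
Lemma wXC i j : wX h i * wX h j = wX h j * wX h i.
Proof.
have := @dop_comm _ _ _ wmod i j (1 : W); rewrite /= -!wXmul => E.
by rewrite -[wX h i * _]mulr1 -mulrA E mulrA mulr1.
Qed.

(* [D] with the left module structure obtained from right multiplication through the
   anti-automorphism fixing [K] and sending [d_i] to [- d_i]. *)
Definition wad of commuting_derivations der := {mpoly K[n]}.
HB.instance Definition _ := GRing.Zmodule.on (wad h).
Definition wad_scale (a : K) (p : wad h) : wad h := (p : W) * (a *: 1 : W).
Lemma wad_scaleA a b p : wad_scale a (wad_scale b p) = wad_scale (a * b) p.
Proof. by rewrite /wad_scale -[LHS](mulrA (p : W)) wscal_comm mulrC. Qed.
Lemma wad_scale1 : left_id 1 wad_scale.
Proof. by move=> p; rewrite /wad_scale scale1r; exact: (mulr1 (p : W)). Qed.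
Lemma wad_scaleDr : right_distributive wad_scale +%R.
Proof. move=> a p q; exact: (mulrDl (p : W)). Qed.
Lemma wad_scaleDl p : {morph wad_scale^~ p : a b / a + b}.
Proof. by move=> a b; rewrite /wad_scale scalerDl; exact: (mulrDr (p : W)). Qed.
HB.instance Definition _ :=
  GRing.Zmodule_isLmodule.Build K (wad h) wad_scaleA wad_scale1 wad_scaleDr wad_scaleDl.

Definition wad_op (i : 'I_n) (p : wad h) : wad h := - ((p : W) * wX h i).
Definition wadmod : dmod der.
Proof.
refine (@DMod K n der (wad h) wad_op _ _ _).
- by move=> i x y; rewrite /wad_op (mulrDl (x : W)); exact: (@opprD W).
- move=> i a x; rewrite /wad_op.
  change (- ((x : W) * (a *: 1 : W) * wX h i)
    = - ((x : W) * wX h i) * (a *: 1 : W) + (x : W) * (der i a *: 1 : W)).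
  rewrite mulNr -!mulrA wX_scal mulrDr opprD addrNK //.
- move=> i j x; rewrite /wad_op.
  change (- (- ((x : W) * wX h j) * wX h i) = - (- ((x : W) * wX h i) * wX h j)).
  by rewrite !mulNr -!mulrA wXC.
Defined.

(** The formal adjoint, read off at 1, since in [wadmod] the operator [p] acts as right
    multiplication by its adjoint. *)
Definition adj (p : W) : W := act p (1 : wadmod).

Lemma wad_mul_qlin (z : W) : @qlin K n der n wadmod wadmod (fun w => z * (w : W)).
Proof.
split=> [x y|a x|i x _].
- exact: (mulrDr z).
- exact: (mulrA z).
- by rewrite /= /wad_op; change (z * - ((x : W) * wX h i) = - (z * (x : W) * wX h i)); rewrite mulrN mulrA.
Qed.
Lemma act_wad p (z : wadmod) : act p z = (z : W) * adj p.
Proof.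
rewrite /adj; have := @qlin_act K n der wadmod wadmod _ p (1 : W) (wad_mul_qlin z).
by rewrite /= mulr1 => <-.
Qed.
Lemma adjD p q : adj (p + q) = adj p + adj q. Proof. exact: (@actD _ _ _ wadmod). Qed.
Lemma adjM p q : adj (p * q) = adj q * adj p.
Proof. by rewrite {1}/adj actM act_wad. Qed.
Lemma adj0 : adj 0 = 0. Proof. exact: (@act0 _ _ _ wadmod). Qed.
Lemma adj1 : adj 1 = 1. Proof. exact: (@act1 _ _ _ wadmod). Qed.
Lemma adjZ a p : adj (a *: p : W) = adj p * (a *: 1 : W).
Proof. exact: (@actZ _ _ _ wadmod). Qed.
Lemma adjX i p : adj (wd i p) = - (adj p * wX h i).
Proof. by rewrite /adj act_wd. Qed.
Lemma adj_scal a : adj (a *: 1 : W) = a *: 1 :> W.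
Proof. by rewrite adjZ adj1 mul1r. Qed.
Lemma adj_wX i : adj (wX h i) = - wX h i.
Proof. by rewrite -{1}[wX h i]mulr1 wXmul adjX adj1 mul1r. Qed.
Lemma adjN p : adj (- p) = - adj p. Proof. exact: (@actN _ _ _ wadmod). Qed.
Lemma adjK : involutive adj.
Proof.
move=> p; have := inR_all p; elim=> {p} [p||p q _ H1 _ H2|a p _ H|i p _ _ H].
- by rewrite inE => /eqP->; rewrite !adj1.
- by rewrite !adj0.
- by rewrite !adjD H1 H2.
- by rewrite adjZ adjM adj_scal H -wscaleE.
- by rewrite adjX adjN adjM adj_wX H mulNr opprK wXmul.
Qed.
Lemma adj_eq0 p : adj p = 0 -> p = 0.
Proof. by move=> E; rewrite -(adjK p) E adj0. Qed.
Lemma inR_adj k p : inR k p -> inR k (adj p).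
Proof.
move=> Hp; apply: (@inR_act _ _ _ _ k wadmod (fun x => inR k (x : W)) p 1) => //; last exact: inR1.
split=> [|x y|a x Hx|i x ik Hx].
- exact: inR0.
- exact: inRD.
- by apply: inRM => //; apply/inRZ/inR1.
- by apply/inRN/inRM => //; apply: inRwX.
Qed.
Lemma adj_qlin : @qlin K n der n wadmod wmod adj.
Proof.
split=> [x y|a x|i x _]; first exact: adjD.
- by rewrite [RHS]wscaleE -adj_scal -adjM.
- rewrite /= /wad_op -wXmul; change (adj (- ((x : W) * wX h i)) = wX h i * adj x).
  by rewrite adjN adjM adj_wX mulNr opprK.
Qed.

Section Separation.
Variables (k : nat) (M : dmod der) (g : seq M).
Hypothesis gM : forall x, gen k g x.
Hypothesis tf : forall p (x : M), inR k p -> act p x = 0 -> p = 0 \/ x = 0.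

(** Linearity into [wadmod] means that $\phi(p x)$ is $\phi(x)$ times the adjoint of $p$, for $p \in
    R_k$. *)
Definition antilin (phi : M -> W) : Prop :=
  @qlin K n der k M wadmod phi /\ forall x, inR k (phi x).

(* Graphs of antilinear functionals defined on a submodule *)
Definition fgraph (Gam : M -> W -> Prop) : Prop :=
  [/\ [/\ Gam 0 0, forall x w y v, Gam x w -> Gam y v -> Gam (x + y) (w + v),
      forall a x w, Gam x w -> Gam (a *: x) (w * (a *: 1 : W))
      & forall (i : 'I_n) x w, (i < k)%N -> Gam x w -> Gam (dop i x) (- (w * wX h i))],
      forall w, Gam 0 w -> w = 0 & forall x w, Gam x w -> inR k w].

Lemma fgraph_act Gam p x w : fgraph Gam -> inR k p -> Gam x w -> Gam (act p x) (w * adj p).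
Proof.
move=> [[G0 GD GZ Gd] _ _] Hp Gx; elim: Hp => {p} [p||p q _ H1 _ H2|a p _ H|i p ik _ H].
- by rewrite inE => /eqP->; rewrite act1 adj1 mulr1.
- by rewrite act0 adj0 mulr0.
- by rewrite actD adjD mulrDr; apply: GD.
- by rewrite actZ adjZ mulrA; apply: GZ.
- by rewrite /= act_wd adjX mulrN mulrA; apply: Gd.
Qed.

(** A functional need not extend to [y] with values in $R_k$, but a nonzero left multiple of it
    does. If $a y$ is in the domain, with value $v$, the Ore condition yields $b \ne 0$ and $z$ such
    that $b v$ is $z$ times the adjoint of $a$; then $b$ times the functional extends by $y \mapsto
    z$. The value at [m] stays nonzero because there are no zero divisors. *)
Lemma fgraph_ext Gam y m w : fgraph Gam -> Gam m w -> w != 0 ->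
  exists Gam', [/\ fgraph Gam', exists2 w', Gam' m w' & w' != 0,
    exists v, Gam' y v & forall x v, Gam x v -> exists v', Gam' x v'].
Proof.
move=> HG Gm w0; case: (HG) => [[G0 GD GZ Gd] Gf GR].
have [b [z [Hb Hz b0 Hbz]]] : exists b z : W, [/\ inR k b, inR k z, b != 0 &
    forall e v, inR k e -> Gam (act e y) v -> b * v = z * adj e].
  case: (pselect (exists (a : W) v, [/\ inR k a, a != 0 & Gam (act a y) v])); last first.
    (* No nonzero multiple of [y] lies in the domain, so [y] can be sent to 0. *)
    move=> none; exists 1, 0; split; [exact: inR1|exact: inR0|exact: oner_neq0|].
    move=> e v He Gev; rewrite mul1r mul0r; case: (eqVneq e 0) => [E|e0].
      by apply: Gf; rewrite E act0 in Gev.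
    by case: none; exists e, v.
  case=> a [v [Ha a0 Gav]].
  have aj0 : adj a != 0 by apply: contra_neq a0; exact: adj_eq0.
  have [b [z [Hb Hz b0 E]]] := ore (GR _ _ Gav) (inR_adj Ha) aj0.
  exists b, z; split=> // e v' He Gev.
  (* A second Ore relation, $s e = t a$, compares an arbitrary multiple $e y$ in the domain with $a
     y$. *)
  have [s [t [Hs Ht s0 Est]]] := ore He Ha a0.
  have sj0 : adj s != 0 by apply: contra_neq s0; exact: adj_eq0.
  apply: (wmulIr sj0); rewrite -[RHS]mulrA -adjM Est adjM mulrA -E -!mulrA; congr (_ * _).
  have G1 := fgraph_act HG Hs Gev; have G2 := fgraph_act HG Ht Gav.
  rewrite -!actM Est in G1 G2.
  have := GD _ _ _ _ G1 (GZ (-1) _ _ G2).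
  rewrite scaleN1r subrr => /Gf; rewrite scaleN1r mulrN mulr1 => /subr0_eq; exact.
exists (fun x w => exists v c w0, [/\ Gam v w0, inR k c, x = v + act c y & w = b * w0 + z * adj c]).
split.
- split; first split.
  + exists 0, 0, 0; split=> //; first exact: inR0.
      by rewrite act0 addr0.
    by rewrite adj0 !mulr0 addr0.
  + move=> x1 w1 x2 w2 [v [c [u [G1 Hc -> ->]]]] [v' [c' [u' [G2 Hc' -> ->]]]].
    exists (v + v'), (c + c'), (u + u'); split; first exact: GD.
    * exact: inRD.
    * by rewrite actD addrACA.
    * by rewrite adjD !mulrDr addrACA.
  + move=> a x1 w1 [v [c [u [G1 Hc -> ->]]]].
    exists (a *: v), (a *: c : W), (u * (a *: 1 : W)); split; first exact: GZ.
    * exact: inRZ.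
    * by rewrite actZ scalerDr.
    * by rewrite adjZ !mulrA -mulrDl.
  + move=> i x1 w1 ik [v [c [u [G1 Hc -> ->]]]].
    exists (dop i v), (wd i c), (- (u * wX h i)); split; first exact: Gd.
    * exact: inRd.
    * by rewrite act_wd dop_add.
    * by rewrite adjX !mulrN !mulrA -opprD -mulrDl.
- move=> w1 [v [c [u [G1 Hc /eqP E ->]]]].
  rewrite eq_sym addr_eq0 -actN in E; rewrite (eqP E) in G1.
  by rewrite (Hbz _ _ (inRN Hc) G1) adjN mulrN addNr.
- move=> x1 w1 [v [c [u [G1 Hc _ ->]]]].
  by apply: inRD; apply: inRM => //; [apply: GR G1|apply: inR_adj].
- exists (b * w).
    exists m, 0, w; split=> //; [exact: inR0|by rewrite act0 addr0|].
    by rewrite adj0 !mulr0 addr0.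
  by apply/eqP => /wmul_eq0[E|E]; [rewrite E eqxx in b0|rewrite E eqxx in w0].
- exists z, 0, 1, 0; split=> //; [exact: inR1|by rewrite act1 add0r|].
  by rewrite mulr0 add0r adj1 mulr1.
- move=> x v Gx; exists (b * v), x, 0, v; split=> //; [exact: inR0|by rewrite act0 addr0|].
  by rewrite adj0 !mulr0 addr0.
Qed.

(** Torsion-freeness makes [adj c] depend on [act c m] only, which gives a functional on $R_k m$.
    The generators are then adjoined one at a time, never killing the value at [m]. *)
Lemma antilin_separates m : m != 0 -> exists2 phi, antilin phi & phi m != 0.
Proof.
move=> m0.
have [Gam [HG [w Gm w0] Gg]] : exists Gam, [/\ fgraph Gam, exists2 w, Gam m w & w != 0 &
    forall y, y \in g -> exists v, Gam y v].
  elim: (g) => [|y s [Gam [HG [w Gm w0] Gs]]].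
    exists (fun x w => exists2 c, inR k c & x = act c m /\ w = adj c); split=> //.
      split; first split.
      + by exists 0; [exact: inR0|rewrite act0 adj0].
      + move=> _ _ _ _ [c Hc [-> ->]] [e He [-> ->]].
        by exists (c + e); [exact: inRD|rewrite actD adjD].
      + move=> a _ _ [c Hc [-> ->]]; exists (a *: c : W); first exact: inRZ.
        by rewrite actZ adjZ.
      + move=> i _ _ ik [c Hc [-> ->]]; exists (wd i c); first exact: inRd.
        by rewrite act_wd adjX.
      + move=> w [c Hc [/esym E ->]]; case: (tf Hc E) => [->|mE]; first exact: adj0.
        by rewrite mE eqxx in m0.
      + by move=> _ _ [c Hc [_ ->]]; apply: inR_adj.
    exists 1; last exact: oner_neq0.
    by exists 1; [exact: inR1|rewrite act1 adj1].
  have [Gam' [HG' [w' Gm' w0'] Gy' Gs']] := fgraph_ext y HG Gm w0.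
  exists Gam'; split=> //; first by exists w'.
  move=> x; rewrite inE => /orP[/eqP->//|/Gs[v /Gs']//].
case: (HG) => [[G0 GD GZ Gd] Gf GR].
have tot x : exists v, Gam x v.
  elim: (gM x) => {x} [x /Gg//||x y _ [v Hv] _ [u Hu]|a x _ [v Hv]|i x ik _ [v Hv]].
  - by exists 0.
  - by exists (v + u); apply: GD.
  - by exists (v * (a *: 1 : W)); apply: GZ.
  - by exists (- (v * wX h i)); apply: Gd.
have fn x u v : Gam x u -> Gam x v -> u = v.
  move=> Hu Hv; have := GD _ _ _ _ Hu (GZ (-1) _ _ Hv).
  by rewrite scaleN1r subrr => /Gf; rewrite scaleN1r mulrN mulr1 => /subr0_eq.
pose phi x := sval (cid (tot x)).
have Hphi x : Gam x (phi x) by rewrite /phi; case: cid.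
exists phi; last by rewrite (fn _ _ _ (Hphi m) Gm).
split; last by move=> x; apply: GR (Hphi x).
split=> [x y|a x|i x ik]; apply: (fn _ _ _ (Hphi _)).
- exact: GD.
- exact: GZ.
- exact: Gd.
Qed.
End Separation.
End Adjoint.

(** * Free modules and vanishing of cohomology *)

Section FreeModules.
Variables (K : fieldType) (n : nat) (der : 'I_n -> K -> K) (h : commuting_derivations der).
Notation W := (wop h).
Notation wmod := (wmod h).
Implicit Types (X Y Z : dmod der).

Definition powm (I : Type) X : dmod der.
Proof.
refine (@DMod K n der (I -> X : lmodType K) (fun i x k => dop i (x k)) _ _ _).
- by move=> i x y; apply/funext => k; exact: dop_add.
- by move=> i a x; apply/funext => k; exact: dop_scale.
- by move=> i j x; apply/funext => k; exact: dop_comm.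
Defined.

Arguments powm : simpl never.

Lemma powm_dop (I : Type) X i (x : powm I X) k : dop i x k = dop i (x k). Proof. by []. Qed.

Section Rank.
Variable p : nat.
Notation G := (powm 'I_p wmod).

Definition mon (l : 'I_p) (m : 'X_{1..n}) : G :=
  fun k => if k == l then 'X_[m] : {mpoly K[n]} else 0.
Definition unit_vec l : G := mon l 0%MM.

Lemma mon_wd i l m : dop i (mon l m) = mon l (U_(i) + m)%MM :> G.
Proof.
apply/funext => k; rewrite powm_dop /mon; case: ifP => _; last exact: (@dop0 _ _ _ wmod).
by rewrite /= /wd (cderX h) addr0 mpolyXD.
Qed.
Lemma mon_dpow l (al : 'I_n -> nat) m :
  dpow al (mon l m) = mon l ([multinom al i | i < n] + m)%MM.
Proof.
elim/expo_ind: al => [|al i IH].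
  by rewrite dpow0 //; congr mon; apply/mnmP => k; rewrite mnmDE mnmE.
rewrite dpowS IH mon_wd; congr mon; apply/mnmP => k.
by rewrite !mnmDE !mnmE eq_sym addnA (addnC (al k)).
Qed.
Lemma mon_sum (x : G) :
  x = \sum_l \sum_(m <- msupp (x l)) (x l : {mpoly K[n]})@_m *: mon l m.
Proof.
apply/funext => k; rewrite fct_sumE (bigD1 k) //= [X in _ = _ + X]big1 ?addr0; last first.
  move=> l lk; rewrite fct_sumE big1_seq // => m _.
  change ((x l : {mpoly K[n]})@_m *: (mon l m k : W) = 0).
  by rewrite /mon eq_sym (negbTE lk) scaler0.
rewrite fct_sumE {1}[x k]mpolyE; apply: eq_bigr => m _.
change ((x k : {mpoly K[n]})@_m *: ('X_[m] : {mpoly K[n]}) = (x k : {mpoly K[n]})@_m *: (mon k m k : W)).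
by rewrite /mon eqxx.
Qed.

Definition klin X Y (f : X -> Y) := qlin 0 f.
Lemma klin_ext X (f g : G -> X) : klin f -> klin g ->
  (forall l m, f (mon l m) = g (mon l m)) -> f = g.
Proof.
move=> Hf Hg E; apply/funext => x; rewrite [x]mon_sum !(qlin_sum _ _ _ Hf) !(qlin_sum _ _ _ Hg).
apply: eq_bigr => l _; rewrite (qlin_sum _ _ _ Hf) (qlin_sum _ _ _ Hg).
by apply: eq_bigr => m _; case: Hf => _ -> _; case: Hg => _ -> _; rewrite E.
Qed.

Definition gext X (F : 'I_p -> 'X_{1..n} -> X) (x : G) : X := \sum_l lext (F l) (x l).

Lemma gext_klin X (F : 'I_p -> 'X_{1..n} -> X) : klin (gext F).
Proof.
split=> [x y|a x|//].
- by rewrite /gext -big_split; apply: eq_bigr => l _; exact: lextD.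
- by rewrite /gext scaler_sumr; apply: eq_bigr => l _; exact: lextZ.
Qed.
Lemma gext_mon X (F : 'I_p -> 'X_{1..n} -> X) l m : gext F (mon l m) = F l m.
Proof.
rewrite /gext (bigD1 l) //= big1 ?addr0 /mon ?eqxx ?lextX // => k /negbTE->.
exact: lext0.
Qed.
Lemma gext_dop X (F : 'I_p -> 'X_{1..n} -> X) i x :
  (forall l m, F l (U_(i) + m)%MM = dop i (F l m)) -> gext F (dop i x) = dop i (gext F x).
Proof. by move=> HF; rewrite /gext dop_sum; apply: eq_bigr => l _; exact: lext_wd. Qed.
Lemma gext_qlin q X (F : 'I_p -> 'X_{1..n} -> X) :
  (forall (i : 'I_n) l m, (i < q)%N -> F l (U_(i) + m)%MM = dop i (F l m)) -> qlin q (gext F).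
Proof.
move=> HF; case: (gext_klin F) => FD FZ _; split=> // i x iq; apply: gext_dop => l m; exact: HF.
Qed.
Lemma gext_in q X (F : 'I_p -> 'X_{1..n} -> X) (V : X -> Prop) x : subq q V ->
  (forall l m, V (F l m)) -> V (gext F x).
Proof.
move=> HV VF; apply: (subq_sum _ HV) => l _; apply: (subq_sum _ HV) => m _.
by case: HV => _ _ VZ _; apply: VZ.
Qed.

(* [G] is projective over the subring of operators in the first [q] derivations. *)
Lemma free_lift q Y Z (psi : G -> Y) (pi : Z -> Y) (V : Z -> Prop) :
  qlin q psi -> qlin q pi -> subq q V -> (forall x, exists2 z, V z & pi z = psi x) ->
  exists u : G -> Z, [/\ qlin q u, forall x, pi (u x) = psi x & forall x, V (u x)].
Proof.
move=> Hpsi Hpi HV surj.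
(* The monomials [hi], in the derivations of index at least [q], form an $R_q$-basis together with
   the unit vectors. Lifts are chosen on this basis only, and [lo] acts on them. *)
pose lo (m : 'X_{1..n}) (i : 'I_n) : nat := if (i < q)%N then m i else 0%N.
pose hi (m : 'X_{1..n}) : 'X_{1..n} := [multinom if (i < q)%N then 0%N else m i | i < n].
pose z0 l m := s2val (cid2 (surj (mon l (hi m)))).
have Vz0 l m : V (z0 l m) by rewrite /z0; case: cid2.
have pz0 l m : pi (z0 l m) = psi (mon l (hi m)) by rewrite /z0; case: cid2.
pose F l m := dpow (lo m) (z0 l m).
have lo0 m (i : 'I_n) : (q <= i)%N -> lo m i = 0%N by rewrite /lo ltnNge => ->.
have FE (i : 'I_n) l m : (i < q)%N -> F l (U_(i) + m)%MM = dop i (F l m).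
  move=> iq; rewrite /F -dpowS.
  have -> : z0 l (U_(i) + m)%MM = z0 l m.
    rewrite /z0; suff -> : hi (U_(i) + m)%MM = hi m by [].
    apply/mnmP => k; rewrite !mnmE; case: ifP => // kq.
    by case: eqP => // ik; rewrite -ik iq in kq.
  apply: eq_dpow => k; rewrite /lo; case: ifP => kq.
    by rewrite mnmDE mnm1E addnC eq_sym.
  by rewrite add0n; case: eqP => // ki; rewrite ki iq in kq.
exists (gext F); split; first exact: gext_qlin FE.
- suff -> : psi = fun x => pi (gext F x) by [].
  apply: klin_ext; first exact: qlin_le Hpsi.
    by apply: qlin_comp; [exact: qlin_le Hpi|exact: gext_klin].
  move=> l m; rewrite gext_mon /F (qlin_dpow _ Hpi) ?pz0; last exact: lo0.
  rewrite -(qlin_dpow _ Hpsi); last exact: lo0.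
  congr psi; rewrite mon_dpow; congr mon; apply/mnmP => k; rewrite mnmDE !mnmE /lo.
  by case: ifP => _; rewrite ?addn0.
- by move=> x; apply: (gext_in x HV) => l m; apply: (subq_dpow HV (@lo0 m)).
Qed.

Definition lin X (v : 'I_p -> X) (x : G) : X := \sum_l act (x l) (v l).
Lemma lin_qlin X (v : 'I_p -> X) : qlin n (lin v).
Proof.
split=> [x y|a x|i x _].
- by rewrite /lin -big_split; apply: eq_bigr => l _; exact: actD.
- by rewrite /lin scaler_sumr; apply: eq_bigr => l _; exact: actZ.
- by rewrite /lin dop_sum; apply: eq_bigr => l _; exact: (act_wd (h := h)).
Qed.
Lemma act_unit (l : 'I_p) (m : 'X_{1..n}) : mon l m = dpow m (unit_vec l).
Proof. by rewrite mon_dpow mnm_id addm0. Qed.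
Lemma lin_unit X (v : 'I_p -> X) l : lin v (unit_vec l) = v l.
Proof.
rewrite /lin (bigD1 l) //= big1 ?addr0 /unit_vec /mon ?eqxx ?mpolyX0 ?act1 // => k /negbTE->.
by rewrite act0.
Qed.
Lemma qlin_lin X (f : G -> X) : qlin n f -> f = lin (fun l => f (unit_vec l)).
Proof.
move=> Hf; apply: klin_ext.
- exact: qlin_le Hf.
- exact: qlin_le (lin_qlin _).
move=> l m; rewrite act_unit (qlin_dpow _ Hf) ?(qlin_dpow _ (lin_qlin _)) ?lin_unit //.
  by move=> i; rewrite leqNgt ltn_ord.
by move=> i; rewrite leqNgt ltn_ord.
Qed.
Lemma free_gen : exists s, forall x : G, gen n s x.
Proof.
exists (map unit_vec (enum 'I_p)) => x; rewrite [x]mon_sum.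
apply: (subq_sum _ (gen_subq _ _)) => l _; apply: (subq_sum _ (gen_subq _ _)) => m _.
apply: gen_scale; rewrite act_unit; apply: (subq_dpow (gen_subq _ _)).
  by move=> i; rewrite leqNgt ltn_ord.
by apply/gen_in/map_f; rewrite mem_enum.
Qed.
End Rank.
End FreeModules.
Arguments powm : simpl never.

(** * Coefficients with respect to one derivation *)

Section Coefficients.
Variables (K : fieldType) (n : nat) (der : 'I_n -> K -> K) (h : commuting_derivations der).
Notation W := (wop h).
Notation wmod := (wmod h).
Implicit Types (p : W) (i j : 'I_n).

(* [cf j k p] is the coefficient of [d_j^k] when [p] is written with the powers of [d_j] on the right. *)
Definition cf j k (p : W) : W := lext (X := wmod)
  (fun m => if m j == k then 'X_[m - U_(j) *+ k] : {mpoly K[n]} else 0) p.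

Lemma cf_klin j k : @qlin K n der 0 wmod wmod (cf j k).
Proof. by split=> [x y|a x|//]; [exact: lextD|exact: lextZ]. Qed.

Lemma coef_cf j k p (m : 'X_{1..n}) : (cf j k p : {mpoly K[n]})@_m =
  if m j == 0%N then (p : {mpoly K[n]})@_(m + U_(j) *+ k) else 0.
Proof.
have -> : (cf j k p : {mpoly K[n]}) = \sum_(u <- msupp p) p@_u *: 
    (if u j == k then 'X_[u - U_(j) *+ k] : {mpoly K[n]} else 0) by [].
rewrite raddf_sum /=.
have T u : (p@_u *: (if u j == k then 'X_[u - U_(j) *+ k] : {mpoly K[n]} else 0))@_m =
    if (m j == 0%N) && (u == (m + U_(j) *+ k)%MM) then p@_u else 0.
  rewrite mcoeffZ; case: (eqVneq (u j) k) => [uj|uj]; last first.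
    rewrite mcoeff0 mulr0; case: andP => // -[/eqP mj /eqP E]; case/eqP: uj.
    by rewrite E mnmDE mulmnE mnm1E eqxx mj mul1n.
  rewrite mcoeffX; case: (eqVneq u (m + U_(j) *+ k)%MM) => [E|ne].
    move: uj; rewrite E addmK eqxx mulr1 andbT mnmDE mulmnE mnm1E eqxx mul1n => uj.
    by rewrite (_ : m j = 0%N) //; lia.
  rewrite andbF; case: eqP => [E|]; rewrite ?mulr0 //.
  case/eqP: ne; rewrite -E submK //; apply/mnm_lepP => i; rewrite mulmnE mnm1E.
  by case: eqP => [<-|//]; rewrite uj mul1n.
under eq_bigr do rewrite T.
case: (m j == 0%N) => /=; last by rewrite big1.
case: (boolP ((m + U_(j) *+ k)%MM \in msupp p)) => Hm.
  rewrite (bigD1_seq _ Hm) ?msupp_uniq //= eqxx big1 ?addr0 // => u /negbTE-> //.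
rewrite (memN_msupp_eq0 Hm) big_seq big1 // => u up; case: eqP => // E.
by rewrite -E up in Hm.
Qed.

Lemma coef_wd i p (m : 'X_{1..n}) : (wd i p : {mpoly K[n]})@_m =
  (if m i == 0%N then 0 else (p : {mpoly K[n]})@_(m - U_(i))) + der i (p : {mpoly K[n]})@_m.
Proof.
rewrite mcoeffD (coef_cder h) coef_mulX; congr (_ + _).
by rewrite lep1mP; case: eqP.
Qed.

Lemma cf_wd i j k p : i != j -> cf j k (wd i p) = wd i (cf j k p).
Proof.
move=> ij; apply/mpolyP => m; rewrite coef_wd !coef_cf coef_wd.
rewrite mnmBE mnm1E (negbTE ij) subn0.
case: (eqVneq (m j) 0%N) => [mj|_]; last by rewrite (der0 h) addr0 if_same.
congr (_ + _); rewrite mnmDE mulmnE mnm1E [j == i]eq_sym (negbTE ij) mul0n addn0.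
case: eqP => // /eqP mi; congr (_ @_ _); apply/mnmP => l.
rewrite !(mnmDE, mnmBE, mulmnE, mnm1E).
case: (eqVneq i l) => [<-|_]; last by rewrite !subn0.
by rewrite [j == i]eq_sym (negbTE ij) mul0n !addn0.
Qed.
Lemma cf_qlin j k q : (q <= j)%N -> @qlin K n der q wmod wmod (cf j k).
Proof.
move=> qj; case: (cf_klin j k) => D Z _; split=> // i x iq; apply: cf_wd.
by apply: contraTneq iq => ->; rewrite -leqNgt.
Qed.
(** Left multiplication by $d_j$ raises the degree in $d_j$ by one and keeps the top coefficient,
    which is what drives [bounded_cob]. *)
Lemma cf_wdS j k p : cf j k.+1 (wd j p) = cf j k p + cder der j (cf j k.+1 p) :> {mpoly K[n]}.
Proof.
apply/mpolyP => m; rewrite mcoeffD (coef_cder h) !coef_cf coef_wd.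
case: (eqVneq (m j) 0%N) => [mj|_]; last by rewrite (der0 h) addr0.
congr (_ + _); rewrite mnmDE mulmnE mnm1E eqxx mj /=.
by congr (_ @_ _); apply/mnmP => l; rewrite !(mnmDE, mnmBE, mulmnE, mnm1E); case: eqP => //= _; lia.
Qed.
Lemma cf_eq0 j p : (forall k, cf j k p = 0) -> p = 0.
Proof.
move=> H; apply/mpolyP => m; rewrite mcoeff0.
have := congr1 (mcoeff (m - U_(j) *+ m j)) (H (m j)); rewrite coef_cf mcoeff0.
rewrite mnmBE mulmnE mnm1E eqxx mul1n subnn eqxx submK //.
by apply/mnm_lepP => i; rewrite mulmnE mnm1E; case: eqP => [<-|//]; rewrite mul1n.
Qed.
Lemma cf_mulX j k l p : cf j k (cf j l p * wX h j ^+ l) = if k == l then cf j l p else 0.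
Proof.
apply/mpolyP => m; rewrite coef_cf.
have -> : cf j l p * wX h j ^+ l = ('X_[U_(j) *+ l] * (cf j l p : {mpoly K[n]}) : {mpoly K[n]}).
  exact: mulwXn.
rewrite coef_mulX; case: (eqVneq (m j) 0%N) => [mj|mj]; last first.
  case: eqP => _; last by rewrite mcoeff0.
  by rewrite coef_cf (negbTE mj).
case: (eqVneq k l) => [<-|kl].
  by rewrite lem_addl addmK.
rewrite mcoeff0; case: ifP => // /mnm_lepP/(_ j); rewrite mnmDE !mulmnE mnm1E eqxx mj !mul1n add0n => lk.
rewrite coef_cf mnmBE mnmDE !mulmnE mnm1E eqxx mj !mul1n add0n subn_eq0.
by case: leqP => // kl'; rewrite eqn_leq lk kl' in kl.
Qed.
Lemma cf_bounded j p : exists S, forall k, (S <= k)%N -> cf j k p = 0.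
Proof.
exists (msize p) => k Sk; apply/mpolyP => m; rewrite coef_cf mcoeff0; case: eqP => // _.
apply/eqP; rewrite mcoeff_eq0; apply: msize_mdeg_ge; apply: leq_trans Sk _.
by rewrite mdegD mdegMn mdeg1 mul1n leq_addl.
Qed.
Lemma cf_inR j k p : inR j p -> (0 < k)%N -> cf j k p = 0.
Proof.
move=> /inR_suppP Hp k0; apply/mpolyP => m; rewrite coef_cf mcoeff0; case: eqP => // _.
apply/eqP; apply: contraTT k0 => /Hp /(_ j (leqnn _)).
by rewrite mnmDE mulmnE mnm1E eqxx mul1n => /eqP; rewrite addn_eq0 => /andP[_ /eqP->].
Qed.
Lemma inR_cder i k p : inR k p -> inR k (cder der i p : W).
Proof.
move=> /inR_suppP Hp; apply/inR_suppP => m; rewrite (coef_cder h) => Hm.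
by apply: Hp; apply: contraNneq Hm => ->; rewrite (der0 h).
Qed.
Lemma wX_comm i p : wX h i * p - p * wX h i = cder der i p :> {mpoly K[n]}.
Proof. by rewrite wXmul mulwX /wd addrC addKr. Qed.
Lemma inR_comm i k p : inR k p -> inR k (wX h i * p - p * wX h i).
Proof. by move=> Hp; rewrite wX_comm; apply: inR_cder. Qed.
End Coefficients.

Lemma addr_shuffle (V : zmodType) (a b c e g t : V) : a - b = c + g ->
  (a - t) - (b - e) = c - (t - e) + g.
Proof. by move=> H; rewrite [RHS]addrAC -H !opprB addrACA [RHS]addrACA [- t - b]addrC. Qed.
Lemma subrACA (V : zmodType) (a b c e : V) : (a - b) - (c - e) = (a - c) - (b - e).
Proof. by rewrite opprD addrACA -opprD. Qed.

(** * Cohomology of the complexes $\mathrm{Hom}_{R_q}(G, D)$ *)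

Section Complex.
Variables (K : fieldType) (n : nat) (der : 'I_n -> K -> K) (h : commuting_derivations der).
Notation W := (wop h).
Notation wmod := (wmod h).
Variables (d : nat) (X : dmod der) (p : nat -> nat).
Notation G i := (powm 'I_(p i) wmod).
Variables (v : forall i, 'I_(p i.+1) -> G i) (eps : G 0 -> X).
Definition bd i : G i.+1 -> G i := lin (v (i := i)).
Hypothesis eps_lin : qlin n eps.
Hypothesis ex0 : forall x, eps x = 0 <-> exists y, bd y = x.
Hypothesis exS : forall i (x : G i.+1), bd x = 0 <-> exists y, bd y = x.
Variable s0 : seq X.
Hypothesis s0_eps : forall y, y \in s0 -> exists x, eps x = y.
Hypothesis eps_s0 : forall x, gen d s0 (eps x).

Lemma bd_lin q i : (q <= n)%N -> qlin q (@bd i).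
Proof. by move=> qn; exact: (qlin_le qn (lin_qlin h (v (i := i)))). Qed.
Lemma bdbd i (x : G i.+2) : bd (bd x) = 0.
Proof. by apply/exS; exists x. Qed.

Definition wlin q (Y : dmod der) (f : Y -> W) := @qlin K n der q Y wmod f.

(** The coboundaries of $\mathrm{Hom}_{R_q}(G, D)$ in degree [i]. *)
Definition cob q i : (G i -> W) -> Prop :=
  match i with
  | 0 => fun f => forall x, f x = 0
  | j.+1 => fun f => exists2 w : G j -> W, wlin q w & forall x, f x = w (bd x)
  end.

Lemma wd0 i : wd i 0 = 0 :> W. Proof. exact: (@dop0 _ _ _ wmod). Qed.
Lemma wdB i (x y : W) : wd i (x - y) = wd i x - wd i y :> W.
Proof. exact: (@dopB _ _ _ wmod). Qed.
Lemma wdC i j (x : W) : wd i (wd j x) = wd j (wd i x) :> W.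
Proof. exact: (@dop_comm _ _ _ wmod). Qed.

(** The commutator with $d_j$; its kernel on the $R_j$-linear maps consists of the $R_{j+1}$-linear
    ones. *)
Definition tau (Y : dmod der) (j : 'I_n) (f : Y -> W) (x : Y) : W := f (dop j x) - wd j (f x).

Lemma tau_lin (Y : dmod der) q (j : 'I_n) (f : Y -> W) : (q <= j)%N -> wlin q f -> wlin q (tau j f).
Proof.
move=> qj [fD fZ fd]; rewrite /tau; split=> [x y|a x|i x iq].
- by rewrite dop_add !fD wdD opprD addrACA.
- by rewrite dop_scale fD !fZ wdZ opprD addrACA subrr addr0 scalerBr.
- rewrite dop_comm !(fd i) //.
  change (wd i (f (dop j x)) - wd j (wd i (f x)) = wd i (f (dop j x) - wd j (f x)) :> W).
  by rewrite wdB wdC.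
Qed.
Lemma tau_eq0 (Y : dmod der) (j : 'I_n) (f : Y -> W) :
  wlin j f -> (forall x, tau j f x = 0) -> wlin j.+1 f.
Proof.
move=> [fD fZ fd] T; split=> // i x; rewrite ltnS leq_eqVlt => /orP[/eqP/val_inj->|]; last exact: fd.
exact: subr0_eq (T x).
Qed.
Lemma wlin_tau (Y : dmod der) q (j : 'I_n) (f : Y -> W) : (j < q)%N -> wlin q f -> forall x, tau j f x = 0.
Proof. by move=> jq [_ _ fd] x; rewrite /tau fd // subrr. Qed.

Lemma eq_cob q i (f g : G i -> W) : (forall x, f x = g x) -> cob q f -> cob q g.
Proof. by move=> /funext->. Qed.
Lemma cob0 q i : cob q (fun _ : G i => 0).
Proof. by case: i => [//|i]; exists (fun=> 0) => //; exact: (qlin_cst0 q _ wmod). Qed.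
Lemma cobB q i (f g : G i -> W) : cob q f -> cob q g -> cob q (fun x => f x - g x).
Proof.
case: i f g => [|i] f g; first by move=> Hf Hg x; rewrite Hf Hg subr0.
move=> [w Hw E] [w' Hw' E']; exists (fun x => w x - w' x); last by move=> x; rewrite E E'.
exact: (qlin_sub Hw Hw').
Qed.
Lemma cobN q i (f : G i -> W) : cob q f -> cob q (fun x => - f x).
Proof. by move=> Hf; apply: eq_cob (cobB (cob0 q i) Hf) => x; rewrite sub0r. Qed.
Lemma cobD q i (f g : G i -> W) : cob q f -> cob q g -> cob q (fun x => f x + g x).
Proof. by move=> Hf Hg; apply: eq_cob (cobB Hf (cobN Hg)) => x; rewrite opprK. Qed.
Lemma cob_comp q i (f : G i -> W) (a : W -> W) : @qlin K n der q wmod wmod a ->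
  cob q f -> cob q (fun x => a (f x)).
Proof.
move=> Ha; case: i f => [|i] f; first by move=> Hf x; rewrite Hf (qlin0 Ha).
by move=> [w Hw E]; exists (fun x => a (w x)) => [|x]; [exact: (qlin_comp Ha Hw)|rewrite E].
Qed.
Lemma cob_tau q (j : 'I_n) i (f : G i -> W) : (q <= j)%N -> cob q f -> cob q (tau j f).
Proof.
move=> qj; case: i f => [|i] f.
  by move=> Hf x; rewrite /tau !Hf sub0r wd0 oppr0.
move=> [w Hw E]; exists (tau j w); first exact: tau_lin.
by move=> x; rewrite /tau !E; case: (bd_lin i (leqnn n)) => _ _ ->.
Qed.

(** The identity of $G_i$ equals [phi] up to homotopy. Here [kap] stands for the homotopy of degree
    $i - 1$ composed with [bd], and for 0 when $i = 0$; recording only its two properties lets a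
    single degree be treated at a time. *)
Definition homotopy q i (phi kap : G i -> G i) (hh : G i -> G i.+1) (s : seq (G i)) : Prop :=
  [/\ [/\ qlin q phi, qlin q kap & qlin q hh], forall x, gen q s (phi x),
    forall x, x - phi x = bd (hh x) + kap x, forall x, kap (bd x) = 0
    & forall u, wlin q u -> cob q (fun x => u (kap x))].

Lemma fg_lift q (Y Z : dmod der) (f : Y -> Z) (t : seq Z) : qlin q f ->
  (forall z, z \in t -> exists y, f y = z) ->
  exists s : seq Y, forall z, gen q t z -> exists2 y, gen q s y & f y = z.
Proof.
move=> Hf Ht; case: (Hf) => fD fZ fd.
have [s Hs] : exists s : seq Y, forall z, z \in t -> exists2 y, y \in s & f y = z.
  elim: t Ht => [|z t IH] Ht; first by exists [::].
  have [|s Hs] := IH; first by move=> y yt; apply: Ht; rewrite inE yt orbT.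
  have [y fy] := Ht z (mem_head _ _); exists (y :: s) => z'.
  rewrite inE => /orP[/eqP->|/Hs[y' y's fy']]; first by exists y; rewrite ?mem_head.
  by exists y'; rewrite // inE y's orbT.
exists s => z; elim=> {z} [z /Hs[y ys fy]||z z' _ [y gy fy] _ [y' gy' fy']|a z _ [y gy fy]|i z iq _ [y gy fy]].
- by exists y => //; apply: gen_in.
- by exists 0; [exact: gen_0|exact: qlin0 Hf].
- by exists (y + y'); [exact: gen_add|rewrite fD fy fy'].
- by exists (a *: y); [exact: gen_scale|rewrite fZ fy].
- by exists (dop i y); [exact: gen_dop|rewrite fd // fy].
Qed.

(** The modules $G_i$ need not be finitely generated over $R_q$, but the image of [eps] is contained
    in such a module. As $G$ is projective over $R_q$, the identity can be compared with a chain map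
    [phi] built from finitely many lifts in each degree. *)
Lemma lift_identity q i : (d <= q <= n)%N ->
  exists phi kap hh s, @homotopy q i phi kap hh s.
Proof.
case/andP=> dq qn; elim: i => [|i [phi [kap [hh [s [[Hphi Hkap Hhh] phis Erel kapbd kapcob]]]]]].
  have Heps : qlin q eps := qlin_le qn eps_lin.
  have [s Hs] := fg_lift Heps s0_eps.
  have [phi [Hphi ephi phis]] : exists phi : G 0 -> G 0,
      [/\ qlin q phi, forall x, eps (phi x) = eps x & forall x, gen q s (phi x)].
    apply: (free_lift (psi := eps) (pi := eps) (V := gen q s)) => //; first exact: gen_subq.
    move=> x; apply: Hs; exact: (gen_le dq).
  have Hpsi : qlin q (fun x => x - phi x) by apply: qlin_sub => //; exact: qlin_id.
  have [hh [Hhh bhh _]] : exists hh : G 0 -> G 1,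
      [/\ qlin q hh, forall x, bd (hh x) = x - phi x & forall x, (fun _ => True) (hh x)].
    apply: (free_lift (psi := fun x => x - phi x) (pi := @bd 0) (V := fun=> True)) => //; first exact: bd_lin.
    move=> x; have [y Hy] : exists y, bd y = x - phi x.
      by apply/ex0; rewrite (qlinB _ _ Heps) ephi subrr.
    by exists y.
  exists phi, (fun=> 0), hh, s; split=> //.
  - by split=> //; exact: qlin_cst0.
  - by move=> x; rewrite bhh addr0.
  - by move=> u Hu x; rewrite (qlin0 Hu).
have bl := bd_lin i qn.
have phibd (x : G i.+1) : phi (bd x) = bd (x - hh (bd x)).
  rewrite (qlinB _ _ bl); have := Erel (bd x); rewrite kapbd addr0 => <-.
  by rewrite opprB addrC subrK.
(* An $R_q$-submodule of the finitely generated module that contains the values of [phi]. By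
   noetherianity it has finitely many generators, and these are boundaries, hence can be lifted. *)
pose V y := exists x : G i.+1, y = phi (bd x).
have [t Ht] : fgq q V.
  apply: (@noeth _ _ _ q _ s) => [|_ [x ->]]; last exact: phis.
  split.
  - by exists 0; rewrite (qlin0 bl) (qlin0 Hphi).
  - by move=> _ _ [x ->] [y ->]; exists (x + y); case: bl => -> _ _; case: Hphi => -> _ _.
  - by move=> a _ [x ->]; exists (a *: x); case: bl => _ -> _; case: Hphi => _ -> _.
  - by move=> l _ lq [x ->]; exists (dop l x); case: bl => _ _ ->//; case: Hphi => _ _ ->.
have Vbd y : y \in t -> exists x, bd x = y.
  by move=> yt; have [x ->] : V y by [apply/Ht/gen_in]; exists (x - hh (bd x)).
have [s' Hs'] := fg_lift bl Vbd.
have Hpb : qlin q (fun x : G i.+1 => phi (bd x)) by exact: qlin_comp Hphi bl.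
have [phi' [Hphi' bphi' phis']] : exists phi' : G i.+1 -> G i.+1,
    [/\ qlin q phi', forall x, bd (phi' x) = phi (bd x) & forall x, gen q s' (phi' x)].
  apply: (free_lift (psi := fun x => phi (bd x)) (pi := @bd i) (V := gen q s')) => //; first exact: gen_subq.
  by move=> x; apply: Hs'; apply/Ht; exists x.
have Hpsi : qlin q (fun x : G i.+1 => x - phi' x - hh (bd x)).
  by apply: qlin_sub; [apply: qlin_sub => //; exact: qlin_id|exact: qlin_comp].
have [hh' [Hhh' bhh' _]] : exists hh' : G i.+1 -> G i.+2,
    [/\ qlin q hh', forall x, bd (hh' x) = x - phi' x - hh (bd x) & forall x, (fun _ => True) (hh' x)].
  apply: (free_lift (psi := fun x => x - phi' x - hh (bd x)) (pi := @bd i.+1) (V := fun=> True)) => //; first exact: bd_lin.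
  move=> x; have [y Hy] : exists y, bd y = x - phi' x - hh (bd x).
    apply/exS; rewrite !(qlinB _ _ bl) bphi'; have := Erel (bd x); rewrite kapbd addr0 => ->.
    by rewrite subrr.
  by exists y.
exists phi', (fun x => hh (bd x)), hh', s'; split=> //.
- by split=> //; exact: qlin_comp.
- by move=> x; rewrite bhh' subrK.
- by move=> x; rewrite bdbd (qlin0 Hhh).
- by move=> u Hu; exists (fun x => u (hh x)) => //; exact: (qlin_comp Hu Hhh).
Qed.

(** Left multiplication by $R_j$ does not affect powers of $d_j$ standing on the right, so a bound
    valid at the generators holds on their span. *)
Lemma wlin_gen_bounded (j : 'I_n) (Y : dmod der) (u : Y -> W) (s : seq Y) : wlin j u ->
  exists S, forall x, gen j s x -> forall k, (S <= k)%N -> cf j k (u x) = 0.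
Proof.
move=> Hu; have [S HS] : exists S, forall x, x \in s -> forall k, (S <= k)%N -> cf j k (u x) = 0.
  elim: s => [|z t [S HS]]; first by exists 0%N.
  have [S' HS'] := cf_bounded j (u z); exists (maxn S S') => x.
  rewrite inE => /orP[/eqP->|xt] k; rewrite geq_max => /andP[Sk S'k]; [exact: HS'|exact: HS].
exists S => x gx k Sk; have Hcf := qlin_comp (cf_qlin h k (leqnn j)) Hu.
elim: gx => {x} [x xs||x y _ E _ E'|a x _ E|i x ij _ E].
- exact: HS.
- exact: (qlin0 Hcf).
- by case: Hcf => -> _ _; rewrite E E' addr0.
- by case: Hcf => _ -> _; rewrite E scaler0.
- by case: Hcf => _ _ ->//; rewrite E; exact: wd0.
Qed.

Lemma mulwXn_lin (j : 'I_n) k q : @qlin K n der q wmod wmod (fun w => (w : W) * wX h j ^+ k).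
Proof.
split=> [x y|a x|i x _].
- exact: (mulrDl (x : W) (y : W) (wX h j ^+ k)).
- exact: (wscaleAl a (x : W) (wX h j ^+ k)).
- exact: (wd_mul i (x : W) (wX h j ^+ k)).
Qed.

(** Let $S$ bound the degree of [u] in $d_j$. In degree $S + 1$ the relation for [tau j u] has no
    contribution from $u(d_j x)$ or from [g], while $d_j u(x)$ contributes the coefficient of
    $d_j^S$ in $u(x)$. So this coefficient is a coboundary. Right multiplication by $d_j^S$ being
    left linear, the top term of [u] is one too; it is subtracted and $S$ decreases. *)
Lemma bounded_cob (j : 'I_n) i S (u c g : G i -> W) : wlin j u -> cob j c ->
  (forall x, tau j u x = c x + g x) -> (forall x k, (0 < k)%N -> cf j k (g x) = 0) ->
  (forall x k, (S <= k)%N -> cf j k (u x) = 0) -> cob j u.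
Proof.
move=> + + + Hg; elim: S u c => [|S IH] u c Hu Hc E Hb.
  by apply: eq_cob (cob0 _ _) => x; apply/esym/(@cf_eq0 _ _ _ _ j) => k; apply: Hb.
have top x : cf j S (u x) = - cf j S.+1 (c x).
  have Hcf := cf_klin h j S.+1.
  have := congr1 (cf j S.+1) (E x); case: (Hcf) => cD _ _; rewrite [RHS]cD Hg // addr0 => <-.
  rewrite /tau (qlinB _ _ Hcf) (Hb _ S.+1) // sub0r opprK cf_wdS (Hb _ S.+1) // (_ : cder der j 0 = 0) ?addr0 //.
  by apply/mpolyP => m; rewrite (coef_cder h) mcoeff0 (der0 h).
pose t x := cf j S (u x) * wX h j ^+ S.
have Ht : cob j t.
  apply: (cob_comp (mulwXn_lin j S j)); apply: eq_cob (cobN (cob_comp (cf_qlin h S.+1 (leqnn j)) Hc)) => x.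
  by rewrite top.
have tl : wlin j t := qlin_comp (mulwXn_lin j S j) (qlin_comp (cf_qlin h S (leqnn j)) Hu).
have : cob j (fun x => u x - t x).
  apply: (IH _ (fun x => c x - tau j t x)).
  - exact: (qlin_sub Hu tl).
  - by apply: cobB => //; apply: cob_tau.
  - move=> x; have := E x; by rewrite /tau wdB; exact: addr_shuffle.
  - move=> x k Sk; rewrite (qlinB _ _ (cf_klin h j k)) cf_mulX; case: eqP => [->|ne]; first by rewrite subrr.
    by rewrite subr0 Hb //; lia.
by move=> /cobD/(_ Ht); apply: eq_cob => x; rewrite subrK.
Qed.

(** For a cocycle, [u] is the sum of its composites with [phi] and with [kap]; the second is a
    coboundary and the first has bounded degree in $d_j$. With [g] zero, this is the injectivity of
    [tau j] on cohomology; a general [g] is the error term met in [transfer_inj]. *)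
Lemma cocycle_cob (j : 'I_n) i (u c g : G i -> W) : (d <= j)%N -> wlin j u ->
  (forall x, u (bd x) = 0) -> cob j c ->
  (forall x, tau j u x = c x + g x) -> (forall x k, (0 < k)%N -> cf j k (g x) = 0) -> cob j u.
Proof.
move=> dj Hu ubd Hc E Hg; have jn : (d <= j <= n)%N by rewrite dj ltnW.
have [phi [kap [hh [s [[Hphi Hkap Hhh] phis Erel kapbd kapcob]]]]] := lift_identity i jn.
have uE x : u x = u (phi x) + u (kap x).
  have := congr1 u (Erel x); case: (Hu) => uD _ _; rewrite [RHS]uD ubd add0r => <-.
  by rewrite (qlinB _ _ Hu) addrC subrK.
have Hup : wlin j (fun x => u (phi x)) := qlin_comp Hu Hphi.
have [S HS] := wlin_gen_bounded s Hu.
have H1 : cob j (fun x => u (phi x)).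
  apply: (@bounded_cob j i S _ (fun x => c x - tau j (fun x => u (kap x)) x) g) => //.
  - by apply: cobB => //; apply: cob_tau => //; apply: kapcob.
  - move=> x; have := E x; rewrite /tau (uE x) (uE (dop j x)) wdD => H.
    by rewrite -(addr_shuffle _ _ H) !addrK.
  - by move=> x k Sk; apply: HS.
by apply: eq_cob (cobD H1 (kapcob _ Hu)) => x; rewrite [RHS]uE.
Qed.

(** As $G_i$ is free, [u] can be defined by recursion on the exponent of $d_j$ through $u(d_j y) =
    d_j u(y) + f(y)$. The predicate [V] keeps track of where the values lie. *)
Lemma tau_surj (j : 'I_n) i (f : G i -> W) (V : W -> Prop) : wlin j f ->
  @subq K n der j.+1 wmod V -> (forall x, V (f x)) ->
  exists u : G i -> W, [/\ wlin j u, forall x, tau j u x = f x & forall x, V (u x)].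
Proof.
move=> Hf HV Vf; case: (HV) => V0 VD VZ Vd.
pose F0 l := fix F0 k (m : 'X_{1..n}) : W :=
  if k is k'.+1 then wd j (F0 k' (m - U_(j))%MM) + f (mon h l (m - U_(j))%MM) else 0.
pose F l (m : 'X_{1..n}) := F0 l (m j) m.
have Fj l (m : 'X_{1..n}) : F l (U_(j) + m)%MM = wd j (F l m) + f (mon h l m).
  rewrite /F mnmDE mnm1E eqxx add1n /= (_ : (U_(j) + m - U_(j))%MM = m) //.
  by rewrite addmC addmK.
have Fi (a : 'I_n) l (m : 'X_{1..n}) : (a < j)%N -> F l (U_(a) + m)%MM = wd a (F l m).
  move=> aj; have ne : a != j by apply: contraTneq aj => ->; rewrite ltnn.
  rewrite /F mnmDE mnm1E (negbTE ne) add0n.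
  have [k] := ubnPeq (m j); elim: k m => [|k IH] m /eqP mk /=.
    by rewrite wd0.
  have -> : (U_(a) + m - U_(j))%MM = (U_(a) + (m - U_(j)))%MM.
    by apply/mnmP => l'; rewrite !(mnmDE, mnmBE, mnm1E); case: (eqVneq j l') => [<-|_];
      rewrite ?(negbTE ne) ?add0n ?subn0.
  have mk' : (m - U_(j))%MM j = k by rewrite mnmBE mnm1E eqxx mk subn1.
  rewrite IH ?mk' //.
  rewrite -mon_wd; case: Hf => _ _ -> //.
  by rewrite wdC -wdD.
have FV l (m : 'X_{1..n}) : V (F l m).
  rewrite /F; move: (m j) => k; elim: k m => [|k IH] m //=.
  by apply: VD => //; apply: Vd => //; rewrite ltnSn.
exists (gext (X := wmod) F); split.
- by apply: gext_qlin => a l m aj; exact: Fi.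
- suff -> : f = tau j (gext (X := wmod) F) by [].
  apply: (@klin_ext _ _ _ h _ wmod); first exact: qlin_le Hf.
    by apply: tau_lin => //; exact: gext_klin.
  by move=> l m; rewrite /tau mon_wd !gext_mon Fj addrC addKr.
- by move=> x; apply: (gext_in x HV).
Qed.

(** Write [tau j u] as $w \circ \mathrm{bd}$ and $w$ as [tau j y]. Then $u - y \circ \mathrm{bd}$
    has the same coboundary as [u] and is killed by [tau j]. In degree 0 already [tau j u]
    vanishes. *)
Lemma cob_tau_adjust (j : 'I_n) i (u : G i -> W) : wlin j u -> cob j (tau j u) ->
  exists2 u', wlin j.+1 u' & forall x : G i.+1, u' (bd x) = u (bd x).
Proof.
case: i u => [|i] u Hu; first by move=> T; exists u => //; apply: tau_eq0.
case=> w Hw E; have [//|//|y [Hy Ty _]] := @tau_surj j i w (fun=> True) Hw.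
have yl : wlin j (fun x : G i.+1 => y (bd x)) := qlin_comp Hy (bd_lin _ (ltnW (ltn_ord j))).
exists (fun x => u x - y (bd x)); last by move=> x; rewrite bdbd (qlin0 Hy) subr0.
apply: tau_eq0; first exact: (qlin_sub Hu yl).
move=> x; have := E x; rewrite -Ty /tau wdB; case: (bd_lin i (leqnn n)) => _ _ ->// H.
by rewrite subrACA H subrr.
Qed.

(** The long exact sequence, by induction on [q]. Injectivity of $\tau_q$ on cohomology makes [f] a
    coboundary $w \circ \mathrm{bd}$ over $R_q$; then $\tau_q w$ is a cocycle of degree $i - 1$,
    hence a coboundary, so [w] can be corrected to an $R_{q+1}$-linear map. *)
Theorem vanishing q i (f : G i -> W) : (d <= q <= n)%N -> (i < q - d)%N -> wlin q f ->
  (forall x, f (bd x) = 0) -> cob q f.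
Proof.
elim: q i f => [|q IH] i f; first by rewrite sub0n.
case/andP=> dq qn iq Hf fbd; case: (ltnP q d) => [qd|{}dq]; first by lia.
pose j : 'I_n := Ordinal qn.
have Hfj : wlin j f := qlin_le (leqnSn q) Hf.
have Cf : cob q f.
  apply: (@cocycle_cob j i f (fun=> 0) (fun=> 0)) => //; first exact: cob0.
    by move=> x; rewrite addr0; apply: (wlin_tau (q := q.+1)).
  by move=> x k _; exact: (qlin0 (cf_klin h j k)).
case: i f iq Hf fbd Hfj Cf => [//|i] f iq Hf fbd Hfj [w Hw E].
have Ct : cob j (tau j w).
  apply: IH; [by rewrite dq ltnW|by lia|exact: tau_lin|] => x.
  have := wlin_tau (ltnSn q : (j < q.+1)%N) Hf x.
  by rewrite /tau !E; case: (bd_lin i (leqnn n)) => _ _ ->.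
have [w' Hw' E'] := @cob_tau_adjust j i w Hw Ct.
by exists w' => // x; rewrite E.
Qed.

(** * Iterated connecting maps *)

Section Transfer.
Variables (M : dmod der) (pair : G 0 -> M -> W).
Hypothesis pair_lin : forall m, wlin d (fun x => pair x m).
Hypothesis pair_in : forall x m, inR d (pair x m).
Hypothesis pair_bd : forall (y : G 1) m, pair (bd y) m = 0.
Hypothesis pairD : forall x m m', pair x (m + m') = pair x m + pair x m'.
Hypothesis pairZ : forall x a m, pair x (a *: m) = pair x m * (a *: 1 : W).
Hypothesis pair_dop : forall x i m,
  pair x (dop i m) = wX h i * pair x m - pair (dop i x) m - pair x m * wX h i.
Hypothesis pair_nondeg : forall m, (forall x, pair x m = 0) -> m = 0.

(** The effect on cochains of replacing [m] by [dop i m] in the pairing, as [pair_dop] states in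
    degree 0. *)
Definition twist (Y : dmod der) i (f : Y -> W) (x : Y) : W :=
  wX h i * f x - f (dop i x) - f x * wX h i.

(* Iterating the connecting maps of the sequences [0 -> B_{q+1} -> B_q -tau_q-> B_q -> 0], where
   [B_q] is the complex of maps [G -> D] linear over the first [q] derivations, sends [m] to a
   cocycle of degree [k] in [B_{d+k}], well defined up to [cob]. *)
Fixpoint transfer k (m : M) : (G k -> W) -> Prop :=
  match k with
  | 0 => fun f => forall x, f x = pair x m
  | k'.+1 => fun f' => exists f u (j : 'I_n), [/\ j = (d + k')%N :> nat, transfer m f,
      [/\ wlin j u & forall x, inR j.+1 (u x)], forall x, tau j u x = f x
      & forall x, f' x = u (bd x)]
  end.

(** The bound on the values says that [f] has degree 0 in the next derivation; [transfer_inj]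
    depends on it. *)
Lemma transfer_facts k m (f : G k -> W) : transfer m f ->
  [/\ wlin (d + k) f, forall x : G k.+1, f (bd x) = 0 & forall x, inR (d + k) (f x)].
Proof.
elim: k f => [|k IH] f /=.
  move=> /funext->; rewrite addn0; split=> //; exact: pair_lin.
case=> f0 [u [j [ej /IH [Hf0 f0bd f0in] [Hu uin] Tu Ef]]].
have jn := ltnW (ltn_ord j); rewrite addnS -ej.
have Hub : wlin j (fun x : G k.+1 => u (bd x)) := qlin_comp Hu (bd_lin _ jn).
rewrite (funext Ef); split=> [||x].
- apply: tau_eq0 => // x; have := Tu (bd x); rewrite f0bd /tau.
  by case: (bd_lin k (leqnn n)) => _ _ ->.
- by move=> x; rewrite bdbd (qlin0 Hu).
- exact: uin.
Qed.

Lemma transfer_total k m : (d + k <= n)%N -> exists f : G k -> W, transfer m f.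
Proof.
elim: k => [|k IH] dk; first by exists (fun x => pair x m).
have [|f Ef] := IH; first by lia.
have dkn : (d + k < n)%N by rewrite -addnS.
pose j : 'I_n := Ordinal dkn.
have [Hf _ fin] := transfer_facts Ef.
have [||u [Hu Tu uin]] := @tau_surj j k f (inR j.+1) Hf; first exact: inR_subq.
  by move=> x; apply: inR_le (fin x); rewrite leqnSn.
by exists (fun x => u (bd x)), f, u, j.
Qed.

Lemma transferD k m m' (f f' : G k -> W) : transfer m f -> transfer m' f' ->
  transfer (m + m') (fun x => f x + f' x).
Proof.
elim: k f f' => [|k IH] f f' /=; first by move=> E E' x; rewrite E E' pairD.
move=> [f0 [u [j [ej T [Hu uin] Tu Ef]]]] [f0' [u' [j' [ej' T' [Hu' uin'] Tu' Ef']]]].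
have jj : j' = j by apply: val_inj; rewrite /= ej ej'.
subst j'; exists (fun x => f0 x + f0' x), (fun x => u x + u' x), j; split=> //.
- exact: IH.
- by split=> [|x]; [exact: (qlin_add Hu Hu')|exact: inRD].
- by move=> x; rewrite -Tu -Tu' /tau wdD opprD addrACA.
- by move=> x; rewrite Ef Ef'.
Qed.

Lemma mulr_lin (z : W) q : @qlin K n der q wmod wmod (fun w => (w : W) * z).
Proof.
split=> [x y|a x|i x _].
- exact: (mulrDl (x : W) (y : W) z).
- exact: (wscaleAl a (x : W) z).
- exact: (wd_mul i (x : W) z).
Qed.

Lemma transferZ k a m (f : G k -> W) : transfer m f ->
  transfer (a *: m) (fun x => f x * (a *: 1 : W)).
Proof.
elim: k f => [|k IH] f /=; first by move=> E x; rewrite E pairZ.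
move=> [f0 [u [j [ej T [Hu uin] Tu Ef]]]].
exists (fun x => f0 x * (a *: 1 : W)), (fun x => u x * (a *: 1 : W)), j; split=> //.
- exact: IH.
- split=> [|x]; first exact: (qlin_comp (mulr_lin (a *: 1 : W) j) Hu).
  by apply: inRM => //; apply/inRZ/inR1.
- by move=> x; rewrite -Tu /tau mulrBl wd_mul.
- by move=> x; rewrite Ef.
Qed.

Lemma twist_lin (Y : dmod der) q i (f : Y -> W) : wlin q f -> wlin q (twist i f).
Proof.
move=> Hf; case: (Hf) => fD fZ fd; rewrite /twist; split=> [x y|a x|l x lq].
- by rewrite dop_add !fD mulrDl mulrDr !opprD [X in X + _ = _]addrACA [LHS]addrACA.
- rewrite dop_scale fD !fZ wXmul wdZ -!wXmul wscaleAl opprD.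
  by rewrite [X in X - _ = _]addrACA subrr addr0 !scalerBr.
- rewrite dop_comm !(fd l) // !wXmul.
  change (wd i (wd l (f x)) - wd l (f (dop i x)) - wd l (f x) * wX h i =
    wd l (wd i (f x) - f (dop i x) - f x * wX h i) :> W).
  by rewrite !wdB wd_mul (wdC i l).
Qed.

Lemma transfer_twist k i m (f : G k -> W) : transfer m f -> transfer (dop i m) (twist i f).
Proof.
elim: k f => [|k IH] f; first by move=> E x; rewrite /twist !E pair_dop.
move=> [f0 [u [j [ej T [Hu uin] Tu Ef]]]].
have [Hf0 _ f0in] := transfer_facts T.
exists (twist i f0), (twist i u), j; split=> //.
- exact: IH.
- split=> [|x]; first exact: twist_lin.
  have R (i' : 'I_n) : (i' <= j)%N -> inR j.+1 (u x * wX h i').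
    by move=> ij; apply: inRM => //; apply: inRwX; rewrite ltnS.
  (* Below [j], linearity of [u] leaves only $-u(x) d_i$. Above [j], the terms are the commutator
     $[d_i, u(x)]$ and a value of [u], both in $R_{j+1}$. At [j], the new term is a value of
     [f0]. *)
  case: (ltngtP i j) => [ij|ij|ij].
  + rewrite /twist; case: (Hu) => _ _ ud; rewrite ud // wXmul.
    change (inR j.+1 (wd i (u x) - wd i (u x) - u x * wX h i)).
    by rewrite subrr sub0r; apply/inRN/R/ltnW.
  + rewrite /twist addrAC; apply: inRB => //; exact: inR_comm.
  + have -> : i = j by apply: val_inj.
    have -> : twist j u x = - tau j u x - u x * wX h j.
      by rewrite /twist /tau wXmul opprB.
    apply: inRB; last exact: R.
    by rewrite Tu; apply/inRN/(inR_le _ (f0in x)); rewrite -ej.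
- move=> x; rewrite /twist -!Tu /tau !wXmul !wdB (wdC j i) (dop_comm i j) mulrBl wd_mul.
  by rewrite [LHS]subrACA [X in X - _ = _]subrACA.
- move=> x; rewrite /twist !Ef; case: (bd_lin k (leqnn n)) => _ _ -> //.
Qed.

(** By additivity, this makes the class of a transfer of any [m] independent of the choices of
    [u]. *)
Lemma transfer_wd k (f : G k -> W) : transfer 0 f -> (d + k <= n)%N -> cob (d + k) f.
Proof.
elim: k f => [|k IH] f.
  move=> E _ x; rewrite E -(scale0r 0) pairZ scale0r mulr0 //.
move=> [f0 [u [j [ej T [Hu uin] Tu Ef]]]] dk.
have C : cob j (tau j u).
  rewrite (funext Tu) ej; apply: IH => //; lia.
have [u' Hu' E'] := @cob_tau_adjust j k u Hu C.
by rewrite addnS -ej; exists u' => // x; rewrite Ef.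
Qed.

(** If [f] is the coboundary of an $R_{j+1}$-linear [w], then $u - w$ is a cocycle which [tau j]
    sends to [f0]. The values of [f0] have degree 0 in $d_j$, so $u - w$ is a coboundary, hence so
    is [f0], and the induction goes down to the pairing itself. *)
Lemma transfer_inj k m (f : G k -> W) : transfer m f -> cob (d + k) f -> m = 0.
Proof.
elim: k f => [|k IH] f.
  by rewrite addn0 => E C; apply: pair_nondeg => x; rewrite -E C.
rewrite addnS => -[f0 [u [j [ej T [Hu uin] Tu Ef]]]]; rewrite -ej => -[w Hw Ew].
have [Hf0 _ f0in] := transfer_facts T.
have Hwj : wlin j w := qlin_le (leqnSn j) Hw.
apply: (IH f0) => //; rewrite -ej.
have Tuw x : tau j (fun x => u x - w x) x = f0 x.
  have := wlin_tau (ltnSn j) Hw x; rewrite -Tu /tau wdB => H.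
  by rewrite subrACA H subr0.
have : cob j (tau j (fun x => u x - w x)).
  apply: cob_tau => //; apply: (@cocycle_cob j k _ (fun=> 0) f0).
  - by rewrite ej leq_addr.
  - exact: (qlin_sub Hu Hwj).
  - by move=> x; rewrite -Ef Ew subrr.
  - exact: cob0.
  - by move=> x; rewrite add0r.
  - by move=> x l; apply: cf_inR; rewrite ej.
by apply: eq_cob.
Qed.
End Transfer.
End Complex.

(** * The embedding of a torsion-free module *)

Section Quotient.
Variables (K : fieldType) (n : nat) (der : 'I_n -> K -> K) (X : dmod der) (V : X -> Prop).

Section Type_.
Variable HV : subq n V.
Let V0 : V 0. Proof. by case: HV. Qed.

Lemma coset_ex x : exists y, V (x - y).
Proof. by exists x; rewrite subrr. Qed.
Definition coset_rep x : X := sval (cid (coset_ex x)).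
Lemma coset_repP x : V (x - coset_rep x).
Proof. by rewrite /coset_rep; case: cid. Qed.
(** The representative is chosen from the predicate $z \mapsto V(x - z)$ alone, and congruent
    elements have equal predicates by extensionality. *)
Lemma eq_coset_rep x y : V (x - y) -> coset_rep x = coset_rep y.
Proof.
move=> xy; rewrite /coset_rep; move: (coset_ex x) (coset_ex y).
have -> : (fun z => V (y - z)) = (fun z => V (x - z)).
  apply/funext => z; apply/propext; split=> H.
    have -> : x - z = (x - y) + (y - z) by rewrite addrA subrK.
    by case: HV => _ VD _ _; apply: VD.
  have -> : y - z = (x - z) - (x - y) by rewrite opprB [RHS]addrC addrA subrK.
  exact: subq_sub HV H xy.
by move=> p q; rewrite (Prop_irrelevance p q).
Qed.
Lemma coset_repK x : coset_rep (coset_rep x) == coset_rep x.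
Proof. by apply/eqP/esym/eq_coset_rep/coset_repP. Qed.
Lemma coset_rep_eq x y : coset_rep x = coset_rep y -> V (x - y).
Proof.
move=> E; have -> : x - y = (x - coset_rep x) - (y - coset_rep y).
  by rewrite E opprB addrA subrK.
exact: subq_sub HV (coset_repP x) (coset_repP y).
Qed.
End Type_.

Definition qtype (HV : subq n V) := {x : X | coset_rep HV x == x}.
Variable HV : subq n V.
HB.instance Definition _ := Choice.on (qtype HV).
Definition qpi (x : X) : qtype HV := exist _ (coset_rep HV x) (coset_repK HV x).
Definition qval (a : qtype HV) : X := sval a.
Lemma qval_inj : injective qval. Proof. exact: val_inj. Qed.
Lemma qpi_val (a : qtype HV) : qpi (qval a) = a.
Proof. by apply: qval_inj; case: a => a Ha; exact: (eqP Ha). Qed.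
Lemma qpiP x y : qpi x = qpi y <-> V (x - y).
Proof.
split=> [/(congr1 qval)/=|H]; first exact: coset_rep_eq.
by apply: qval_inj; exact: eq_coset_rep.
Qed.
Lemma val_qpi x : V (qval (qpi x) - x).
Proof. by apply/qpiP; rewrite qpi_val. Qed.

Definition qadd (a b : qtype HV) := qpi (qval a + qval b).
Definition qopp (a : qtype HV) := qpi (- qval a).
Definition qscale (c : K) (a : qtype HV) := qpi (c *: qval a).
Definition qop i (a : qtype HV) := qpi (dop i (qval a)).

Lemma qpiD x y : qadd (qpi x) (qpi y) = qpi (x + y).
Proof.
apply/qpiP; rewrite opprD addrACA; case: (HV) => _ VD _ _; apply: VD; exact: val_qpi.
Qed.
Lemma qpiN x : qopp (qpi x) = qpi (- x).
Proof. by apply/qpiP; rewrite -opprD; apply: (subq_opp HV); exact: val_qpi. Qed.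
Lemma qpiZ c x : qscale c (qpi x) = qpi (c *: x).
Proof. by apply/qpiP; rewrite -scalerBr; case: (HV) => _ _ VZ _; apply: VZ; exact: val_qpi. Qed.
Lemma qpi_op i x : qop i (qpi x) = qpi (dop i x).
Proof. by apply/qpiP; rewrite -dopB; case: (HV) => _ _ _ Vd; apply: Vd => //; exact: val_qpi. Qed.

Lemma qaddA : associative qadd.
Proof. by move=> a b c; rewrite -(qpi_val a) -(qpi_val b) -(qpi_val c) !qpiD addrA. Qed.
Lemma qaddC : commutative qadd.
Proof. by move=> a b; rewrite -(qpi_val a) -(qpi_val b) !qpiD addrC. Qed.
Lemma qadd0 : left_id (qpi 0) qadd.
Proof. by move=> a; rewrite -(qpi_val a) !qpiD add0r. Qed.
Lemma qaddN : left_inverse (qpi 0) qopp qadd.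
Proof. by move=> a; rewrite -(qpi_val a) qpiN qpiD addNr. Qed.
HB.instance Definition _ := GRing.isZmodule.Build (qtype HV) qaddA qaddC qadd0 qaddN.

Lemma qscaleA c e a : qscale c (qscale e a) = qscale (c * e) a.
Proof. by rewrite -(qpi_val a) !qpiZ scalerA. Qed.
Lemma qscale1 : left_id 1 qscale.
Proof. by move=> a; rewrite -(qpi_val a) qpiZ scale1r. Qed.
Lemma qscaleDr : right_distributive qscale +%R.
Proof.
move=> c a b; rewrite -(qpi_val a) -(qpi_val b).
by rewrite [X in qscale _ X]qpiD !qpiZ [RHS]qpiD scalerDr.
Qed.
Lemma qscaleDl a : {morph qscale^~ a : c e / c + e}.
Proof.
have [x <-] : exists x, qpi x = a by exists (qval a); exact: qpi_val.
move=> c e; rewrite (qpiZ c) (qpiZ e) (qpiZ (c + e)) scalerDl; exact: esym (qpiD _ _).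
Qed.
HB.instance Definition _ :=
  GRing.Zmodule_isLmodule.Build K (qtype HV) qscaleA qscale1 qscaleDr qscaleDl.

Definition quot : dmod der.
Proof.
refine (@DMod K n der (qtype HV) qop _ _ _).
- move=> i a b; rewrite -(qpi_val a) -(qpi_val b).
  by rewrite [X in qop _ X]qpiD !qpi_op [RHS]qpiD dop_add.
- move=> i c a; have [x <-] : exists x, qpi x = a by exists (qval a); exact: qpi_val.
  transitivity (qop i (qscale c (qpi x))); first by [].
  by rewrite qpiZ qpi_op dop_scale -qpiD -!qpiZ -qpi_op.
- by move=> i j a; rewrite -(qpi_val a) !qpi_op dop_comm.
Defined.

Definition qproj (x : X) : quot := qpi x.
Lemma qproj_dlinear : dlinear qproj.
Proof.
split=> [x y|a x|i x]; apply: esym; [exact: qpiD|exact: qpiZ|exact: qpi_op].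
Qed.
Lemma qproj_surj (y : quot) : exists x, qproj x = y.
Proof. by exists (qval y); exact: qpi_val. Qed.
Lemma qproj_eq x y : qproj x = qproj y <-> V (x - y).
Proof. exact: qpiP. Qed.
Lemma qproj_factor (Y : dmod der) (f : X -> Y) : dlinear f -> (forall x, V x -> f x = 0) ->
  exists2 g : quot -> Y, dlinear g & forall x, g (qproj x) = f x.
Proof.
move=> [fD fZ fd] fV; pose g (y : quot) := f (qval y).
have gE x : g (qproj x) = f x.
  apply/eqP; rewrite -subr_eq0 -scaleN1r -fZ -fD scaleN1r; apply/eqP/fV/val_qpi.
exists g => //; split=> [a b|c a|i a].
- have [x <-] := qproj_surj a; have [y <-] := qproj_surj b.
  by case: qproj_dlinear => <- _ _; rewrite !gE fD.
- by have [x <-] := qproj_surj a; case: qproj_dlinear => _ <- _; rewrite !gE fZ.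
- by have [x <-] := qproj_surj a; case: qproj_dlinear => _ _ <-; rewrite !gE fd.
Qed.
End Quotient.

(** * Projectivity and finite generation *)

Section Projective.
Variables (K : fieldType) (n : nat) (der : 'I_n -> K -> K) (h : commuting_derivations der).
Implicit Types (X Y P Q : dmod der).

Lemma projective_retract P Q (f : P -> Q) (g : Q -> P) :
  projective P -> dlinear f -> dlinear g -> (forall x, f (g x) = x) -> projective Q.
Proof.
move=> HP Hf Hg fg A B p q Hp psurj Hq.
have [u [Hu pu]] := HP A B p (fun x => q (f x)) Hp psurj
  ((qlin_dlin _).2 (qlin_comp ((qlin_dlin _).1 Hq) ((qlin_dlin _).1 Hf))).
exists (fun x => u (g x)); split; last by move=> x; rewrite pu fg.
exact: ((qlin_dlin _).2 (qlin_comp ((qlin_dlin _).1 Hu) ((qlin_dlin _).1 Hg))).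
Qed.

Lemma free_projective p : projective (powm 'I_p (wmod h)).
Proof.
move=> A B f g Hf fsurj Hg.
have [||||u [Hu fu _]] := @free_lift _ _ _ h p n _ _ g f (fun=> True).
- exact/qlin_dlin.
- exact/qlin_dlin.
- by [].
- by move=> x; have [y Hy] := fsurj (g x); exists y.
by exists u; split=> //; exact/qlin_dlin.
Qed.

Definition adjv p (x : 'I_p -> wop h) : 'I_p -> wop h := fun l => adj (x l).
Lemma adjvK p (x : 'I_p -> wop h) : adjv (adjv x) = x.
Proof. by apply/funext => l; exact: adjK. Qed.
Lemma adjv_free p : @dlinear K n der (powm 'I_p (wmod h)) (powm 'I_p (wadmod h)) (@adjv p).
Proof.
by split=> [x y|a x|i x]; apply/funext => l; [exact: adjD|exact: adjZ|exact: adjX].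
Qed.
Lemma adjv_ad p : @dlinear K n der (powm 'I_p (wadmod h)) (powm 'I_p (wmod h)) (@adjv p).
Proof.
have [aD aZ ad] := adj_qlin h.
by split=> [x y|a x|i x]; apply/funext => l; [exact: aD|exact: aZ|exact: ad].
Qed.
Lemma adfree_projective p : projective (powm 'I_p (wadmod h)).
Proof.
exact (projective_retract (@free_projective p) (@adjv_free p) (@adjv_ad p) (@adjvK p)).
Qed.

Lemma gen_Dgenerated X (s : seq X) x : gen n s x -> Dgenerated s x.
Proof.
elim=> {x} [x xs||x y _ [l ->] _ [l' ->]|a x _ [l ->]|i x _ _ [l ->]].
- exists [:: (1, fun=> 0%N, index x s)]; rewrite big_seq1 /= scale1r dpow0 //.
  by rewrite nth_index.
- by exists [::]; rewrite big_nil.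
- by exists (l ++ l'); rewrite big_cat.
- exists [seq (a * t.1.1, t.1.2, t.2) | t <- l].
  by rewrite big_map scaler_sumr; apply: eq_bigr => t _; rewrite scalerA.
- exists ([seq (t.1.1, (fun k => t.1.2 k + (k == i))%N, t.2) | t <- l] ++
    [seq (der i t.1.1, t.1.2, t.2) | t <- l]).
  rewrite big_cat /= !big_map -big_split dop_sum; apply: eq_bigr => t _ /=.
  by rewrite dop_scale dpowS.
Qed.
Lemma Dgenerated_gen X (s : seq X) x : Dgenerated s x -> gen n s x.
Proof.
case=> l ->; apply: (subq_sum _ (gen_subq _ _)) => t _; apply: gen_scale.
apply: (subq_dpow (gen_subq _ _)) => [i|]; first by rewrite leqNgt ltn_ord.
case: (ltnP t.2 (size s)) => Hs; first exact/gen_in/mem_nth.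
by rewrite nth_default //; apply: gen_0.
Qed.

Lemma fingen_image X Y (f : X -> Y) (s : seq X) : (forall x, gen n s x) -> dlinear f ->
  (forall y, exists x, f x = y) -> fingen Y.
Proof.
move=> Hs Hf fs; exists (map f s) => y; have [x <-] := fs y.
by apply/gen_Dgenerated/gen_image => //; exact/qlin_dlin.
Qed.
End Projective.

(** * Free resolutions and the module of antilinear functionals *)

Section Embedding.
Variables (K : fieldType) (n : nat) (der : 'I_n -> K -> K) (h : commuting_derivations der).
Notation W := (wop h).
Notation wmod := (wmod h).
Notation wadmod := (wadmod h).

Lemma free_kernel a (Q : dmod der) (f : powm 'I_a wmod -> Q) : qlin n f ->
  exists b (w : 'I_b -> powm 'I_a wmod), forall x, f x = 0 <-> exists y, lin (h := h) w y = x.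
Proof.
move=> Hf; case: (Hf) => fD fZ fd.
have [s0 Hs0] := free_gen h a.
have [s Hs] : fgq n (fun x => f x = 0).
  apply: (@noeth _ _ _ n _ s0) => [|x _]; last exact: Hs0.
  split=> [|x y Hx Hy|c x Hx|i x _ Hx]; first exact: qlin0 Hf.
  - by rewrite fD Hx Hy addr0.
  - by rewrite fZ Hx scaler0.
  - by rewrite fd // Hx dop0.
exists (size s), (fun l => s`_l) => x; split=> [/Hs/(gen_coef h)[c [_ ->]]|[y <-]].
  by exists (fun l => c l).
apply/Hs; apply: (subq_sum _ (gen_subq _ _)) => l _.
by apply: (inR_act (gen_subq _ _) (inR_all _)); apply/gen_in/mem_nth.
Qed.

Section Resolution.
Variables (X : dmod der) (p0 : nat) (eps : powm 'I_p0 wmod -> X).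
Hypothesis eps_lin : qlin n eps.

(** A map $D^b \to D^a$ given on the unit vectors. Both ranks change along the resolution, so they
    are packed with the map to allow iteration. *)
Definition stage := {a : nat & {b : nat & 'I_b -> powm 'I_a wmod}}.
Definition stage_map (s : stage) := lin (h := h) (projT2 (projT2 s)).

Arguments stage_map : clear implicits.

Lemma stage_next (s : stage) : exists c (w : 'I_c -> powm 'I_(projT1 (projT2 s)) wmod),
  forall x, stage_map s x = 0 <-> exists y, lin (h := h) w y = x.
Proof. by apply: free_kernel; exact: lin_qlin. Qed.
Definition next (s : stage) : stage :=
  let c := cid (stage_next s) in
  existT _ (projT1 (projT2 s)) (existT _ (projT1 c) (projT1 (cid (projT2 c)))).
Lemma nextP (s : stage) x : stage_map s x = 0 <-> exists y, stage_map (next s) y = x.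
Proof. by rewrite /stage_map /next /=; case: cid => c Hc /=; case: cid => w /= ->. Qed.

Definition first_stage : stage :=
  let b := cid (free_kernel eps_lin) in existT _ p0 (existT _ (projT1 b) (projT1 (cid (projT2 b)))).
Lemma first_stageP x : eps x = 0 <-> exists y, stage_map first_stage y = x.
Proof. by rewrite /stage_map /first_stage /=; case: cid => c Hc /=; case: cid => w /= ->. Qed.

(** The augmentation is returned as a map [eps'] with the image of [eps], because its source has to
    be indexed by [p 0]. *)
Lemma free_resolution : exists (p : nat -> nat) (v : forall i, 'I_(p i.+1) -> powm 'I_(p i) wmod)
    (eps' : powm 'I_(p 0) wmod -> X),
  [/\ qlin n eps', forall y, (exists x, eps x = y) <-> (exists x, eps' x = y),
    forall x, eps' x = 0 <-> exists y, bd v y = x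
    & forall i (x : powm 'I_(p i.+1) wmod), bd v x = 0 <-> exists y, bd v y = x].
Proof.
pose st i := iter i next first_stage.
exists (fun i => projT1 (st i)), (fun i => projT2 (projT2 (st i))), eps.
split=> //; first exact: first_stageP.
by move=> i x; exact: nextP.
Qed.
End Resolution.

Variables (d : nat) (M : dmod der) (g : seq M).
Hypothesis dn : (d <= n)%N.
Hypothesis gM : forall x, gen d g x.
Hypothesis tf : forall (p : W) (x : M), inR d p -> act p x = 0 -> p = 0 \/ x = 0.

(* The right [D]-module structure of [Hom(M, K[d_0, .., d_(d-1)])], extended to all functions,
   and turned into a left one. *)
Definition funmod : dmod der.
Proof.
refine (@DMod K n der (M -> W : lmodType K)
  (fun i phi m => wX h i * (phi m : W) - (phi (dop i m) : W) - (phi m : W) * wX h i) _ _ _).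
- move=> i x y; apply/funext => m.
  pose a : W := x m; pose b : W := y m; pose a' : W := x (dop i m); pose b' : W := y (dop i m).
  change (wX h i * (a + b) - (a' + b') - (a + b) * wX h i =
    (wX h i * a - a' - a * wX h i) + (wX h i * b - b' - b * wX h i)).
  by rewrite mulrDl mulrDr !opprD [X in X + _ = _]addrACA [LHS]addrACA.
- move=> i a x; apply/funext => m.
  pose b : W := x m; pose b' : W := x (dop i m).
  change (wX h i * (a *: b : W) - (a *: b' : W) - (a *: b : W) * wX h i =
    (a *: (wX h i * b - b' - b * wX h i) : W) + (der i a *: b : W)).
  rewrite wXmul wdZ -wXmul wscaleAl !scalerBr.
  by rewrite -!addrA; congr (_ + _); rewrite addrC !addrA.
- move=> i j x; apply/funext => m.
  (* Once the noncommutative products are expanded, only an additive identity remains; it can be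
     proved in the commutative polynomial ring on the same carrier. *)
  have E (t a b c e f g0 k l : {mpoly K[n]}) :
    (t - a - b) - (c - e - f) - (g0 - k - l) = (t - c - g0) - (a - e - k) - (b - f - l) by ring.
  pose A := wX h i; pose B := wX h j; pose a : W := x m; pose b : W := x (dop i m).
  pose c : W := x (dop j m); pose e : W := x (dop j (dop i m)).
  have e' : x (dop i (dop j m)) = e by rewrite dop_comm.
  change (A * (B * a - c - a * B) - (B * b - e - b * B) - (B * a - c - a * B) * A =
    B * (A * a - b - a * A) - (A * c - (x (dop i (dop j m)) : W) - c * A) - (A * a - b - a * A) * B).
  rewrite e' !mulrBr !mulrBl !(mulrA A) !(mulrA B) (wXC h i j : A * B = B * A).
  rewrite -[a * B * A]mulrA -[a * A * B]mulrA (wXC h i j : A * B = B * A).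
  exact: E.
Defined.

Lemma funmod_dop i (phi : funmod) m :
  dop i phi m = wX h i * (phi m : W) - (phi (dop i m) : W) - (phi m : W) * wX h i.
Proof. by []. Qed.
Notation anti := (@antilin K n der h d M).

(** Values stay in $R_d$ because $[d_i, \cdot]$ preserves $R_d$ for every $i$. For $i < d$
    antilinearity cancels the last two terms of the action, which becomes left multiplication by
    $d_i$. *)
Lemma anti_subq : @subq K n der n funmod anti.
Proof.
split.
- by split=> [|x]; [exact: qlin_cst0|exact: inR0].
- by move=> x y [Hx xR] [Hy yR]; split=> [|m]; [exact: (qlin_add Hx Hy)|exact: inRD].
- move=> a x [[xD xZ xd] xR]; split=> [|m]; last exact: inRZ.
  split=> [u v|c u|i u id].
  + change ((a *: (x (u + v) : W) : W) = (a *: (x u : W) : W) + (a *: (x v : W) : W)).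
    by rewrite xD -scalerDr.
  + change ((a *: (x (c *: u) : W) : W) = (a *: (x u : W) : W) * (c *: 1 : W)).
    by rewrite xZ wscaleAl.
  + change ((a *: (x (dop i u) : W) : W) = - ((a *: (x u : W) : W) * wX h i)).
    by rewrite xd // wscaleAl -scalerN.
- move=> i x _ [Hx xR]; case: (Hx) => xD xZ xd; split; last first.
    move=> m; rewrite funmod_dop addrAC; apply: inRB => //; apply: inR_comm => //; exact: xR.
  have xD' u v : x (u + v) = (x u : W) + (x v : W) by exact: xD.
  have xZ' c u : x (c *: u) = (x u : W) * (c *: 1 : W) by exact: xZ.
  have xd' (l : 'I_n) u : (l < d)%N -> x (dop l u) = - ((x u : W) * wX h l) by exact: xd.
  split=> [u v|c u|l u ld].
  + rewrite !funmod_dop dop_add !xD' mulrDl mulrDr !opprD [X in X + _ = _]addrACA [LHS]addrACA.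
    by [].
  + change (dop i x (c *: u) = (dop i x u : W) * (c *: 1 : W)).
    rewrite !funmod_dop dop_scale xD' !xZ' !mulrBl -!mulrA wX_scal mulrDr.
    by rewrite !opprD !addrA; exact: addrAC.
  + change (dop i x (dop l u) = - ((dop i x u : W) * wX h l)).
    rewrite !funmod_dop dop_comm !(xd' l) // mulrN mulNr !opprK !mulrBl -!mulrA (wXC h l i) !opprB.
    by rewrite addrC [X in _ + X]addrC.
Qed.

Lemma anti_dop (i : 'I_n) (phi : funmod) m : anti phi -> (i < d)%N -> dop i phi m = wd i (phi m : W).
Proof.
move=> [[_ _ xd] _] id; rewrite funmod_dop.
have -> : phi (dop i m) = - ((phi m : W) * wX h i) by exact: xd.
by rewrite opprK addrK wXmul.
Qed.

Lemma anti_eq (phi psi : funmod) : anti phi -> anti psi ->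
  (forall x, x \in g -> phi x = psi x) -> phi = psi.
Proof.
move=> [[xD xZ xd] _] [[yD yZ yd] _] E; apply/funext => m.
elim: (gM m) => {m} [m /E//||x y _ H1 _ H2|a x _ H|i x id _ H].
- by rewrite (@qlin0 _ _ _ d M wadmod phi) // (@qlin0 _ _ _ d M wadmod psi).
- by rewrite xD yD H1 H2.
- by rewrite xZ yZ H.
- by rewrite xd // yd // H.
Qed.

(** Evaluation at the generators [g] embeds the antilinear functionals $R_d$-linearly into a free
    $R_d$-module of finite rank; noetherianity of $R_d$ applies. *)
Lemma anti_fg : exists s : seq funmod, (forall phi, phi \in s -> anti phi) /\
  forall phi : funmod, anti phi -> gen d s phi.
Proof.
pose G := powm 'I_(size g) wmod.
pose ev (phi : funmod) : G := fun l => phi g`_l.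
have dsub := subq_le dn anti_subq.
have evd (i : 'I_n) (phi : funmod) : anti phi -> (i < d)%N -> ev (dop i phi) = dop i (ev phi).
  by move=> Hphi id; apply/funext => l; exact: anti_dop.
pose V (y : G) := exists2 phi : funmod, anti phi & y = ev phi.
have HV : subq d V.
  case: dsub => A0 AD AZ Ad; split.
  - by exists 0.
  - by move=> _ _ [x Hx ->] [y Hy ->]; exists (x + y); first exact: AD.
  - by move=> a _ [x Hx ->]; exists (a *: x); first exact: AZ.
  - by move=> i _ id [x Hx ->]; exists (dop i x); [exact: Ad|rewrite evd].
have [t Ht] : fgq d V.
  apply: (@noeth _ _ _ d G (map (@unit_vec _ _ _ h _) (enum 'I_(size g)))) => // _ [phi [_ phiR] ->].
  rewrite (congr1 (fun f => f (ev phi)) (qlin_lin (qlin_id n G))).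
  apply: (subq_sum _ (gen_subq _ _)) => l _.
  apply: (inR_act (gen_subq _ _)); first exact: phiR.
  by apply/gen_in/map_f; rewrite mem_enum.
have [s Hs Hst] : exists2 s : seq funmod, (forall phi, phi \in s -> anti phi) &
    forall y, y \in t -> exists2 phi, phi \in s & ev phi = y.
  have: forall y, y \in t -> V y by move=> y yt; apply/Ht/gen_in.
  elim: (t) => [|y u IH] Hu; first by exists [::].
  have [|s Hs Hsu] := IH; first by move=> z zu; apply: Hu; rewrite inE zu orbT.
  have [phi Hphi Ey] := Hu y (mem_head _ _); exists (phi :: s) => z.
    by rewrite inE => /orP[/eqP->|/Hs].
  rewrite inE => /orP[/eqP->|/Hsu[psi ps E]]; first by exists phi; rewrite ?mem_head.
  by exists psi; rewrite // inE ps orbT.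
exists s; split=> // phi Hphi.
have lift y : gen d t y -> exists psi : funmod, [/\ gen d s psi, anti psi & ev psi = y].
  case: dsub => A0 AD AZ Ad.
  elim=> {y} [y /Hst[psi ps E]||x y _ [f [gf Hf <-]] _ [f' [gf' Hf' <-]]|a x _ [f [gf Hf <-]]|i x id _ [f [gf Hf <-]]].
  - by exists psi; split=> //; [exact: gen_in|exact: Hs].
  - by exists 0; split=> //; exact: gen_0.
  - by exists (f + f'); split=> //; [exact: gen_add|exact: AD].
  - by exists (a *: f); split=> //; [exact: gen_scale|exact: AZ].
  - by exists (dop i f); split; [exact: gen_dop|exact: Ad|exact: evd].
have [psi [gpsi Hpsi Epsi]] : exists psi : funmod, [/\ gen d s psi, anti psi & ev psi = ev phi].
  by apply: lift; apply/Ht; exists phi.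
suff -> : phi = psi by [].
apply: anti_eq => // x xg; have := congr1 (fun f : 'I_(size g) -> W => f (Ordinal (n:=size g) (m:=index x g) _)) Epsi.
have ix : (index x g < size g)%N by rewrite index_mem.
by move=> /(_ ix); rewrite /ev /= nth_index.
Qed.

(** * The dual complex, its cokernels and their projective dimension *)

Section Cokernels.
Variables (p : nat -> nat) (v : forall i, 'I_(p i.+1) -> powm 'I_(p i) wmod).
Notation G i := (powm 'I_(p i) wmod).
Notation A i := (powm 'I_(p i) wadmod).
Hypothesis exact_at : forall i (f : G i -> W), (i < n - d)%N -> wlin n f ->
  (forall x, f (bd v x) = 0) -> cob v n f.
Hypothesis bd2 : forall i (x : G i.+2), bd v (bd v x) = 0.

(** Identifies [A i] with $\mathrm{Hom}_D(G_i, D)$, whose right $D$-module structure is made a left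
    one through the adjoint. *)
Definition hom i (a : A i) : G i -> W := lin (h := h) (X := wmod) (a : 'I_(p i) -> W).
Lemma hom_lin i (a : A i) : wlin n (hom a). Proof. exact: lin_qlin. Qed.
Lemma homE i (f : G i -> W) : wlin n f ->
  hom ((fun l => f (unit_vec h l)) : A i) = f.
Proof. by move=> Hf; apply/esym; exact: (qlin_lin (X := wmod) Hf). Qed.
Lemma hom_unit i (a : A i) l : hom a (unit_vec h l) = a l.
Proof. by rewrite /hom lin_unit. Qed.
Lemma hom_eq i (a : A i) (f : G i -> W) : wlin n f -> (forall l, a l = f (unit_vec h l)) ->
  forall x, hom a x = f x.
Proof. by move=> Hf E x; rewrite -[in RHS](homE Hf); congr (hom _ x); apply/funext. Qed.
Lemma homD i (a b : A i) x : hom (a + b) x = hom a x + hom b x.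
Proof.
apply: (hom_eq (f := fun x => hom a x + hom b x)) => [|l]; last by rewrite !hom_unit.
exact: (qlin_add (hom_lin a) (hom_lin b)).
Qed.
Lemma homZ i c (a : A i) x : hom (c *: a) x = hom a x * (c *: 1 : W).
Proof.
apply: (hom_eq (f := fun x => hom a x * (c *: 1 : W))) => [|l]; last by rewrite !hom_unit.
exact: (qlin_comp (mulr_lin (c *: 1 : W) n) (hom_lin a)).
Qed.
Lemma hom_dop i j (a : A i) x : hom (dop j a) x = - (hom a x * wX h j).
Proof.
apply: (hom_eq (f := fun x => - (hom a x * wX h j))) => [|l]; last by rewrite !hom_unit.
exact: (qlin_opp (qlin_comp (mulr_lin (wX h j) n) (hom_lin a))).
Qed.

Definition coblock i (a : A i) : Prop := cob v n (hom a).
Lemma coblock_subq i : subq n (@coblock i).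
Proof.
split=> [|a b Ha Hb|c a Ha|j a _ Ha].
- apply: eq_cob (cob0 v n i) => x; rewrite -(subrr (0 : A i)) homD.
  by rewrite -scaleN1r homZ scaleN1r mulrN mulr1 subrr.
- by apply: eq_cob (cobD Ha Hb) => x; rewrite homD.
- by apply: eq_cob (cob_comp (mulr_lin (c *: 1 : W) n) Ha) => x; rewrite homZ.
- by apply: eq_cob (cobN (cob_comp (mulr_lin (wX h j) n) Ha)) => x; rewrite hom_dop.
Qed.

(** The cokernel of the transposed differential into [A i]; for [i = 0] the submodule divided out is
    zero. *)
Definition cok i : dmod der := quot (@coblock_subq i).
Definition tbd i (a : A i) : A i.+1 := fun l => hom a (v l).
Lemma hom_tbd i (a : A i) x : hom (tbd a) x = hom a (bd v x).
Proof.
have Hl : wlin n (fun x => hom a (bd v x)) := qlin_comp (hom_lin a) (bd_lin v i (leqnn n)).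
by apply: (hom_eq Hl) => l; rewrite /bd lin_unit.
Qed.
Lemma tbd_dlinear i : dlinear (@tbd i).
Proof.
split=> [a b|c a|j a]; apply/funext => l; [exact: homD|exact: homZ|exact: hom_dop].
Qed.

Lemma coblock_tbd i (a : A i.+1) : coblock a <-> exists b, tbd b = a.
Proof.
split=> [[w Hw E]|[b <-]]; last by exists (hom b); [exact: hom_lin|exact: hom_tbd].
exists (fun l => w (unit_vec h l)); apply/funext => l.
by rewrite /tbd homE // -[RHS]hom_unit E /bd lin_unit.
Qed.

(** Exactness of the dual complex in degree $i$ makes the map from [cok i] to [A i.+1] induced by
    [tbd] injective, with cokernel [cok i.+1]. So each step adds one projective term, starting from
    [cok 0], a retract of [A 0]. *)
Lemma cok_pd i : (i <= n - d)%N -> pd_le i (cok i).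
Proof.
elim: i => [|i IH] id.
  have [||f Hf fE] := @qproj_factor _ _ _ _ _ (@coblock_subq 0) (A 0) (fun x => x).
  - by [].
  - by move=> a Ha; apply/funext => l; rewrite -hom_unit; exact: Ha.
  apply: (projective_retract (@adfree_projective _ _ _ h (p 0)) (qproj_dlinear (@coblock_subq 0)) Hf).
  move=> y; have [x <-] := qproj_surj y; by rewrite fE.
have [||f Hf fE] := @qproj_factor _ _ _ _ _ (@coblock_subq i) (A i.+1) (@tbd i).
- exact: tbd_dlinear.
- move=> a Ha; apply/funext => l; rewrite /tbd; case: i a Ha id IH l => [|i] a Ha id IH l; first exact: Ha.
  have /coblock_tbd[b <-] := Ha; have -> : v l = bd v (unit_vec h l) by rewrite /bd lin_unit.
  by rewrite hom_tbd bd2; exact: (qlin0 (hom_lin b)).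
exists (A i.+1), (cok i), f, (qproj (@coblock_subq i.+1)); split.
- by split; [exact: adfree_projective|apply: IH; exact: ltnW].
- by split=> //; exact: qproj_dlinear.
- move=> y y'; have [x <-] := qproj_surj y; have [x' <-] := qproj_surj y'.
  rewrite !fE => E; apply/qproj_eq; apply: exact_at => // [|z]; first exact: hom_lin.
  have := hom_tbd x z; rewrite E hom_tbd => E'.
  have -> : x - x' = x + (-1) *: x' by rewrite scaleN1r.
  by rewrite homD homZ -E' scaleN1r mulrN mulr1 subrr.
- exact: qproj_surj.
- move=> x; split=> [E|[y <-]].
    have /coblock_tbd[b Hb] : coblock x.
      rewrite -[x]subr0; apply/(qproj_eq (@coblock_subq i.+1)); rewrite E.
      by rewrite (qlin0 ((qlin_dlin _).1 (qproj_dlinear (@coblock_subq i.+1)))).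
    by exists (qproj (@coblock_subq i) b); rewrite fE.
  have [a <-] := qproj_surj y; rewrite fE.
  rewrite -(qlin0 ((qlin_dlin _).1 (qproj_dlinear (@coblock_subq i.+1)))).
  by apply/qproj_eq; rewrite subr0; apply/coblock_tbd; exists a.
Qed.

Lemma cok_fingen i : fingen (cok i).
Proof.
have [s Hs] := free_gen h (p i).
apply: (@fingen_image _ _ _ (powm 'I_(p i) wmod) (cok i) (fun x => qproj (@coblock_subq i) (adjv x)) s Hs).
  apply/qlin_dlin/(@qlin_comp _ _ _ _ _ (A i)); first exact/qlin_dlin/qproj_dlinear.
  exact/qlin_dlin/adjv_free.
by move=> y; have [x <-] := qproj_surj y; exists (adjv x); rewrite adjvK.
Qed.
End Cokernels.

Theorem embed_torsionfree : exists L : dmod der,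
  [/\ fingen L, pd_le (n - d) L & exists f : M -> L, dlinear f /\ injective f].
Proof.
have [s [santi santiP]] := anti_fg.
pose eps0 : powm 'I_(size s) wmod -> funmod := lin (fun l => s`_l).
have [p [v [eps [Heps epsE ex0 exS]]]] := free_resolution (lin_qlin h (fun l : 'I_(size s) => s`_l)).
have dsub := subq_le dn anti_subq.
have anti_eps x : anti (eps x).
  have [y <-] : exists y, eps0 y = eps x by apply/epsE; exists x.
  apply: (subq_sum _ anti_subq) => l _; apply: (inR_act anti_subq (inR_all _)).
  exact/santi/mem_nth.
have s_eps y : y \in s -> exists x, eps x = y.
  move=> ys; apply/epsE; have ix : (index y s < size s)%N by rewrite index_mem.
  exists (unit_vec h (Ordinal ix)); by rewrite lin_unit /= nth_index.
have eps_s x : gen d s (eps x) by exact: santiP.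
pose pair x m : W := eps x m.
have P1 m : wlin d (fun x => pair x m).
  case: (Heps) => eD eZ ed; split=> [x y|a x|i x id].
  - by rewrite /pair eD.
  - by rewrite /pair eZ.
  - by rewrite /pair ed // anti_dop.
have P2 x m : inR d (pair x m) by case: (anti_eps x).
have P3 y m : pair (bd v y) m = 0 by rewrite /pair (_ : eps (bd v y) = 0) //; apply/ex0; exists y.
have P4 x m m' : pair x (m + m') = pair x m + pair x m' by case: (anti_eps x) => [[H _ _] _]; exact: H.
have P5 x a m : pair x (a *: m) = pair x m * (a *: 1 : W) by case: (anti_eps x) => [[_ H _] _]; exact: H.
have P6 x i m : pair x (dop i m) = wX h i * pair x m - pair (dop i x) m - pair x m * wX h i.
  rewrite /pair; case: (Heps) => _ _ -> //; rewrite funmod_dop.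
  have E (P Q R : {mpoly K[n]}) : Q = P - (P - Q - R) - R by ring.
  exact: E.
have P7 m : (forall x, pair x m = 0) -> m = 0.
  move=> H; apply/eqP/negP => /negP m0.
  have [phi Hphi /eqP[]] := antilin_separates gM tf m0.
  have [y Ey] : exists y, eps y = phi.
    apply/epsE; have [c [_ ->]] := gen_coef h (santiP _ Hphi).
    by exists (fun l => c l).
  by rewrite -Ey; exact: H.
pose r := (n - d)%N; have drn : (d + r)%N = n by rewrite subnKC.
pose T := @transfer K n der h d p v M pair r.
have Ttot m : exists f, T m f by apply: transfer_total => //; rewrite drn.
have Tfacts m f : T m f -> wlin n f.
  move=> H; have [] : [/\ wlin (d + r) f, forall x : powm 'I_(p r.+1) wmod, f (bd v x) = 0
    & forall x, inR (d + r) (f x)] by apply: transfer_facts H.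
  by rewrite drn.
pose tr m := sval (cid (Ttot m)).
have trP m : T m (tr m) by rewrite /tr; case: cid.
have van : forall i (f : powm 'I_(p i) wmod -> W), (i < n - d)%N -> wlin n f ->
    (forall x, f (bd v x) = 0) -> cob v n f.
  move=> i f id; apply: (@vanishing _ _ _ h d funmod p v eps Heps ex0 exS s s_eps eps_s n i f) => //.
  by rewrite dn leqnn.
have TB m m' f f' : T m f -> T m' f' -> T (m - m') (fun x => f x - f' x).
  move=> H H'; have := transferD P4 H (transferZ P5 (-1) H').
  rewrite scaleN1r; congr transfer; apply/funext => x; by rewrite scaleN1r mulrN mulr1.
have Twd m f f' : T m f -> T m f' -> cob v n (fun x => f x - f' x).
  move=> H H'; rewrite -[X in cob v X _]drn; apply: transfer_wd => //; last by rewrite drn.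
  by have := TB _ _ _ _ H H'; rewrite subrr.
exists (cok v r); split; first exact: cok_fingen.
  apply: cok_pd => // i x; exact: (bdbd exS).
pose vec (f : powm 'I_(p r) wmod -> W) : powm 'I_(p r) wadmod := fun l => f (unit_vec h l).
(* The chosen transfers [tr m] depend on [m] neither additively nor $D$-linearly; only their classes
   in the cokernel do. Linearity is therefore checked by comparing two transfers of the same
   element. *)
have vecE m f a : T m f -> T m (hom a) -> qproj (coblock_subq v r) (vec f) = qproj (coblock_subq v r) a.
  move=> H H'; apply/qproj_eq; rewrite /coblock.
  apply: eq_cob (Twd _ _ _ H H') => x; rewrite -scaleN1r homD homZ homE; last exact: Tfacts H.
  by rewrite scaleN1r mulrN mulr1.
exists (fun m => qproj (coblock_subq v r) (vec (tr m))); split.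
  have [qD qZ qd] := qproj_dlinear (coblock_subq v r).
  split=> [m m'|a m|i m].
  - rewrite -qD; apply: (vecE (m + m')) => //.
    have := transferD P4 (trP m) (trP m'); congr transfer; apply/funext => x.
    by rewrite homD !homE //; exact: Tfacts (trP _).
  - rewrite -qZ; apply: (vecE (a *: m)) => //.
    have := transferZ P5 a (trP m); congr transfer; apply/funext => x.
    by rewrite homZ !homE //; exact: Tfacts (trP _).
  - rewrite -qd; apply: (vecE (dop i m)) => //.
    have := transfer_twist exS P1 P2 P3 P6 i (trP m).
    congr transfer; apply/funext => x.
    rewrite hom_dop !homE; last exact: Tfacts (trP _).
    rewrite /twist; case: (Tfacts _ _ (trP m)) => _ _ -> //.
    by rewrite wXmul; change (wd i (tr m x) - wd i (tr m x) - tr m x * wX h i = - (tr m x * wX h i));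
      rewrite subrr sub0r.
move=> m m' /qproj_eq H; apply/eqP; rewrite -subr_eq0; apply/eqP.
apply: (transfer_inj Heps ex0 exS s_eps eps_s P1 P2 P3 P7 (TB _ _ _ _ (trP m) (trP m'))).
rewrite drn; apply: eq_cob H => x.
by rewrite -scaleN1r homD homZ !homE ?scaleN1r ?mulrN ?mulr1 //; exact: Tfacts (trP _).
Qed.
End Embedding.

(** * Growth *)

Section LinearAlgebra.
Variables (K : fieldType) (n : nat) (der : 'I_n -> K -> K) (X : dmod der).

Lemma gen0_coef (v : seq X) x : gen 0 v x -> exists c : 'I_(size v) -> K, x = \sum_i c i *: v`_i.
Proof.
elim=> {x} [x xs||x y _ [c ->] _ [e ->]|a x _ [c ->]|//].
- have ix : (index x v < size v)%N by rewrite index_mem.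
  exists (fun i => (i == Ordinal ix)%:R); rewrite (bigD1 (Ordinal ix)) //= eqxx scale1r nth_index //.
  by rewrite big1 ?addr0 // => i /negbTE->; rewrite scale0r.
- by exists (fun=> 0); rewrite big1 // => i _; rewrite scale0r.
- by exists (fun i => c i + e i); rewrite -big_split; apply: eq_bigr => i _; rewrite scalerDl.
- by exists (fun i => a * c i); rewrite scaler_sumr; apply: eq_bigr => i _; rewrite scalerA.
Qed.

Lemma dependent_family (T : finType) (u : T -> X) (v : seq X) :
  (size v < #|T|)%N -> (forall t, gen 0 v (u t)) ->
  exists c : T -> K, (exists t, c t != 0) /\ \sum_t c t *: u t = 0.
Proof.
move=> vT uv; pose a t := sval (cid (gen0_coef (uv t))).
have aE t : u t = \sum_i a t i *: v`_i by rewrite /a; case: cid.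
pose A := \matrix_(k < #|T|, i < size v) a (enum_val k) i.
have kA : kermx A != 0.
  by rewrite kermx_eq0 /row_free neq_ltn (leq_ltn_trans (rank_leq_col A) vT).
have /rowV0Pn[r rA r0] := kA.
have rA0 : r *m A = 0 by apply/sub_kermxP.
exists (fun t => r 0 (enum_rank t)); split.
  have [k rk] : exists k, r 0 k != 0 by apply/rV0Pn.
  by exists (enum_val k); rewrite enum_valK.
under eq_bigr => t _ do rewrite aE scaler_sumr.
rewrite exchange_big /= big1 // => i _.
under eq_bigr => t _ do rewrite scalerA.
rewrite -scaler_suml; suff -> : \sum_t r 0 (enum_rank t) * a t i = 0 by rewrite scale0r.
have : (r *m A) 0 i = 0 by rewrite rA0 mxE.
rewrite mxE => E; rewrite -[RHS]E (reindex (@enum_val T predT)) /=; last first.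
  by apply: onW_bij; exact: enum_val_bij.
by apply: eq_bigr => k _; rewrite mxE enum_valK.
Qed.

Lemma independent_basis (fam : seq X) :
  exists u, [/\ subseq u fam, independent u & forall x, x \in fam -> gen 0 u x].
Proof.
elim: fam => [|z t [u [ut iu tu]]]; first by exists [::].
case: (pselect (gen 0 u z)) => [gz|gz].
  exists u; split=> // [|x]; first exact: subseq_trans ut (subseq_cons _ _).
  by rewrite inE => /orP[/eqP->|/tu].
exists (z :: u); split=> [|c|x]; first by rewrite /= eqxx.
  rewrite /= big_ord_recl /= => E0.
  have E : c`_0 *: z + \sum_(i < size u) c`_i.+1 *: u`_i = 0 := E0.
  have c0 : c`_0 = 0.
    apply: contra_notP gz => /eqP c0.
    have -> : z = (- (c`_0)^-1) *: \sum_(i < size u) c`_i.+1 *: u`_i.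
      move/eqP: E; rewrite addr_eq0 => /eqP E.
      by rewrite scaleNr -scalerN -E scalerA mulVf // scale1r.
    apply: gen_scale; apply: (subq_sum _ (gen_subq 0 u)) => i _.
    by apply/gen_scale/gen_in/mem_nth.
  move: E; rewrite c0 scale0r add0r => E [//|i] iu'.
  have := iu (behead c); rewrite -(nth_behead 0 c i); apply=> //.
  by rewrite -[RHS]E; apply: eq_bigr => k _; rewrite nth_behead.
rewrite inE => /orP[/eqP->|/tu]; first by apply: gen_in; rewrite mem_head.
by apply: gen_sub => y yu; rewrite inE yu orbT.
Qed.

Definition dimle (V : X -> Prop) k :=
  exists v : seq X, (size v <= k)%N /\ forall x, V x -> gen 0 v x.

Lemma dimle_sub (V V' : X -> Prop) k k' :
  (k <= k')%N -> (forall x, V' x -> V x) -> dimle V k -> dimle V' k'.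
Proof. by move=> kk VV [v [sv Hv]]; exists v; split=> [|x /VV/Hv//]; exact: leq_trans kk. Qed.

Lemma span_dim_dimle (fam : seq X) k : span_dim fam k -> dimle (gen 0 fam) k.
Proof.
case=> _ Hmax; have [u [ut iu tu]] := independent_basis fam; exists u; split; first exact: Hmax.
by apply: gen_min => //; exact: gen_subq.
Qed.
Lemma span_dim_le (fam : seq X) k k' : span_dim fam k -> dimle (gen 0 fam) k' -> (k <= k')%N.
Proof.
case=> -[w wf [iw <-]] _ [v [sv Hv]]; rewrite leqNgt; apply/negP => lt.
have [||c [[t ct] E]] := @dependent_family 'I_(size w) (fun i => w`_i) v.
- by rewrite card_ord; apply: leq_ltn_trans lt.
- by move=> i; apply/Hv/gen_in/(mem_subseq wf)/mem_nth.
have := iw (mkseq (fun i => if insub i is Some t then c t else 0) (size w)).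
have N (i : 'I_(size w)) : (mkseq (fun i => if insub i is Some t then c t else 0) (size w))`_i = c i.
  by rewrite nth_mkseq // valK.
move=> H; have /(_ _ t (ltn_ord t)) := H; rewrite N => ct0; move/eqP: ct; apply; apply: ct0.
by rewrite -[RHS]E; apply: eq_bigr => i _; rewrite N.
Qed.
End LinearAlgebra.

Section Growth.
Variables (K : fieldType) (n : nat) (der : 'I_n -> K -> K) (X : dmod der).
Implicit Types (x y : X) (s : nat).

Definition ordsp s x : X -> Prop := gen 0 (Dfam s x).

Lemma Dfam_in s (al : 'I_n -> nat) x : (\sum_i al i <= s)%N -> dpow al x \in Dfam s x.
Proof.
move=> als; have ali i : (al i < s.+1)%N.
  by rewrite ltnS; apply: leq_trans als; rewrite (bigD1 i) //= leq_addr.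
apply/mapP; exists [ffun i => inord (al i) : 'I_s.+1]; last first.
  by apply: eq_dpow => i; rewrite ffunE inordK.
rewrite mem_filter mem_enum andbT; apply: leq_trans als; apply: eq_leq.
by apply: eq_bigr => i _; rewrite ffunE inordK.
Qed.
Lemma DfamP s x y : y \in Dfam s x -> exists2 al : 'I_n -> nat, (\sum_i al i <= s)%N & y = dpow al x.
Proof. by case/mapP => f; rewrite mem_filter => /andP[Hf _] ->; exists (fun i => nat_of_ord (f i)). Qed.
Lemma ordsp_le s s' x y : (s <= s')%N -> ordsp s x y -> ordsp s' x y.
Proof.
move=> ss; apply: gen_sub => z /DfamP[al als ->]; apply: Dfam_in; exact: leq_trans ss.
Qed.
Lemma ordsp_dop s i x y : ordsp s x y -> ordsp s.+1 x (dop i y).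
Proof.
elim=> {y} [y /DfamP[al als ->]||y z _ H _ H'|a y Hy H|//].
- rewrite -dpowS; apply/gen_in/Dfam_in; rewrite big_split /=.
  have -> : (\sum_k (k == i) = 1)%N by rewrite (bigD1 i) //= eqxx big1 // => k /negbTE->.
  by rewrite addn1 ltnS.
- by rewrite dop0; apply: gen_0.
- by rewrite dop_add; apply: gen_add.
- rewrite dop_scale; apply: gen_add; apply: gen_scale => //; exact: ordsp_le Hy.
Qed.
Lemma ordsp_iter s i k x y : ordsp s x y -> ordsp (s + k) x (iter k (@dop _ _ _ X i) y).
Proof. by move=> H; elim: k => [|k IH]; rewrite ?addn0 // addnS; apply: ordsp_dop. Qed.
Lemma ordsp0 x : ordsp 0 x x.
Proof.
have : dpow (fun=> 0%N) x \in Dfam 0 x by apply: Dfam_in; rewrite big1.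
by rewrite dpow0 // => H; apply: gen_in.
Qed.

Definition upper d := forall x, exists C, forall s, dimle (ordsp s x) (C * s.+1 ^ d).
(** No nonzero element has growth of degree below [d]. The factor [s.+1] stands on the left so that
    the case [d = 0] needs no negative exponent. *)
Definition lower d := forall x,
  (exists C, forall s, exists k, dimle (ordsp s x) k /\ (k * s.+1 <= C * s.+1 ^ d)%N) -> x = 0.

(** The monomials in the first $j + 1 > d$ derivations with exponents at most [s] outnumber the
    dimension of the space of order $ns$ that contains their values at [x]; a linear relation
    between these values is the operator [p]. *)
Lemma annihilator (h : commuting_derivations der) d (j : 'I_n) x : upper d -> (d <= j)%N ->
  exists p : wop h, [/\ inR j.+1 p, p != 0 & act p x = 0].
Proof.
(* This [s] gives $C (ns+1)^d \le C n^d (s+1)^d = s (s+1)^d < (s+1)^{d+1}$. *)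
move=> /(_ x)[C HC] dj; pose s := (C * n ^ d)%N.
have n0 : (0 < n)%N by apply: leq_ltn_trans (ltn_ord j).
pose T := {ffun 'I_j.+1 -> 'I_s.+1}.
pose al (f : T) : 'X_{1..n} := [multinom (if (i < j.+1)%N then f (inord i) : nat else 0%N) | i < n].
have al_inj : injective al.
  move=> f f' E; apply/ffunP => i; apply: val_inj.
  have ilt : (i < n)%N by apply: leq_trans (ltn_ord i) (ltn_ord j).
  have := congr1 (fun m : 'X_{1..n} => m (Ordinal ilt)) E.
  rewrite !mnmE /= ltn_ord; suff -> : inord i = i by [].
  exact: inord_val.
have [v [sv Hv]] := HC (n * s)%N.
have [||c [[t ct] E]] := @dependent_family _ _ _ X T (fun f => dpow (al f) x) v.
- apply: leq_ltn_trans sv _; rewrite card_ffun !card_ord.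
  apply: (@leq_ltn_trans (C * (n * s.+1) ^ d)).
    have H : ((n * s).+1 <= n * s.+1)%N by rewrite mulnS; lia.
    by rewrite leq_mul2l; apply/orP; right; case: (d) => // d'; rewrite leq_exp2r.
  rewrite expnMn mulnA -/s; apply: (@leq_trans (s.+1 ^ d.+1)); last by rewrite leq_pexp2l.
  by rewrite expnS ltn_mul2r expn_gt0 /= ltnSn.
- move=> f; apply/Hv/gen_in/Dfam_in.
  rewrite -[X in (_ <= X * _)%N](card_ord n) -sum_nat_const.
  by apply: leq_sum => i _; rewrite mnmE; case: ifP => // _; rewrite -ltnS.
pose p : wop h := \sum_f c f *: ('X_[al f] : {mpoly K[n]}).
have pE f : (p : {mpoly K[n]})@_(al f) = c f.
  rewrite /p raddf_sum (bigD1 f) //= mcoeffZ mcoeffX eqxx mulr1 big1 ?addr0 // => f' ne.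
  by rewrite mcoeffZ mcoeffX (inj_eq al_inj) (negbTE ne) mulr0.
exists p; split.
- apply: (@subq_sum _ _ _ _ (wmod h) _ _ _ _ _ (inR_subq h _)) => f _; apply/inRZ/inR_mono => i ji.
  by rewrite mnmE ltnNge ji.
- by apply: contraNneq ct => p0; rewrite -pE p0 mcoeff0.
- rewrite -[RHS]E /p /act lext_sumr; apply: eq_bigr => f _.
  by rewrite lextZ lextX.
Qed.
End Growth.

(** * From Hilbert polynomials to growth bounds *)

Section HilbertPolynomial.
Import Order.TTheory Num.Theory.

Lemma poly_upper (P : {poly rat}) d : (size P <= d.+1)%N ->
  exists C : nat, forall s : nat, P.[s%:R] <= (C * s.+1 ^ d)%:R.
Proof.
move=> sP; pose B := \sum_(i < size P) `|P`_i|.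
have B0 : 0 <= B by apply: sumr_ge0.
exists (Num.bound B) => s; rewrite natrM.
apply: (@le_trans _ _ (B * (s.+1 ^ d)%:R)); last first.
  by rewrite ler_wpM2r ?ler0n // ltW // archi_boundP.
rewrite horner_coef /B mulr_suml; apply: ler_sum => i _.
apply: (le_trans (ler_norm _)); rewrite normrM ler_wpM2l // ger0_norm ?exprn_ge0 ?ler0n //.
rewrite -natrX ler_nat; apply: (@leq_trans (s.+1 ^ i)).
  by case: (nat_of_ord i) => // k; rewrite leq_exp2r.
by rewrite leq_pexp2l // -ltnS (leq_trans (ltn_ord i)).
Qed.

Lemma lead_coef_ge0 (P : {poly rat}) s0 : (forall s : nat, (s0 <= s)%N -> 0 <= P.[s%:R]) ->
  0 <= lead_coef P.
Proof.
move=> HP; rewrite leNgt; apply/negP => lt0.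
have [|x Hx] := @polyrcf.poly_pinfty_gt_lc _ (- P).
  by rewrite lead_coefN oppr_gt0.
pose s := maxn s0 (Num.bound `|x|).
have xs : x <= s%:R.
  apply: le_trans (ler_norm x) _; apply: ltW; apply: lt_le_trans (archi_boundP (normr_ge0 x)) _.
  by rewrite ler_nat leq_maxr.
have := Hx _ xs; rewrite lead_coefN hornerN lerNr opprK => H.
have := HP s (leq_maxl _ _); rewrite leNgt; move/negP; apply.
exact: le_lt_trans H lt0.
Qed.

(** The polynomial $C (X+1)^d - P \cdot (X+1)$ is nonnegative at all large integers, but if $\deg P
    \ge d$ its leading coefficient is the opposite of that of $P$, which is positive. *)
Lemma poly_lower (P : {poly rat}) d s0 (C : nat) :
  (forall s : nat, (s0 <= s)%N -> 0 <= P.[s%:R]) ->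
  (forall s : nat, (s0 <= s)%N -> P.[s%:R] * s.+1%:R <= (C * s.+1 ^ d)%:R) -> (size P <= d)%N.
Proof.
move=> P0 PC; rewrite leqNgt; apply/negP => dP.
have Pn0 : P != 0 by rewrite -size_poly_gt0 (leq_ltn_trans _ dP).
pose Y : {poly rat} := 'X + 1%:P.
have sY : size Y = 2 by rewrite size_XaddC.
have Y0 : Y != 0 by rewrite -size_poly_gt0 sY.
have YE s : Y.[s%:R] = s.+1%:R by rewrite /Y hornerD hornerX hornerC -natr1.
pose Q := C%:R%:P * Y ^+ d - P * Y.
have HQ : lead_coef Q = - lead_coef P.
  rewrite /Q addrC lead_coefDl; last first.
    rewrite size_polyN (size_mul Pn0 Y0) sY addn2 /=; apply: leq_ltn_trans (size_polyMleq _ _) _.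
    have s1 := size_polyC_leq1 (C%:R : rat).
    have s2 : size (Y ^+ d) = d.+1.
      by have := size_exp Y d; rewrite sY mul1n; have := size_poly_gt0 (Y ^+ d); rewrite expf_neq0 //; case: (size _) => // k _ /= ->.
    by rewrite s2 addnS /= ltnS; apply: leq_trans dP; rewrite -add1n leq_add2r.
  by rewrite lead_coefN lead_coefM lead_coefXaddC mulr1.
have : 0 <= lead_coef Q.
  apply: (@lead_coef_ge0 _ s0) => s ss; rewrite /Q hornerD hornerN !hornerM hornerC horner_exp YE.
  by rewrite subr_ge0 -natrX -natrM; exact: PC.
rewrite HQ oppr_ge0 => l0; have l1 := lead_coef_ge0 P0.
have lc0 : lead_coef P = 0 by apply/le_anti; rewrite l0 l1.
by move/eqP: lc0; rewrite lead_coef_eq0 (negbTE Pn0).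
Qed.

Variables (K : fieldType) (n : nat) (der : 'I_n -> K -> K) (M : dmod der).

Lemma hilb_upper (m : M) P d : hilb_poly m P -> (size P <= d.+1)%N ->
  exists C, forall s, dimle (ordsp s m) (C * s.+1 ^ d).
Proof.
move=> [s0 HP] sP; have [C HC] := poly_upper sP.
have U s : (s0 <= s)%N -> dimle (ordsp s m) (C * s.+1 ^ d).
  move=> ss; have [k [sk Pk]] := HP _ ss.
  apply: (dimle_sub _ (fun _ H => H) (span_dim_dimle sk)).
  by have := HC s; rewrite Pk ler_nat.
exists (C * s0.+1 ^ d)%N => s; case: (leqP s0 s) => ss.
  apply: (dimle_sub _ (fun _ H => H) (U _ ss)); rewrite leq_mul2r -[X in (X <= _)%N]muln1 leq_mul2l.
  by rewrite expn_gt0 /= !orbT.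
apply: (dimle_sub _ _ (U _ (leqnn _))) => [|x]; last exact/ordsp_le/ltnW.
by rewrite -[X in (X <= _)%N]muln1 leq_mul2l expn_gt0 /= orbT.
Qed.

Lemma hilb_lower (m : M) P d C : hilb_poly m P ->
  (forall s, exists k, dimle (ordsp s m) k /\ (k * s.+1 <= C * s.+1 ^ d)%N) -> (size P <= d)%N.
Proof.
move=> [s0 HP] HC; apply: (@poly_lower _ _ s0 C) => s ss; have [k [sk ->]] := HP _ ss.
  exact: ler0n.
have [k' [dk kC]] := HC s; rewrite -natrM ler_nat; apply: leq_trans kC.
by rewrite leq_mul2r (span_dim_le sk dk) orbT.
Qed.

(** The condition $t_{r-1}(M) = M$ gives the upper bound and $t_r(M) = 0$ the lower one. For $r > n$
    a codimension above $r - 1$ has to be infinite, so $M = 0$. *)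
Lemma pure_growth r : (1 <= r)%N -> pure M r ->
  (r <= n)%N /\ upper M (n - r) /\ lower M (n - r) \/ (forall m : M, m = 0).
Proof.
move=> r1 [p1 p2].
have cod (m : M) : exists P, hilb_poly m P /\ (P = 0 \/ (r <= n)%N /\ (size P <= (n - r).+1)%N).
  case: (p2 m) => [r0|[c [[P [HP Pc]] cr]]]; first by rewrite r0 in r1.
  exists P; split=> //; case: eqP Pc => [->|P0] Pc; first by left.
  right; move: cr; rewrite Pc /= => H.
  have sP : (0 < size P)%N by rewrite size_poly_gt0; apply/eqP.
  by split; lia.
case: (leqP r n) => rn; last first.
  right=> m; apply: p1; have [P [HP [P0|[]]]] := cod m; last by rewrite leqNgt rn.
  by exists None; split=> //; exists P; rewrite P0 eqxx -P0.
left; split=> //; split=> m; have [P [HP HP']] := cod m.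
  by apply: (hilb_upper HP); case: HP' => [->|[]//]; rewrite size_poly0.
case=> C HC; have sP := hilb_lower HP HC; apply: p1.
case: (eqVneq P 0) => P0.
  by exists None; split=> //; exists P; rewrite P0 eqxx -P0.
exists (Some (n - (size P).-1)%N); split; first by exists P; rewrite (negbTE P0).
have sP0 : (0 < size P)%N by rewrite size_poly_gt0.
by move: sP sP0 rn => /=; move: (size P) => k; rewrite /=; lia.
Qed.
End HilbertPolynomial.

Section StableGrowth.
Variables (K : fieldType) (n : nat) (der : 'I_n -> K -> K) (X : dmod der).

(** Filter [V] by the order of operators of $R_q$ applied to [g]. The finitely many [dop i y], with
    [y] in [g], lie in one step of the filtration, so every derivation of $D$ shifts it by a bounded
    amount [B]. Operators of order [s] then send [x] into step $u_0 + sB$, whose dimension is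
    $O(s^q)$. *)
Lemma stable_growth q (V : X -> Prop) (g : seq X) x : (q <= n)%N -> subq n V ->
  (forall y, V y <-> gen q g y) -> V x ->
  exists C, forall s, dimle (ordsp s x) (C * s.+1 ^ q).
Proof.
move=> qn HV Vg Vx.
(* Exponents of monomials of $R_q$: the default 0 serves the derivations of index at least [q]. The
   family [L] is easy to count, and [L'] keeps from it the products of total order at most [u]. *)
pose al u (f : {ffun 'I_q -> 'I_u.+1}) (i : 'I_n) : nat :=
  if insub (nat_of_ord i) is Some k then f k : nat else 0%N.
pose L u := [seq dpow (al u f) y | f <- enum {ffun 'I_q -> 'I_u.+1}, y <- g].
pose mono u z := exists be y, [/\ (\sum_i be i <= u)%N,
  forall i : 'I_n, (q <= i)%N -> be i = 0%N, y \in g & z = dpow be y].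
pose L' u := [seq z <- L u | `[< mono u z >]].
pose Z u := @gen K n der 0 X (L' u).
have L_in u z : mono u z -> z \in L' u.
  move=> m; rewrite mem_filter; apply/andP; split; first exact/asboolP.
  case: m => be [y [bu bq yg ->]]; apply/allpairsP.
  exists ([ffun k => inord (be (widen_ord qn k))], y).
  rewrite mem_enum; split=> //=; apply: eq_dpow => i; rewrite /al; case: insubP => [k kq ki|].
    rewrite ffunE inordK; first by congr be; exact: val_inj.
    by rewrite ltnS; apply: leq_trans bu; rewrite (bigD1 (widen_ord qn k)) //= leq_addr.
  by rewrite -leqNgt => /bq.
have LP u z : z \in L' u -> mono u z by rewrite mem_filter => /andP[/asboolP].
have Zle u u' y : (u <= u')%N -> Z u y -> Z u' y.
  move=> uu; apply: gen_sub => z /LP[be [w [bu bq wg ->]]].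
  by apply: L_in; exists be, w; split=> //; exact: leq_trans uu.
have Zdop u (i : 'I_n) y : (i < q)%N -> Z u y -> Z u.+1 (dop i y).
  move=> iq; elim=> {y} [y /LP[be [w [bu bq wg ->]]]||y z _ H _ H'|a y Hy H|//].
  - rewrite -dpowS; apply/gen_in/L_in; exists (fun k => be k + (k == i))%N, w; split=> //.
      rewrite big_split /=; have -> : (\sum_k (k == i) = 1)%N.
        by rewrite (bigD1 i) //= eqxx big1 // => k /negbTE->.
      by rewrite addn1 ltnS.
    move=> k qk; rewrite bq // add0n; case: eqP => // E; by rewrite E leqNgt iq in qk.
  - by rewrite dop0; apply: gen_0.
  - by rewrite dop_add; apply: gen_add.
  - rewrite dop_scale; apply: gen_add; apply: gen_scale => //; exact: Zle Hy.
have sumS (be : 'I_n -> nat) i : (\sum_k (be k + (k == i)) = (\sum_k be k).+1)%N.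
  rewrite big_split /= -addn1; congr (_ + _)%N.
  by rewrite (bigD1 i) //= eqxx big1 // => k /negbTE->.
have Zdpow u (be : 'I_n -> nat) y : (forall i : 'I_n, (q <= i)%N -> be i = 0%N) ->
    Z u y -> Z (u + \sum_i be i)%N (dpow be y).
  move=> + Hy; elim/expo_ind: be => [|be i IH] Hbe; first by rewrite dpow0 // big1 // addn0.
  have iq : (i < q)%N by rewrite ltnNge; apply/negP => /Hbe; rewrite eqxx addn1.
  rewrite dpowS sumS addnS; apply: Zdop => //; apply: IH => k /Hbe; by case: (be k).
have gZ y : gen q g y -> exists u, Z u y.
  elim=> {y} [y yg||y z _ [u Hu] _ [u' Hu']|a y _ [u Hu]|i y iq _ [u Hu]].
  - exists 0%N; apply/gen_in/L_in; exists (fun=> 0%N), y; split=> //; last by rewrite dpow0.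
    by rewrite big1.
  - by exists 0%N; apply: gen_0.
  - by exists (maxn u u'); apply: gen_add; [apply: Zle Hu|apply: Zle Hu']; rewrite ?leq_maxl ?leq_maxr.
  - by exists u; apply: gen_scale.
  - by exists u.+1; apply: Zdop.
have [B0 HB0] : exists B, forall y, y \in g -> forall i : 'I_n, Z B (dop i y).
  have: forall y, y \in g -> V y by move=> y yg; apply/Vg/gen_in.
  elim: (g) => [|y t IH] Ht; first by exists 0%N.
  have [|B HB] := IH; first by move=> z zt; apply: Ht; rewrite inE zt orbT.
  have Vy i : V (dop i y) by case: HV => _ _ _; apply => //; apply: Ht; rewrite mem_head.
  pose u i := sval (cid (gZ _ ((Vg _).1 (Vy i)))).
  have uP i : Z (u i) (dop i y) by rewrite /u; case: cid.
  exists (maxn B (\max_i u i)) => z; rewrite inE => /orP[/eqP->|zt] i.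
    by apply: Zle (uP i); rewrite leq_max (leq_bigmax i) orbT.
  by apply: Zle (HB _ zt i); exact: leq_maxl.
pose B := B0.+1.
have ZB u i y : Z u y -> Z (u + B)%N (dop i y).
  elim=> {y} [y /LP[be [w [bu bq wg ->]]]||y z _ H _ H'|a y Hy H|//].
  - rewrite -dpow_dop; apply: Zle (Zdpow B0 be _ bq (HB0 _ wg i)).
    by rewrite /B addnC; lia.
  - by rewrite dop0; apply: gen_0.
  - by rewrite dop_add; apply: gen_add.
  - rewrite dop_scale; apply: gen_add; apply: gen_scale => //; apply: Zle Hy; exact: leq_addr.
have [u0 Hu0] := gZ _ ((Vg x).1 Vx).
have Zx (be : 'I_n -> nat) : Z (u0 + (\sum_i be i) * B)%N (dpow be x).
  elim/expo_ind: be => [|be i IH]; first by rewrite dpow0 // big1 // mul0n addn0.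
  by rewrite dpowS sumS mulSn addnCA addnC; apply: ZB.
exists ((u0 + B).+1 ^ q * size g)%N => s; exists (L' (u0 + s * B)%N); split.
  rewrite size_filter; apply: leq_trans (count_size _ _) _.
  rewrite size_allpairs -cardE card_ffun !card_ord mulnAC leq_mul2r; apply/orP; right.
  rewrite -expnMn; have H : ((u0 + s * B).+1 <= (u0 + B).+1 * s.+1)%N by rewrite mulSn mulnS; nia.
  by case: (q) => // q'; rewrite leq_exp2r.
move=> y; apply: gen_min => [|z /DfamP[be bs ->]]; first exact: gen_subq.
by apply: Zle (Zx be); rewrite leq_add2l leq_mul2r bs orbT.
Qed.
End StableGrowth.

(** * Noether normalization *)

Section Leibniz.
Variables (K : fieldType) (n : nat) (der : 'I_n -> K -> K) (h : commuting_derivations der).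
Variables (X : dmod der) (j : 'I_n).
Notation d := (@dop _ _ _ X j).

Lemma der_nat i (k : nat) : der i k%:R = 0.
Proof. by elim: k => [|k IH]; rewrite ?(der0 h) // -natr1 (derD h) IH (der1 h) addr0. Qed.
Lemma dop_nat i (k : nat) (x : X) : dop i (k%:R *: x) = k%:R *: dop i x.
Proof. by rewrite dop_scale der_nat scale0r addr0. Qed.

Lemma leibniz e a x : iter e d (a *: x) =
  \sum_(k < e.+1) 'C(e, k)%:R *: (iter k (der j) a *: iter (e - k) d x).
Proof.
elim: e => [|e IH]; first by rewrite big_ord1 bin0 scale1r.
rewrite iterS IH dop_sum.
under eq_bigr => k _ do rewrite dop_nat dop_scale -!iterS scalerDr -subSn -1?ltnS //.
rewrite big_split /= [RHS]big_ord_recl /=.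
under [X in _ = _ + X]eq_bigr => k _ do rewrite /bump /= add1n binS natrD scalerDl subSS.
rewrite [X in _ = _ + X]big_split /= addrA; congr (_ + _).
pose F k := 'C(e, k)%:R *: (iter k (der j) a *: iter (e.+1 - k) d x).
have E : \sum_(k < e.+1) F k = F 0%N + \sum_(k < e.+1) F k.+1.
  rewrite -(big_ord_recl e.+1 (fun k : 'I_e.+2 => F k)) [RHS]big_ord_recr /=.
  by rewrite /F (bin_small (ltnSn e)) scale0r addr0.
by rewrite E /F !bin0.
Qed.

(** When the inner binomial coefficients vanish, $d_j^e$ obeys the product rule of a single
    derivation. *)
Lemma leibniz_lb e a x : (0 < e)%N -> (forall k, (0 < k < e)%N -> 'C(e, k)%:R = 0 :> K) ->
  iter e d (a *: x) = a *: iter e d x + iter e (der j) a *: x.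
Proof.
case: e => // e _ lb; rewrite leibniz big_ord_recl big_ord_recr.
rewrite big1 => [|k _]; last by rewrite lb ?scale0r //= /bump /= add1n !ltnS ltn_ord.
by rewrite bin0 [lift _ _ : nat]/= /bump /= add1n binn subnn !scale1r add0r.
Qed.
Lemma dop_const i a (x : X) : der i a = 0 -> dop i (a *: x) = a *: dop i x.
Proof. by move=> E; rewrite dop_scale E scale0r addr0. Qed.
Lemma iter_const e a x : der j a = 0 -> iter e d (a *: x) = a *: iter e d x.
Proof. by move=> E; elim: e => //= e ->; rewrite dop_const. Qed.
Lemma iter_dopD e (x y : X) : iter e d (x + y) = iter e d x + iter e d y.
Proof. by elim: e => //= e ->; rewrite dop_add. Qed.
Lemma iter_der0 e a : (0 < e)%N -> der j a = 0 -> iter e (der j) a = 0.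
Proof.
case: e => // e _ E; rewrite iterSr E; elim: e => //= e ->; exact: (der0 h).
Qed.
End Leibniz.

(** * Triangular shifts of the derivations and transport along them *)

Section Shift.
Variables (K : fieldType) (n : nat) (j : 'I_n) (e : 'I_n -> nat).
Hypothesis e_gt0 : forall i, (0 < e i)%N.
Hypothesis e_lb : forall i k, (0 < k < e i)%N -> 'C(e i, k)%:R = 0 :> K.

(** As [c] vanishes from [j] on, $\partial_j$ itself is unchanged, which makes the shift
    invertible. *)
Definition shifted (der der' : 'I_n -> K -> K) (c : 'I_n -> K) : Prop :=
  [/\ commuting_derivations der, forall i a, der' i a = der i a + c i * iter (e i) (der j) a,
    forall k i, der k (c i) = 0 & forall i : 'I_n, (j <= i)%N -> c i = 0].

Section Operator.
Variables (der der' : 'I_n -> K -> K) (c : 'I_n -> K).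
Hypothesis S : shifted der der' c.
Implicit Type X : dmod der.
Let h : commuting_derivations der. Proof. by case: S. Qed.
Let derE i a : der' i a = der i a + c i * iter (e i) (der j) a. Proof. by case: S. Qed.
Let dc k i : der k (c i) = 0. Proof. by case: S. Qed.
Let c0 (i : 'I_n) : (j <= i)%N -> c i = 0. Proof. by case: S => _ _ _; apply. Qed.

Definition sop (X : dmod der) i (x : X) : X := dop i x + c i *: iter (e i) (@dop _ _ _ X j) x.
Lemma sopD X i (x y : dcar X) : sop i (x + y) = sop i x + sop i y.
Proof. by rewrite /sop dop_add iter_dopD scalerDr addrACA. Qed.
Lemma sopZ X i a (x : dcar X) : sop i (a *: x) = a *: sop i x + der' i a *: x.
Proof.
rewrite /sop dop_scale (leibniz_lb h) //; last exact: e_lb.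
rewrite !scalerDr !scalerA derE scalerDl (mulrC (c i) a).
by rewrite addrACA -!addrA.
Qed.
Lemma sopC X i k (x : dcar X) : sop i (sop k x) = sop k (sop i x).
Proof.
rewrite /sop !dop_add !iter_dopD !(dop_const _ (dc _ _)) !(iter_const _ _ (dc _ _)).
rewrite (dop_comm i k) !dop_iterC !scalerDr !scalerA (mulrC (c i)) -!iterD (addnC (e i)).
by rewrite !addrA; congr (_ + _); rewrite addrAC.
Qed.
Lemma sop_ge X (i : 'I_n) (x : X) : (j <= i)%N -> sop i x = dop i x.
Proof. by move=> /c0 E; rewrite /sop E scale0r addr0. Qed.

Definition tm (X : dmod der) : dmod der' := @DMod K n der' X (@sop X) (@sopD X) (@sopZ X) (@sopC X).

(** With $K$ as a module over $D$, the shifted derivations become shifted operators, so their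
    relations are instances of those proved for modules. *)
Definition kmod : dmod der :=
  @DMod K n der (K^o : lmodType K) der (derD h)
    (fun i a x => etrans (derM h i a x) (addrC _ _)) (derC h).

Lemma shifted_comm : commuting_derivations der'.
Proof.
have E i a : der' i a = @sop kmod i a by rewrite derE.
split=> [i a b|i a b|i k a]; rewrite !E.
- exact: (@sopD kmod).
- by rewrite [LHS](@sopZ kmod) addrC E.
- exact: (@sopC kmod).
Qed.

Lemma shifted_inv : shifted der' der (fun i => - c i).
Proof.
have jE : der' j = der j by apply/funext => a; rewrite derE c0 // mul0r addr0.
split=> [|i a|k i|i ji].
- exact: shifted_comm.
- by rewrite jE derE mulNr addrK.
- rewrite derE; have E l : der l (- c i) = 0.
    by rewrite -[LHS]add0r -{1}(dc l i) -(derD h) subrr (der0 h).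
  by rewrite E (iter_der0 h) ?mulr0 ?addr0.
- by rewrite c0 ?oppr0.
Qed.

Lemma tm_lin (X Y : dmod der) (f : X -> Y) : dlinear f -> @dlinear K n der' (tm X) (tm Y) f.
Proof.
move=> [fD fZ fd]; split=> // i x.
rewrite /= /sop fD fZ fd; congr (_ + _ *: _).
by elim: (e i) => //= k <-; rewrite fd.
Qed.
Lemma subq_tm q X (V : X -> Prop) : (j < q)%N -> subq q V -> @subq K n der' q (tm X) V.
Proof.
move=> jq HV; case: (HV) => V0 VD VZ Vd; split=> // i x iq Vx; rewrite /= /sop.
by apply: VD; [exact: Vd|apply/VZ/(subq_iter _ jq HV)].
Qed.
Lemma gen0_tm (X : dmod der) (s : seq X) x : @gen K n der' 0 (tm X) s x <-> gen 0 s x.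
Proof.
split; elim=> {x} [x xs||x y _ H _ H'|a x _ H|//]; [exact: gen_in|exact: gen_0|exact: (gen_add H H')
  |exact: gen_scale|exact: (@gen_in _ _ _ 0 (tm X))|exact: (@gen_0 _ _ _ 0 (tm X))
  |exact: (@gen_add _ _ _ 0 (tm X) _ _ _ H H')|exact: (@gen_scale _ _ _ 0 (tm X) _ _ _ H)].
Qed.
Lemma dimle_tm (X : dmod der) (V : X -> Prop) k : @dimle K n der' (tm X) V k <-> dimle V k.
Proof.
by split=> -[v [sv Hv]]; exists v; split=> // x /Hv/gen0_tm.
Qed.
(** Each shifted derivation has order at most [stretch] in the original ones. *)
Definition stretch := (\sum_i e i).+1.
Lemma ordsp_tm (X : dmod der) s (x y : X) :
  @ordsp K n der' (tm X) s x y -> ordsp (stretch * s) x y.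
Proof.
move=> /gen0_tm; apply: gen_min => [|z /(@DfamP _ _ _ (tm X))[be bs ->]]; first exact: gen_subq.
have es i : (e i < stretch)%N by rewrite /stretch ltnS (bigD1 i) //= leq_addr.
apply: (@ordsp_le _ _ _ _ (stretch * \sum_i be i)); first by rewrite leq_mul2l bs orbT.
elim/expo_ind: be {bs} => [|be i IH]; first by rewrite dpow0 // big1 // muln0; exact: ordsp0.
rewrite dpowS big_split /=; have -> : (\sum_k (k == i) = 1)%N.
  by rewrite (bigD1 i) //= eqxx big1 // => k /negbTE->.
rewrite mulnDr muln1 /sop; apply: gen_add.
  by apply: ordsp_le (ordsp_dop i IH); rewrite -addn1 leq_add2l.
apply: gen_scale; apply: ordsp_le (ordsp_iter j (e i) IH); by rewrite leq_add2l ltnW.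
Qed.
Lemma stretchE C s d : (C * (stretch * s).+1 ^ d <= (C * stretch ^ d) * s.+1 ^ d)%N.
Proof.
rewrite -mulnA -expnMn leq_mul2l; apply/orP; right.
have H : ((stretch * s).+1 <= stretch * s.+1)%N by rewrite mulnS -addn1 addnC leq_add2r.
by case: d => // d; rewrite leq_exp2r.
Qed.
Lemma upper_tm (X : dmod der) d : upper X d -> upper (tm X) d.
Proof.
move=> H x; have [C HC] := H x; exists (C * stretch ^ d)%N => s.
apply/dimle_tm; apply: dimle_sub (HC (stretch * s)%N); first exact: stretchE.
by move=> y; exact: ordsp_tm.
Qed.
End Operator.

Section Inverse.
Variables (der der' : 'I_n -> K -> K) (c : 'I_n -> K).
Hypothesis S : shifted der der' c.
Implicit Type X : dmod der.
Notation S' := (shifted_inv S).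

(** Shifting back restores the operators, but the resulting record is not convertible to [X];
    transport therefore passes through the identity as a linear map in both directions. *)
Lemma tmK (X : dmod der) i x : @dop K n der (tm S' (tm S X)) i x = @dop K n der X i x.
Proof.
have E : @dop K n der' (tm S X) j = @dop K n der X j.
  by apply/funext => y; exact: (sop_ge S).
change (@dop K n der' (tm S X) i x + - c i *: iter (e i) (@dop K n der' (tm S X) j) x = @dop K n der X i x).
by rewrite E scaleNr /= /sop addrK.
Qed.
Lemma tmK_lin (X : dmod der) : @dlinear K n der X (tm S' (tm S X)) (fun x => x).
Proof. by split=> // i x; rewrite tmK. Qed.
Lemma tmK_lin' (X : dmod der) : @dlinear K n der (tm S' (tm S X)) X (fun x => x).
Proof. by split=> // i x; rewrite tmK. Qed.

(** The inverse shift bounds the original filtration by the shifted one: small growth after the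
    shift means small growth before it. *)
Lemma lower_tm (X : dmod der) d : lower X d -> lower (tm S X) d.
Proof.
move=> H x [C HC]; apply: H; exists (C * stretch ^ d)%N => s.
have [k [dk kC]] := HC (stretch * s)%N; exists k; split.
  have {}dk := (dimle_tm S _ _).1 dk.
  apply: dimle_sub (leqnn k) _ dk => y yx.
  apply: (@ordsp_tm _ _ _ S' (tm S X)); apply/(@gen0_tm _ _ _ S' (tm S X)); apply/(@gen0_tm _ _ _ S X).
  have -> : @Dfam K n der (tm S' (tm S X)) s x = @Dfam K n der X s x.
    apply: eq_map => f.
    elim/expo_ind: (fun i => nat_of_ord (f i)) => [|be i IH]; first by rewrite !dpow0.
    by rewrite !dpowS tmK IH.
  exact: yx.
apply: leq_trans (stretchE C s d); apply: leq_trans kC.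
by rewrite leq_mul2l ltnS leq_pmull // orbT.
Qed.
Lemma dlinear_comp (dr : 'I_n -> K -> K) (A B C : dmod dr) (g : B -> C) (f : A -> B) :
  dlinear g -> dlinear f -> dlinear (fun x => g (f x)).
Proof. by move=> [gD gZ gd] [fD fZ fd]; split=> *; rewrite ?fD ?gD ?fZ ?gZ ?fd ?gd. Qed.

Lemma tm_lin_inv (P A : dmod der) (u : P -> A) :
  @dlinear K n der' (tm S P) (tm S A) u -> dlinear u.
Proof. 
move=> /(tm_lin S') H; apply: dlinear_comp (dlinear_comp (tmK_lin' A) H) (tmK_lin P).
Qed.
End Inverse.

Lemma tm_lin_l (der der' : 'I_n -> K -> K) (c : 'I_n -> K) (S : shifted der der' c)
  (P : dmod der) (A : dmod der') (u : P -> A) :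
  @dlinear K n der P (tm (shifted_inv S) A) u -> @dlinear K n der' (tm S P) A u.
Proof.
move=> H; apply: (tm_lin_inv (S := shifted_inv S)).
exact: dlinear_comp H (tmK_lin' S P).
Qed.

Section Transport.
Variables (der der' : 'I_n -> K -> K) (c : 'I_n -> K).
Hypothesis S : shifted der der' c.
Notation S' := (shifted_inv S).

Lemma projective_tm (P : dmod der) : projective P -> projective (tm S P).
Proof.
move=> HP A B p g Hp psurj Hg.
have Hg' : @dlinear K n der P (tm S' B) g.
  exact: (dlinear_comp (tm_lin S' Hg) (tmK_lin S P)).
have [u [Hu pu]] := HP (tm S' A) (tm S' B) p g (tm_lin S' Hp) psurj Hg'.
by exists u; split=> //; exact: tm_lin_l.
Qed.

Lemma pd_tm r (L : dmod der) : pd_le r L -> pd_le r (tm S L).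
Proof.
elim: r L => [|r IH] L; first exact: projective_tm.
move=> [P [N [f [g [[HP HN] [Hf Hg] finj gsurj ex]]]]].
exists (tm S P), (tm S N), f, g; split=> //; last by split; exact: tm_lin.
by split; [exact: projective_tm|exact: IH].
Qed.

Lemma gen_tm (X : dmod der) (s : seq X) x : gen n s x -> @gen K n der' n (tm S X) s x.
Proof.
move=> H; apply: (gen_min _ _ H) => [|y ys]; last exact: (@gen_in _ _ _ n (tm S X)).
have := subq_tm S' (ltn_ord j) (gen_subq n (s : seq (tm S X))).
move=> [V0 VD VZ Vd]; split=> // i z iq Hz; rewrite -(@tmK _ _ _ S); exact: Vd.
Qed.
Lemma fingen_tm (X : dmod der) : fingen X -> fingen (tm S X).
Proof.
move=> [s Hs]; exists (s : seq (tm S X)) => x.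
by apply/gen_Dgenerated/gen_tm/Dgenerated_gen/Hs.
Qed.
End Transport.
End Shift.

(** * Integral dependence after a shift *)

Section LeadingTerm.
Variables (K : fieldType) (n : nat) (j : 'I_n) (e : 'I_n -> nat).
Hypothesis e_gt0 : forall i, (0 < e i)%N.
Hypothesis e_lb : forall i k, (0 < k < e i)%N -> 'C(e i, k)%:R = 0 :> K.
Hypothesis e_j : e j = 1%N.
Variables (der der' : 'I_n -> K -> K) (c : 'I_n -> K).
Hypothesis h : commuting_derivations der.
Hypothesis S : shifted j e der der' c.

Definition weight (m : 'I_n -> nat) : nat := \sum_i m i * e i.
(** The coefficient of $d_j^{weight(m)}$ in $d^m$, for [m] supported up to [j], after the
    substitution $d_i = d'_i - c_i d_j^{e_i}$. *)
Definition top (m : 'I_n -> nat) : K := \prod_(i < n | (i < j)%N) (- c i) ^+ m i.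

Let dc k i : der k (c i) = 0. Proof. by case: S. Qed.

Lemma der_top k m : der k (top m) = 0.
Proof.
have dM a b : der k a = 0 -> der k b = 0 -> der k (a * b) = 0.
  by move=> A B; rewrite (derM h) A B mul0r mulr0 addr0.
rewrite /top; elim/big_ind: _ => [||i _]; [exact: (der1 h)|exact: dM|].
elim: (m i) => [|l IH]; first by rewrite expr0 (der1 h).
rewrite exprS; apply: dM => //; rewrite -[LHS]add0r -{1}(dc k i) -(derD h) subrr; exact: (der0 h).
Qed.

Section Element.
Variables (X : dmod der) (x : X).
Notation Y := (tm e_gt0 e_lb S X).
Notation d := (@dop K n der X j).
Notation low k := (@ord_lt K n der' j Y [:: x : Y] k).

Lemma tm_dop_j : @dop K n der' Y j = d.
Proof. by apply/funext => y; exact: (sop_ge S). Qed.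
Lemma low_subq k : @subq K n der' j Y (low k). Proof. exact: gen_subq. Qed.
Lemma low_iter k l y : low k y -> low (l + k) (iter l d y).
Proof. by rewrite -tm_dop_j; exact: ord_lt_iter. Qed.
Lemma low_x k : low k.+1 (iter k d x).
Proof. by rewrite -tm_dop_j; apply: ord_lt_in; rewrite ?mem_head. Qed.

(** Induction on [m] by the substitution above: $d'_i$ does not raise the order in $d_j$, which thus
    stays below the new weight as $e_i > 0$, and $d_j$ commutes with the constant [top m]. *)
Lemma leading_term (m : 'I_n -> nat) : (forall i : 'I_n, (j < i)%N -> m i = 0%N) ->
  low (weight m) (dpow m x - top m *: iter (weight m) d x).
Proof.
have wS al i : weight (fun k => al k + (k == i))%N = (weight al + e i)%N.
  rewrite /weight; under eq_bigr do rewrite mulnDl.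
  rewrite big_split /=; congr addn; rewrite (bigD1 i) //= eqxx mul1n big1 ?addn0 // => k.
  by move=> /negbTE->.
elim/expo_ind: m => [|al i IH] Hal.
  have -> : weight (fun=> 0%N) = 0%N by rewrite /weight big1 // => i _; rewrite mul0n.
  have -> : top (fun=> 0%N) = 1 by rewrite /top big1 // => i _; rewrite expr0.
  rewrite dpow0 // scale1r subrr; exact: gen_0.
have ij : (i <= j)%N by rewrite leqNgt; apply/negP => /Hal; rewrite eqxx addn1.
have {}IH : low (weight al) (dpow al x - top al *: iter (weight al) d x).
  by apply: IH => k /Hal; case: (al k).
have {}IH' l : low (l + weight al) (iter l d (dpow al x) - top al *: iter (l + weight al) d x).
  have := low_iter l IH; suff -> : iter l d (dpow al x - top al *: iter (weight al) d x) =
    iter l d (dpow al x) - top al *: iter (l + weight al) d x by [].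
  rewrite -scaleNr iter_dopD (iter_const _ _ _) ?scaleNr ?iterD //.
  rewrite -[LHS]add0r -{1}(der_top j al) -(derD h) subrr; exact: (der0 h).
rewrite dpowS wS; case: (eqVneq i j) => [->|ne].
  have -> : top (fun k => (al k + (k == j))%N) = top al.
    by apply: eq_bigr => k kj; rewrite -val_eqE ltn_eqF //= addn0.
  by rewrite e_j addnC; exact: (IH' 1%N).
have lij : (i < j)%N by rewrite ltn_neqAle ij andbT.
have -> : top (fun k => (al k + (k == i))%N) = - c i * top al.
  rewrite /top (bigD1 i) // [in RHS](bigD1 i) //= eqxx addn1 exprS -!mulrA.
  congr (_ * (_ * _)); apply: eq_bigr => k /andP[_ /negbTE->]; by rewrite addn0.
have al_low : low (weight al).+1 (dpow al x).
  rewrite -(subrK (top al *: iter (weight al) d x) (dpow al x)); apply: (@gen_add K n der' j Y).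
    exact: ord_lt_le IH.
  apply: (@gen_scale K n der' j Y); exact: low_x.
have -> : dop i (dpow al x) - (- c i * top al) *: iter (weight al + e i) d x =
  @dop K n der' Y i (dpow al x)
    - c i *: (iter (e i) d (dpow al x) - top al *: iter (e i + weight al) d x).
  by rewrite /= /sop scalerBr opprB addrACA subrr addr0 mulNr scaleNr opprK scalerA addnC.
apply: (subq_sub (low_subq _)).
  apply: ord_lt_le (gen_dop lij al_low); rewrite -addn1 leq_add2l; exact: e_gt0.
rewrite addnC; apply: (@gen_scale K n der' j Y); exact: IH'.
Qed.

(** Rewritten in the shifted derivations, $p x = 0$ is an equation of integral dependence: the
    coefficient of the highest power $d_j^w$ is a nonzero element of $K$. *)
Lemma integral_of_top (p : wop h) w : inR j.+1 p -> act p x = 0 ->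
  (forall m : 'X_{1..n}, m \in msupp (p : {mpoly K[n]}) -> (weight m <= w)%N) ->
  \sum_(m <- msupp (p : {mpoly K[n]}) | weight m == w) (p : {mpoly K[n]})@_m * top m != 0 ->
  low w (iter w d x).
Proof.
move=> Hp px Hw; set k := \sum_(m <- _ | _) _ => k0.
suff H : low w (act p x - k *: iter w d x).
  have : low w (- k^-1 *: (act p x - k *: iter w d x)) by apply: (@gen_scale K n der' j Y).
  by rewrite px sub0r scaleNr scalerN opprK scalerA mulVf // scale1r.
have -> : act p x - k *: iter w d x = \sum_(m <- msupp (p : {mpoly K[n]}))
   (p : {mpoly K[n]})@_m *: (dpow m x - (if weight m == w then top m *: iter w d x else 0)).
  under [RHS]eq_bigr do rewrite scalerBr.
  rewrite sumrB; congr (_ - _); rewrite /k scaler_suml [in LHS]big_mkcond.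
  by apply: eq_bigr => m _; case: ifP => _; rewrite ?scaler0 ?scalerA.
apply: (@subq_sum_seq K n der' j Y _ _ _ _ (low_subq w)) => m mp.
apply: (@gen_scale K n der' j Y).
have H : low (weight m) (dpow m x - top m *: iter (weight m) d x).
  by apply: leading_term => i ji; move/inR_suppP: Hp; apply => //; rewrite -mcoeff_msupp.
case: eqP => [<-//|/eqP ne]; rewrite subr0.
have wm : (weight m < w)%N by rewrite ltn_neqAle ne Hw.
rewrite -(subrK (top m *: iter (weight m) d x) (dpow m x)); apply: (@gen_add K n der' j Y).
  exact: ord_lt_le (ltnW wm) H.
apply: (@gen_scale K n der' j Y); apply: ord_lt_le wm _; exact: low_x.
Qed.
End Element.

Definition drop_gens (X : dmod der) (w : X -> nat) (g : seq X) : seq X :=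
  flatten [seq [seq iter k (@dop K n der X j) x | k <- iota 0 (w x)] | x <- g].

Lemma drop_gensP (X : dmod der) (w : X -> nat) (g : seq X) y :
  reflect (exists x k, [/\ x \in g, (k < w x)%N & y = iter k (@dop K n der X j) x]) (y \in drop_gens w g).
Proof.
apply: (iffP flattenP) => [[s /mapP[x xg ->] /mapP[k]]|[x [k [xg kw ->]]]].
  by rewrite mem_iota => kw ->; exists x, k.
exists [seq iter k (@dop K n der X j) x | k <- iota 0 (w x)]; first exact: map_f.
by apply: map_f; rewrite mem_iota.
Qed.

(** Integral dependence makes the span of the [drop_gens] stable under $d_j$. Being stable under the
    shifted derivations of index up to [j], it is stable under the original ones, by the inverse
    shift. *)
Lemma gen_drop (X : dmod der) (w : X -> nat) (g : seq X) :
  (forall x, x \in g -> @ord_lt K n der' j (tm e_gt0 e_lb S X) [:: x : tm e_gt0 e_lb S X] (w x)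
     (iter (w x) (@dop K n der X j) x)) ->
  forall y, gen j.+1 g y -> @gen K n der' j (tm e_gt0 e_lb S X) (drop_gens w g) y.
Proof.
move=> Hw; set Y := tm e_gt0 e_lb S X; set G := @gen K n der' j Y (drop_gens w g).
have sub x k y : x \in g -> (k <= w x)%N -> @ord_lt K n der' j Y [:: x : Y] k y -> G y.
  move=> xg kw; apply: gen_min => [|z]; first exact: gen_subq.
  move=> /ord_ltP[i [z' [ik]]]; rewrite inE => /eqP-> ->; apply: gen_in; apply/drop_gensP.
  by exists x, i; rewrite tm_dop_j; split=> //; exact: leq_trans kw.
have HG : @subq K n der' j.+1 Y G.
  case: (gen_subq j (drop_gens w g : seq Y)) => G0 GD GZ Gd; split=> // i z.
  rewrite ltnS leq_eqVlt => /orP[/eqP/val_inj-> {i}|]; last exact: Gd.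
  elim=> {z} [z /drop_gensP[x [k [xg kw ->]]]||a b _ Ha _ Hb|a b Hb' Hb|i b ij _ Hb].
  - rewrite tm_dop_j -iterS; move: kw; rewrite leq_eqVlt => /orP[/eqP->|kw].
      exact: sub (leqnn _) (Hw _ xg).
    by apply: gen_in; apply/drop_gensP; exists x, k.+1.
  - rewrite dop0; exact: G0.
  - rewrite dop_add; exact: GD.
  - rewrite dop_scale; apply: GD; exact: GZ.
  - rewrite dop_comm; exact: Gd.
have HG' : subq j.+1 (G : X -> Prop).
  have := subq_tm e_gt0 e_lb (shifted_inv e_gt0 e_lb S) (ltnSn j) HG.
  move=> [V0 VD VZ Vd]; split=> // i z iq Hz.
  rewrite -(@tmK _ _ _ _ e_gt0 e_lb _ _ _ S); exact: Vd.
apply: (gen_min HG') => x xg; case E: (w x) => [|k].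
  by have := Hw _ xg; rewrite E => /(sub x 0%N); apply=> //; rewrite E.
by apply: gen_in; apply/drop_gensP; exists x, 0%N; rewrite E.
Qed.
End LeadingTerm.

(** * Choice of the shift *)

Lemma digits Q t (f g : nat -> nat) : (forall i, f i < Q)%N -> (forall i, g i < Q)%N ->
  (\sum_(i < t.+1) f i * Q ^ (t - i) = \sum_(i < t.+1) g i * Q ^ (t - i))%N ->
  forall i, (i <= t)%N -> f i = g i.
Proof.
move=> fQ gQ; have Q0 : (0 < Q)%N by apply: leq_ltn_trans (fQ 0%N).
have step (u : nat -> nat) s : (\sum_(i < s.+2) u i * Q ^ (s.+1 - i) =
    (\sum_(i < s.+1) u i * Q ^ (s - i)) * Q + u s.+1)%N.
  rewrite big_ord_recr /= subnn muln1 big_distrl /=; congr addn.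
  apply: eq_bigr => i _; have /subSn-> : (i <= s)%N by rewrite -ltnS ltn_ord.
  by rewrite expnS mulnA mulnAC.
elim: t => [|t IH].
  by rewrite !big_ord1 subnn !muln1 => E [|i].
rewrite !step => E i.
have E1 : f t.+1 = g t.+1.
  by have := congr1 (modn^~ Q) E; rewrite !modnMDl !modn_small.
rewrite leq_eqVlt => /orP[/eqP->//|]; rewrite ltnS; apply: IH.
by have := congr1 (divn^~ Q) E; rewrite !divnMDl // !divn_small // !addn0.
Qed.

Section Weights.
Variables (n : nat) (j : 'I_n).

Lemma digits_ord Q (m m' : 'I_n -> nat) : (0 < Q)%N ->
  (forall i : 'I_n, (j < i)%N -> m i = 0%N) -> (forall i : 'I_n, (j < i)%N -> m' i = 0%N) ->
  (forall i, m i < Q)%N -> (forall i, m' i < Q)%N ->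
  (\sum_i m i * Q ^ (j - i) = \sum_i m' i * Q ^ (j - i))%N -> m =1 m'.
Proof.
move=> Q0 Hm Hm' mQ mQ'.
pose f (u : 'I_n -> nat) k := if insub k is Some i then u i else 0%N.
have fE (u : 'I_n -> nat) (i : 'I_n) : f u i = u i by rewrite /f valK.
have fQ (u : 'I_n -> nat) : (forall i, u i < Q)%N -> forall k, (f u k < Q)%N.
  by move=> H k; rewrite /f; case: insubP.
have E (u : 'I_n -> nat) : (forall i : 'I_n, (j < i)%N -> u i = 0%N) ->
   (\sum_i u i * Q ^ (j - i) = \sum_(k < j.+1) f u k * Q ^ (j - k))%N.
  move=> Hu; rewrite (big_ord_widen n (fun k => f u k * Q ^ (j - k))%N (ltn_ord j)).
  rewrite [RHS]big_mkcond; apply: eq_bigr => i _; rewrite fE ltnS; case: ltnP => // /Hu->.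
  by rewrite mul0n.
rewrite !E // => H i; case: (leqP i j) => ij; last by rewrite Hm ?Hm'.
have := digits (fQ _ mQ) (fQ _ mQ') H ij; by rewrite !fE.
Qed.

Lemma argmax (T : eqType) (s : seq T) (w : T -> nat) : s != [::] ->
  exists2 m, m \in s & forall m', m' \in s -> (w m' <= w m)%N.
Proof.
elim: s => // x s IH _; case: (eqVneq s [::]) => [->|/IH[m ms Hm]].
  by exists x; rewrite ?mem_head // => y; rewrite inE => /eqP->.
case: (leqP (w m) (w x)) => H.
  exists x; rewrite ?mem_head // => y; rewrite inE => /orP[/eqP->//|/Hm]; move/leq_trans; exact.
exists m; first by rewrite inE ms orbT.
by move=> y; rewrite inE => /orP[/eqP->|/Hm//]; exact: ltnW.
Qed.
End Weights.

(** By $k \binom{p^a}{k} = p^a \binom{p^a - 1}{k - 1}$, a binomial coefficient prime to $p$ would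
    force $p^a$ to divide $k < p^a$. *)
Lemma bin_expn_pchar (K : fieldType) p a k : p \in [pchar K] -> (0 < k < p ^ a)%N ->
  'C(p ^ a, k)%:R = 0 :> K.
Proof.
move=> pK; have pp := pcharf_prime pK; case: k => // k /= ka.
apply/eqP; rewrite -(dvdn_pcharf pK); apply/negP => /negP H.
have : (p ^ a %| k.+1 * 'C(p ^ a, k.+1))%N by rewrite -mul_bin_diag dvdn_mulr.
rewrite Gauss_dvdl; last by rewrite coprimeXl // prime_coprime.
by move=> /dvdn_leq; rewrite ltn0Sn => /(_ isT); rewrite leqNgt ka.
Qed.

(** The point is sought among the natural numbers because every derivation kills them. *)
Lemma nonroot (K : fieldType) (P : {poly K}) : [pchar K] =i pred0 -> P != 0 ->
  exists t : nat, P.[t%:R] != 0.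
Proof.
move=> /pcharf0P c0 P0; apply: contrapT => H.
have all0 t : P.[t%:R] = 0.
  by apply/eqP/negPn/negP => Ht; apply: H; exists t.
pose rs : seq K := [seq k%:R | k <- iota 0 (size P)].
have : (size rs < size P)%N.
  apply: max_poly_roots => //; first by apply/allP => x /mapP[k _ ->]; apply/eqP.
  rewrite map_inj_uniq ?iota_uniq // => k l.
  wlog kl : k l / (k <= l)%N.
    by move=> W E; case: (leqP k l) => [/W->//|/ltnW/W->].
  move=> E; apply/eqP; rewrite eqn_leq kl -subn_eq0 -c0 natrB // E subrr eqxx //.
by rewrite size_map size_iota ltnn.
Qed.

Section NormalizingShift.
Variables (K : fieldType) (n : nat) (j : 'I_n) (ps : seq {mpoly K[n]}).
Hypothesis ps_supp : forall p, p \in ps -> forall m, m \in msupp p ->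
  forall i : 'I_n, (j < i)%N -> m i = 0%N.
Hypothesis ps_neq0 : forall p, p \in ps -> p != 0.

Lemma exponent_bound : exists B, forall p, p \in ps -> forall m, m \in msupp p -> forall i, (m i < B)%N.
Proof.
elim: ps => [|p s [B HB]]; first by exists 0%N.
exists (maxn B (msize p)) => q; rewrite inE => /orP[/eqP-> m mp i|/HB H m /H {}H i]; last first.
  by rewrite leq_max H.
rewrite leq_max; apply/orP; right; apply: leq_ltn_trans (msize_mdeg_lt mp).
by rewrite mdegE (bigD1 i) //= leq_addr.
Qed.

(* In characteristic 0 all [e i] are 1 and the [c i] are generic; in characteristic p the [e i]
   are high powers of p, which makes [weight e] injective on the relevant exponents. *)
Lemma parameters : exists (e : 'I_n -> nat) (c : nat -> K),
  [/\ forall i, (0 < e i)%N, forall i k, (0 < k < e i)%N -> 'C(e i, k)%:R = 0 :> K, e j = 1%N,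
     forall i, exists a : nat, c i = a%:R &
     forall p, p \in ps -> exists w : nat,
       (forall m : 'X_{1..n}, m \in msupp p -> (weight e m <= w)%N) /\
       \sum_(m <- msupp p | weight e m == w) p@_m * top j (fun i : 'I_n => if (i < j)%N then - c i else 0) m != 0].
Proof.
have [B HB] := exponent_bound.
have supp_neq0 p : p \in ps -> msupp p != [::].
  by move=> /ps_neq0; apply: contraNneq => E; rewrite -msupp_eq0 E.
case: (pselect (exists p, p \in [pchar K])) => [[p pK]|noc].
  have pp := pcharf_prime pK.
  (* All exponents are below $B \le Q$, so weights are expansions in base $Q$: distinct monomials
     have distinct weights and the top sum has a single term. *)
  pose Q := (p ^ B)%N; have BQ : (B <= Q)%N by apply/ltnW/ltn_expl/prime_gt1.
  have Q0 : (0 < Q)%N by rewrite expn_gt0 prime_gt0.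
  exists (fun i => Q ^ (j - i))%N, (fun=> 1%N%:R); split.
  - by move=> i; rewrite expn_gt0 Q0.
  - by move=> i k; rewrite /Q -expnM; exact: bin_expn_pchar.
  - by rewrite subnn.
  - by move=> i; exists 1%N.
  move=> q qs; have [m0 m0q m0max] := argmax (fun m : 'X_{1..n} => weight (fun i => Q ^ (j - i))%N m) (supp_neq0 _ qs).
  exists (weight (fun i => Q ^ (j - i))%N m0); split=> //.
  rewrite big_mkcond (bigD1_seq m0) ?msupp_uniq //= big1_seq ?addr0; last first.
    move=> m /andP[/eqP ne mq]; case: eqP => // E; case: ne; apply/mnmP; move: E; rewrite /weight.
    by apply: digits_ord => // [i|i|i|i]; try (by apply: (ps_supp qs)); apply: leq_trans BQ; apply: (HB _ qs).
  rewrite eqxx mulf_neq0 ?mcoeff_msupp // -?mcoeff_msupp //.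
  rewrite /top big1 ?oner_neq0 // => i ij; rewrite ij opprK expr1n //.
have c0 : [pchar K] =i pred0.
  by move=> p; apply/negbTE/negP => pK; apply: noc; exists p.
(* With $c_i = t^{B^{j-i}}$, chosen below, [top] at [m] is $t^{D(m)}$. On the exponents of one
   polynomial of [ps] with given total degree, [D] is injective: it determines the entries below [j]
   as digits in base [B], and the degree then gives the entry at [j]. *)
pose D (m : 'X_{1..n}) := (\sum_(i < n | (i < j)%N) m i * B ^ (j - i))%N.
pose F (p : {mpoly K[n]}) w : {poly K} := \sum_(m <- msupp p | mdeg m == w) p@_m *: 'X^(D m).
have Dinj p m m' : p \in ps -> m \in msupp p -> m' \in msupp p -> mdeg m = mdeg m' -> D m = D m' -> m = m'.
  move=> ip mp mp' Em ED.
  pose z (m : 'X_{1..n}) (i : 'I_n) := if (i < j)%N then m i else 0%N.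
  have zD u : D u = (\sum_i z u i * B ^ (j - i))%N.
    by rewrite /D big_mkcond; apply: eq_bigr => i _; rewrite /z; case: ifP => //; rewrite mul0n.
  have zs u (i : 'I_n) : (j < i)%N -> z u i = 0%N.
    by rewrite /z => ji; rewrite ltnNge ltnW.
  have zB (u : 'X_{1..n}) i : u \in msupp p -> (z u i < B)%N.
    by move=> up; rewrite /z; have := HB _ ip _ up i; case: ifP => // _; case: (B).
  have B0 : (0 < B)%N by apply: leq_ltn_trans (HB _ ip _ mp j).
  rewrite !zD in ED.
  have zE : z m =1 z m'.
    apply: digits_ord ED => // [i|i|i|i]; try (by apply: zs); exact: zB.
  have lt (i : 'I_n) : (i < j)%N -> m i = m' i by move=> ij; have := zE i; rewrite /z ij.
  have ne (i : 'I_n) : i != j -> m i = m' i.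
    rewrite -val_eqE neq_ltn => /orP[/lt//|ji]; by rewrite !(ps_supp ip) .
  apply/mnmP => i; case: (eqVneq i j) => [->|/ne//].
  move: Em; rewrite !mdegE (bigD1 j) //= [in RHS](bigD1 j) //=.
  have -> : (\sum_(i < n | i != j) m i = \sum_(i < n | i != j) m' i)%N by apply: eq_bigr => k /ne.
  by move/addIn.
have [w Hw] : exists w : {mpoly K[n]} -> nat, forall p, p \in ps ->
    (forall m, m \in msupp p -> (mdeg m <= w p)%N) /\ F p (w p) != 0.
  exists (fun p => (msize p).-1) => p ip; split=> [m /msize_mdeg_lt|]; first by case: (msize p).
  have [m0 m0p m0max] := argmax (@mdeg n) (supp_neq0 _ ip).
  have E0 : mdeg m0 = (msize p).-1.
    apply/eqP; rewrite eqn_leq -ltnS prednK; last by rewrite lt0n msize_poly_eq0 ps_neq0.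
    rewrite msize_mdeg_lt //= -ltnS prednK; last by rewrite lt0n msize_poly_eq0 ps_neq0.
    rewrite msizeE; apply/bigmax_leqP_seq => m mp _; exact: m0max.
  apply/eqP => /(congr1 (fun P : {poly K} => P`_(D m0))); rewrite coef0 /F coef_sum.
  rewrite big_mkcond (bigD1_seq m0) ?msupp_uniq //= E0 eqxx coefZ coefXn eqxx mulr1 big1_seq ?addr0.
    by apply/eqP; rewrite -mcoeff_msupp.
  move=> m /andP[/eqP ne mp]; case: eqP => // Em; rewrite coefZ coefXn; case: eqP => [E|_]; rewrite ?mulr0 //.
  by case: ne; apply: (Dinj p); rewrite // Em.
have [t Ht] : exists t : nat, forall p, p \in ps -> (F p (w p)).[t%:R] != 0.
  (* One [t] must serve all of [ps], hence the product. *)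
  have [|t Ht] := @nonroot K (\prod_(p <- ps) F p (w p)) c0.
    by rewrite prodf_seq_neq0; apply/allP => p /Hw[].
  by exists t => p ip; move: Ht; rewrite horner_prod prodf_seq_neq0 => /allP/(_ p ip).
exists (fun=> 1%N), (fun i => (t ^ (B ^ (j - i)))%N%:R); split.
- by [].
- by move=> i [|k].
- by [].
- by move=> i; exists (t ^ (B ^ (j - i)))%N.
move=> p ip; have [Hdeg _] := Hw p ip; exists (w p).
have wE (m : 'X_{1..n}) : weight (fun=> 1%N) m = mdeg m.
  by rewrite /weight mdegE; apply: eq_bigr => i _; rewrite muln1.
split=> [m mp|]; first by rewrite wE Hdeg.
have := Ht p ip; rewrite /F horner_sum.
under eq_bigr do rewrite hornerZ hornerXn.
rewrite (eq_bigl (fun m : 'X_{1..n} => weight (fun=> 1%N) m == w p)); last by move=> m; rewrite wE.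
suff E (m : 'X_{1..n}) : t%:R ^+ D m = top j (fun i : 'I_n => if (i < j)%N then - (t ^ B ^ (j - i))%N%:R else 0) m :> K.
  by under eq_bigr do rewrite E.
rewrite /top /D expr_sum; apply: eq_bigr => i ij.
by rewrite ij opprK natrX -exprM mulnC.
Qed.
End NormalizingShift.

Section NoetherNormalization.
Variables (K : fieldType) (n : nat).

(** The new generators are obtained from [g] by powers of $d_j$, so they stay in every $D$-submodule
    that contains [g]; this allows the torsion submodule to be normalized within itself. *)
Lemma noether_normalization (der : 'I_n -> K -> K) (h : commuting_derivations der) (j : 'I_n)
  (X : dmod der) (g : seq X) :
  (forall x, x \in g -> exists p : wop h, [/\ inR j.+1 p, p != 0 & act p x = 0]) ->
  exists e (e_gt0 : forall i : 'I_n, (0 < e i)%N)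
    (e_lb : forall i k, (0 < k < e i)%N -> 'C(e i, k)%:R = 0 :> K)
    der' c (S : shifted j e der der' c) (g' : seq X),
    (forall V : X -> Prop, subq n V -> (forall x, x \in g -> V x) -> forall y, y \in g' -> V y) /\
    forall y, gen j.+1 g y -> @gen K n der' j (tm e_gt0 e_lb S X) g' y.
Proof.
move=> Hg.
have /choice[P HP] (x : X) : exists p : wop h,
    x \in g -> [/\ inR j.+1 p, p != 0 & act p x = 0].
  by case: (boolP (x \in g)) => [/Hg[p Hp]|_]; [exists p|exists 0].
have [|p /mapP[x xg ->]|] := @parameters K n j [seq (P x : {mpoly K[n]}) | x <- g].
- move=> p /mapP[x xg ->] m mp i ji; have [Hp _ _] := HP x xg.
  by move/inR_suppP: Hp; apply=> //; rewrite -mcoeff_msupp.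
- by have [] := HP x xg.
move=> e [c0 [e_gt0 e_lb e_j cN Htop]].
pose c (i : 'I_n) := if (i < j)%N then - c0 i else 0.
pose der' (i : 'I_n) a := der i a + c i * iter (e i) (der j) a.
have S : shifted j e der der' c.
  split=> // [k i|i ji]; last by rewrite /c ltnNge ji.
  rewrite /c; case: ifP => _; last exact: (der0 h).
  have [a ->] := cN i; rewrite -[LHS]add0r -{1}(der_nat h k a) -(derD h) subrr; exact: (der0 h).
have /choice[w Hw] (x : X) : exists w, x \in g ->
    @ord_lt K n der' j (tm e_gt0 e_lb S X) [:: x : tm e_gt0 e_lb S X] w
      (iter w (@dop K n der X j) x).
  case: (boolP (x \in g)) => [xg|_]; last by exists 0%N.
  have [Hp p0 px] := HP x xg.
  have [|w [wm wtop]] := Htop (P x); first exact: (map_f P).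
  by exists w => _; apply: (integral_of_top e_gt0 e_lb e_j S (p := P x)).
exists e, e_gt0, e_lb, der', c, S, (drop_gens j w g); split.
  move=> V HV gV y /drop_gensP[x [k [xg _ ->]]]; exact: (subq_iter _ (ltn_ord j) HV (gV _ xg)).
exact: gen_drop.
Qed.
End NoetherNormalization.

(** * Torsion and the final induction *)

Section Torsion.
Variables (K : fieldType) (n : nat) (der : 'I_n -> K -> K) (h : commuting_derivations der).
Variables (d : nat) (X : dmod der).
Definition torsion (x : X) : Prop := exists p : wop h, [/\ inR d p, p <> 0 & act p x = 0].

Lemma wmul_neq0 (p q : wop h) : p <> 0 -> q <> 0 -> p * q <> 0.
Proof. by move=> p0 q0 /wmul_eq0[]. Qed.

(** Sums use a common left multiple. For [dop i x], if $p x = 0$ then $p d_i x = -[d_i, p] x$ with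
    $[d_i, p] \in R_d$; an Ore relation $a [d_i, p] = b p$ shows that $a p$ kills $d_i x$. *)
Lemma torsion_subq : subq n torsion.
Proof.
have one0 : (1 : wop h) <> 0 by apply/eqP/oner_neq0.
split.
- by exists 1; split=> //; [exact: inR1|rewrite act_0].
- move=> x y [p [Hp p0 px]] [q [Hq q0 qy]].
  have [a [b [Ha Hb a0 E]]] := ore Hp Hq (introN eqP q0).
  exists (a * p); split; [exact: inRM|by apply: wmul_neq0 => //; apply/eqP|].
  by rewrite act_add actM px act_0 E actM qy act_0 addr0.
- move=> a x [p [Hp p0 px]]; case: (eqVneq a 0) => [->|a0].
    by exists 1; split=> //; [exact: inR1|rewrite scale0r act_0].
  exists (p * (a^-1 *: (1 : wop h) : wop h)); split.
  + by apply: inRM => //; apply/inRZ/inR1.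
  + apply: wmul_neq0 => // /(congr1 (fun q : wop h => a *: q)).
    by rewrite scalerA divff // scale1r scaler0.
  + by rewrite actM actZ act1 scalerA mulVf // scale1r.
- move=> i x _ [p [Hp p0 px]].
  have [a [b [Ha Hb a0 E]]] := ore (inR_cder i Hp) Hp (introN eqP p0).
  exists (a * p); split; [exact: inRM|by apply: wmul_neq0 => //; apply/eqP|].
  have wXE (y : X) : act (wX h i) y = dop i y.
    by rewrite -[wX h i]mulr1 wXmul act_wd act1.
  have E2 : act p (dop i x) = - act (cder der i p) x.
    have -> : cder der i p = (wX h i * p : wop h) - (p * wX h i : wop h) :> {mpoly K[n]}.
      by rewrite wX_comm.
    by rewrite actD actN (actM (wX h i)) (actM p) px act_0 sub0r opprK wXE.
  have actNr (y : X) : act a (- y) = - act a y.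
    by apply: (@addrI _ (act a y)); rewrite -act_add !subrr act_0.
  by rewrite actM E2 actNr -[act a _]actM E actM px act_0 oppr0.
Qed.
End Torsion.

Lemma torsion_eq0 (K : fieldType) (n : nat) (der : 'I_n -> K -> K) (h : commuting_derivations der)
  d (M : dmod der) (g : seq M) : (d <= n)%N -> (forall x, gen d g x) -> lower M d ->
  forall x : M, torsion h d x -> x = 0.
Proof.
case: d => [|d] dn gM low x tx.
  have [p [/inR0P[a ->] a0]] := tx; rewrite actZ act1 => ax.
  have {}a0 : a != 0 by apply: contra_notN a0 => /eqP->; rewrite scale0r.
  by rewrite -[x]scale1r -(mulVf a0) -scalerA ax scaler0.
pose j := Ordinal dn.
have [gt Hgt] := noeth (subq_le dn (torsion_subq h d.+1 M)) (fun y _ => gM y).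
have [|e [e_gt0 [e_lb [der' [c [S [g' [Hg' gen']]]]]]]] := @noether_normalization _ _ _ h j M gt.
  move=> y yg; have [p [Hp p0 py]] : torsion h d.+1 y by apply/Hgt/gen_in.
  by exists p; split=> //; apply/eqP.
(* The lower bound survives the shift, while torsion elements now lie in a $D$-stable submodule
   finitely generated over one derivation fewer. *)
apply: (lower_tm (e_gt0 := e_gt0) (e_lb := e_lb) (S := S) low).
have [||y||C HC] := @stable_growth K n der' (tm e_gt0 e_lb S M) d (torsion h d.+1 (X := M)) g' x.
- exact: ltnW.
- exact: (subq_tm e_gt0 e_lb S (ltn_ord j) (torsion_subq h d.+1 M)).
- split=> [/Hgt/gen'//|].
  apply: gen_min; last by apply: Hg' (torsion_subq h d.+1 M) _ => z zg; apply/Hgt/gen_in.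
  apply: subq_le (ltnW dn) _; exact: (subq_tm e_gt0 e_lb S (ltn_ord j) (torsion_subq h d.+1 M)).
- exact: tx.
exists C => s; exists (C * s.+1 ^ d)%N; split; first exact: HC.
by rewrite -mulnA -expnSr.
Qed.

(** Here [k] counts the surplus derivations over which generators are known. Each normalization
    changes the derivations, so the statement quantifies over [der], and [L] is carried back along
    the inverse shift. *)
Lemma pure_embedding (K : fieldType) (n d k : nat) : forall (der : 'I_n -> K -> K),
  commuting_derivations der -> forall M : dmod der, (d + k <= n)%N ->
  (exists g : seq M, forall x, gen (d + k) g x) -> upper M d -> lower M d ->
  exists L : dmod der, [/\ fingen L, pd_le (n - d) L & exists f : M -> L, dlinear f /\ injective f].
Proof.
elim: k => [|k IH] der h M.
  rewrite addn0 => dn [g Hg] up low; apply: (embed_torsionfree (h := h) dn Hg) => p x Hp px.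
  case: (pselect (p = 0)) => p0; [by left|right].
  by apply: (torsion_eq0 dn Hg low); exists p.
rewrite addnS => dkn [g Hg] up low; pose j := Ordinal dkn.
have [|e [e_gt0 [e_lb [der' [c [S [g' [_ gen']]]]]]]] := @noether_normalization _ _ _ h j M g.
  by move=> x _; apply: (annihilator h (d := d)) => //; exact: leq_addr.
have [||||L [Lf Lpd [f [Hf finj]]]] := IH der' (shifted_comm e_gt0 e_lb S) (tm e_gt0 e_lb S M).
- exact: ltnW.
- by exists g' => x; apply: gen'.
- exact: upper_tm.
- exact: lower_tm.
pose S' := shifted_inv e_gt0 e_lb S.
exists (tm e_gt0 e_lb S' L); split; [exact: fingen_tm|exact: pd_tm|].
exists f; split=> //; exact: (dlinear_comp (tm_lin e_gt0 e_lb S' Hf) (tmK_lin e_gt0 e_lb S M)).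
Qed.

Lemma zero_pd (K : fieldType) (n : nat) (der : 'I_n -> K -> K) r (M : dmod der) :
  (forall x : M, x = 0) -> pd_le r M.
Proof.
move=> M0.
have proj : projective M.
  move=> A B p g Hp psurj Hg; exists (fun=> 0); split; first by split=> *; rewrite ?addr0 ?scaler0 ?dop0.
  move=> x; rewrite (M0 x) (qlin0 ((qlin_dlin _).1 Hp)) (qlin0 ((qlin_dlin _).1 Hg)) //.
elim: r => // r IH; exists M, M, (fun x => x), (fun x => x); split=> //.
- by move=> y; exists y.
- by move=> x; split=> [_|_]; [exists x|exact: M0].
Qed.

Theorem theorem4p1 (K : fieldType) (n : nat) (der : 'I_n -> K -> K)
  (hder : commuting_derivations der)
  (r : nat) (hr : (1 <= r)%N)
  (M : dmod der) (hM : fingen M) (hpure : pure M r) :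
  exists L : dmod der,
    [/\ fingen L, pd_le r L &
        exists f : M -> L, dlinear f /\ injective f].
Proof.
case: (pure_growth hr hpure) => [[rn [up low]]|M0]; last first.
  by exists M; split; [exact: hM|exact: (zero_pd r M0)|exists (fun x => x); split].
have [g Hg] := hM.
(* The induction starts at $k = r$, where $R_{d+k} = R_n = D$ and finite generation is the
   hypothesis on [M]. *)
have [||L [Lf Lpd Lemb]] := pure_embedding (k := r) hder (M := M) _ _ up low.
- by rewrite subnK.
- by exists g => x; rewrite subnK //; apply/Dgenerated_gen/Hg.
by exists L; split=> //; rewrite -(subKn rn).
Qed.
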